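(* For any $p\in[1,+\infty)$, the semigroup $\{\mathcal{T}(t)\}$ extends uniquely to a strongly continuous semigroup of positive contractions $\{\mathcal{T}_p(t)\}$ on $L^p(\mathbb{R}^{d+1},\nu)$. Moreover, the infinitesimal generator of $\{\mathcal{T}_p(t)\}$ is an extension of the operator $\mathcal{G}_0:C^{1,2}_c(\mathbb{R}^{d+1})\to L^p(\mathbb{R}^{d+1},\nu)$ defined by $\mathcal{G}_0f=\mathcal{G}f$ for any $f\in C^{1,2}_c(\mathbb{R}^{d+1})$, where $$\mathcal{G}u(t,x)=\mathcal{A}(t)u(t,x)-u_t(t,x),\qquad(t,x)\in\mathbb{R}^{d+1}.$$
   Context: $d\ge 1$ is an integer and $I=\mathbb{R}$. For $t\in\mathbb{R}$ and smooth $\varphi:\mathbb{R}^d\to\mathbb{R}$, $$(\mathcal{A}(t)\varphi)(x)=\sum_{i,j=1}^d q_{ij}(t,x)D_{ij}\varphi(x)+\sum_{i=1}^d b_i(t,x)D_i\varphi(x),$$ with $Q=(q_{ij})$, $b=(b_i)$. Standing assumptions: (1) for some $\alpha\in(0,1)$, all $q_{ij},b_i$ belong to $C^{\alpha/2,\alpha}_{\rm loc}(\mathbb{R}\times\mathbb{R}^d)$, i.e. they are $\alpha$-Hölder continuous with respect to the parabolic distance on every compact subset; (2) for every $(t,x)\in\mathbb{R}\times\mathbb{R}^d$ the matrix $Q(t,x)$ is symmetric, and there is a function $\eta:\mathbb{R}\times\mathbb{R}^d\to\mathbb{R}$ with $0<\eta_0:=\inf\eta$ and $\langle Q(t,x)\xi,\xi\rangle\ge\eta(t,x)|\xi|^2$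 for all $\xi\in\mathbb{R}^d$ and all $(t,x)$; (3) for every bounded interval $J\subset\mathbb{R}$ there exist $\varphi_J\in C^2(\mathbb{R}^d)$ and $\lambda_J>0$ such that $\lim_{|x|\to+\infty}\varphi_J(x)=+\infty$ and $(\mathcal{A}(t)\varphi_J)(x)-\lambda_J\varphi_J(x)\le0$ for $(t,x)\in J\times\mathbb{R}^d$; (4) there exist a nonnegative $\varphi\in C^2(\mathbb{R}^d)$ with $\varphi(x)\to+\infty$ as $|x|\to+\infty$, and constants $a,c>0$, $t_0\in\mathbb{R}$ such that $(\mathcal{A}(t)\varphi)(x)\le a-c\varphi(x)$ for $t\ge t_0$, $x\in\mathbb{R}^d$. $C_b$ denotes bounded continuous functions with the sup-norm. For every $s\in\mathbb{R}$ and $f\in C_b(\mathbb{R}^d)$ there is a unique bounded classical solution $u_f\in C_b([s,+\infty)\times\mathbb{R}^d)\cap C^{1,2}((s,+\infty)\times\mathbb{R}^d)$ of $u_t=\mathcal{A}(t)u$ in $(s,+\infty)\times\mathbb{R}^d$, $u(s,\cdot)=f$; for $t>s$, $(G(t,s)f)(x)=u_f(t,x)$, and $G(t,t)=\mathrm{id}$. There are unique Borel probability measures $p_{t,s}(x,\cdot)$ with $(G(t,s)f)(x)=\int_{\mathbb{R}^d} f(y)\,p_{t,s}(x,dy)$ for $f\in C_b(\mathbb{R}^d)$, and by this formula $G(t,s)$ is extended to the space $B_b(\mathbb{R}^d)$ of bounded Borel functions. The evolution semigroup $\{\mathcal{T}(t)\}$ associated with $\{G(t,s)\}$ on the space $C_b(\mathbb{R}^{d+1})$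 is defined by $(\mathcal{T}(t)f)(s,x)=(G(s,s-t)f(s-t,\cdot))(x)$, $(s,x)\in\mathbb{R}^{d+1}$, $t\ge0$. $(\mu_t)_{t\in\mathbb{R}}$ is an evolution system of measures for $\{G(t,s)\}$, i.e. a family of Borel probability measures on $\mathbb{R}^d$ with $\int_{\mathbb{R}^d} G(t,s)f\,d\mu_t=\int_{\mathbb{R}^d} f\,d\mu_s$ for all $f\in B_b(\mathbb{R}^d)$ and $s<t$. The map $s\mapsto\mu_s(A)$ is measurable for every Borel set $A\subset\mathbb{R}^d$, and $\nu$ is the Borel measure on $\mathbb{R}^{d+1}$ uniquely determined by $\nu(J\times K)=\int_J\mu_t(K)\,dt$ for Borel sets $J\subset\mathbb{R}$, $K\subset\mathbb{R}^d$. $C^{1,2}_c(\mathbb{R}^{d+1})$ denotes the compactly supported functions on $\mathbb{R}\times\mathbb{R}^d$ that are $C^1$ in time and $C^2$ in space. *)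

(* Defs.v *)
From HB Require Import structures.
From mathcomp Require Import all_boot all_order all_algebra.
From mathcomp Require Import all_classical all_reals all_analysis.
From mathcomp Require Import measurable_realfun.
Set Implicit Arguments.
Unset Strict Implicit.
Unset Printing Implicit Defensive.
Import Order.TTheory GRing.Theory Num.Theory.
Import numFieldNormedType.Exports.
Local Open Scope classical_set_scope.
Local Open Scope ring_scope.

(* Borel sigma-algebra on matrices, in particular on R^d = 'rV[R]_d.  With it,
   [R * 'rV[R]_d] carries both the product topology and the product
   sigma-algebra, which is the Borel sigma-algebra of R^{d+1} since both factors
   are second countable. *)
HB.instance Definition _ (R : realType) (m n : nat) :=
  Measurable.copy 'M[R]_(m, n) (g_sigma_algebraType (@open 'M[R]_(m, n))).

Section FunctionSpaces.
Context {R : realType}.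

Definition Cb {T : topologicalType} (f : T -> R) : Prop :=
  continuous f /\ bounded_fun f.

Definition Bb {d : measure_display} {T : measurableType d} (f : T -> R) : Prop :=
  measurable_fun [set: T] f /\ bounded_fun f.

Context {d : nat}.
Local Notation E := 'rV[R]_d.

(* The norm `|x| of the library on 'rV[R]_d is the sup norm. *)
Definition enorm (x : E) : R := Num.sqrt (\sum_(i < d) x 0 i ^+ 2).

Definition basis_vec (i : 'I_d) : E := delta_mx 0 i.

Definition partial (i : 'I_d) (phi : E -> R) : E -> R :=
  'D_(basis_vec i) phi.

Definition C2 (phi : E -> R) : Prop :=
  [/\ continuous phi,
      forall i x, derivable phi x (basis_vec i),
      forall i, continuous (partial i phi),
      forall i j x, derivable (partial j phi) x (basis_vec i)
    & forall i j, continuous (partial i (partial j phi))].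

Definition tends_to_infty (phi : E -> R) : Prop :=
  forall M : R, exists r : R, forall x, r < enorm x -> M < phi x.

Definition time_deriv (u : R * E -> R) (z : R * E) : R :=
  derive1 (fun t => u (t, z.2)) z.1.

Definition space_deriv (i : 'I_d) (u : R * E -> R) (z : R * E) : R :=
  partial i (fun x => u (z.1, x)) z.2.

Definition space_deriv2 (i j : 'I_d) (u : R * E -> R) (z : R * E) : R :=
  partial i (partial j (fun x => u (z.1, x))) z.2.

(* C^{1,2}(J x R^d) for an open set J of times. *)
Definition C12 (J : set R) (u : R * E -> R) : Prop :=
  forall z : R * E, J z.1 ->
  [/\ [/\ derivable (fun t => u (t, z.2)) z.1 1,
          forall i, derivable (fun x => u (z.1, x)) z.2 (basis_vec i)
        & forall i j, derivable (partial j (fun x => u (z.1, x))) z.2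
                        (basis_vec i)]
    & [/\ {for z, continuous u},
          {for z, continuous (time_deriv u)},
          forall i, {for z, continuous (space_deriv i u)}
        & forall i j, {for z, continuous (space_deriv2 i j u)}]].

Definition C12c (u : R * E -> R) : Prop :=
  C12 [set: R] u /\ compact (closure [set z | u z != 0]).

Definition parabolic_dist (z w : R * E) : R :=
  Num.sqrt (enorm (z.2 - w.2) ^+ 2 + `|z.1 - w.1|).

Definition loc_parabolic_holder (alpha : R) (g : R * E -> R) : Prop :=
  forall K : set (R * E), compact K ->
  exists C : R, forall z w, K z -> K w ->
    `|g z - g w| <= C * parabolic_dist z w `^ alpha.

End FunctionSpaces.

Section Operators.
Context {R : realType} {d : nat}.
Local Notation E := 'rV[R]_d.
Variables (q : R -> E -> 'M[R]_d) (b : R -> E -> E).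

Definition opA (t : R) (phi : E -> R) (x : E) : R :=
  \sum_(i < d) \sum_(j < d) q t x i j * partial i (partial j phi) x
  + \sum_(i < d) b t x 0 i * partial i phi x.

Definition opG (u : R * E -> R) (z : R * E) : R :=
  opA z.1 (fun x => u (z.1, x)) z.2 - time_deriv u z.

Definition coefficients_holder : Prop :=
  exists2 alpha : R, 0 < alpha < 1 &
    (forall i j, loc_parabolic_holder alpha (fun z => q z.1 z.2 i j)) /\
    (forall i, loc_parabolic_holder alpha (fun z => b z.1 z.2 0 i)).

(* [inf] of a set that is not bounded below is 0 by convention, so the
   positivity of [inf] includes the lower boundedness of eta. *)
Definition elliptic : Prop :=
  (forall t x, (q t x)^T = q t x) /\
  exists2 eta : R * E -> R, 0 < inf (range eta) &
    forall t x (xi : E),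
      eta (t, x) * enorm xi ^+ 2
      <= \sum_(i < d) \sum_(j < d) q t x i j * xi 0 j * xi 0 i.

Definition local_lyapunov : Prop :=
  forall J : set R, is_interval J -> bounded_set J ->
  exists (phi : E -> R) (lambda : R),
    [/\ C2 phi, 0 < lambda, tends_to_infty phi
      & forall t x, J t -> opA t phi x - lambda * phi x <= 0].

Definition global_lyapunov : Prop :=
  exists (phi : E -> R) (a c t0 : R),
    [/\ C2 phi, forall x, 0 <= phi x, tends_to_infty phi, 0 < a /\ 0 < c
      & forall t x, t0 <= t -> opA t phi x <= a - c * phi x].

Definition bounded_classical_solution (s : R) (f : E -> R) (u : R * E -> R)
    : Prop :=
  let D := [set z : R * E | s <= z.1] in
  [/\ {within D, continuous u}, [bounded u z | z in D], C12 [set t | s < t] u,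
      forall t x, s < t -> time_deriv u (t, x) = opA t (fun y => u (t, y)) x
    & forall x, u (s, x) = f x].

(* [G t s f x] stands for (G(t,s)f)(x), for s <= t and f bounded Borel, and
   [pts t s x] for p_{t,s}(x,dy).  [evol_wellposed] is the existence and
   uniqueness theorem by which G(t,s) is defined on C_b.  [evol_int] at f in C_b
   is the representation by p_{t,s}(x,dy), and at f in B_b it defines the
   extension of G(t,s). *)
Record evolution_operator (G : R -> R -> (E -> R) -> E -> R)
    (pts : R -> R -> E -> probability E R) : Prop := {
  evol_wellposed : forall s f, Cb f ->
    exists2 u, bounded_classical_solution s f u &
      forall v, bounded_classical_solution s f v ->
        forall z, s <= z.1 -> v z = u z ;
  evol_solution : forall s f u, Cb f -> bounded_classical_solution s f u ->
    forall t x, s < t -> G t s f x = u (t, x) ;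
  evol_id : forall t f, Bb f -> G t t f = f ;
  evol_int : forall s t x f, s < t -> Bb f ->
    (G t s f x)%:E = (\int[pts t s x]_y (f y)%:E)%E }.

End Operators.

Section Evolution.
Context {R : realType} {d : nat}.
Local Notation E := 'rV[R]_d.
Variable G : R -> R -> (E -> R) -> E -> R.

Definition evolution_semigroup (t : R) (f : R * E -> R) (z : R * E) : R :=
  G z.1 (z.1 - t) (fun x => f (z.1 - t, x)) z.2.

Definition evolution_system (mu : R -> probability E R) : Prop :=
  forall s t f, s < t -> Bb f ->
    (\int[mu t]_x (G t s f x)%:E = \int[mu s]_x (f x)%:E)%E.

End Evolution.

(* Operators on L^p(nu), 1 <= p < +oo.  An element of [LspaceType nu p1] is a
   class of measurable functions modulo nu-a.e. equality; it coerces to one of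
   its representatives, and two elements are equal iff these representatives
   are nu-a.e. equal (lemma [LspaceP]).  As the library has no vector space
   structure on this type, linear combinations are taken on representatives. *)
Section Semigroups.
Context {disp : measure_display} {T : measurableType disp} {R : realType}.
Context {nu : {measure set T -> \bar R}} {p : R} {p1 : (1 <= p%:E)%E}.
Local Notation L := (LspaceType nu p1).

Lemma LspaceP (F H : L) : F = H <-> F = H %[ae nu].
Proof.
split=> [->|]; first exact: ae_eq_refl.
case: F H => [F [[hF]]] [H [[hH]]] /= FH.
have {FH} e : F = H.
  rewrite -[F]reprK -[H]reprK; apply/eqP.
  by rewrite piE; apply/asboolP.
move: hF hH; rewrite e => hF hH.
by rewrite (Prop_irrelevance hF hH).
Qed.

Lemma Lspace_of_Lfun (f : T -> R) : f \in Lfun nu p%:E ->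
  exists F : L, F = f %[ae nu].
Proof.
move=> /[dup] fL /andP[/[1!inE] /= mf /[1!inE] /= ff].
pose f0 : {mfun T >-> measurableTypeR R} :=
  HB.pack f (isMeasurableFun.Build _ _ T (measurableTypeR R) f mf).
pose F0 : {mfun_ nu, T >-> measurableTypeR R} :=
  (\pi_({mfun_ nu, T >-> measurableTypeR R}) f0)%qT.
have F0f : F0 = f %[ae nu].
  have /eqP : (\pi_({mfun_ nu, T >-> measurableTypeR R}) (repr F0)
             = \pi_({mfun_ nu, T >-> measurableTypeR R}) f0)%qT.
    by rewrite reprK.
  by rewrite piE => /asboolP.
have mpow (g : T -> measurableTypeR R) : measurable_fun [set: T] g ->
    measurable_fun [set: T] (fun x => `|(g x)%:E| `^ p)%E.
  move=> mg; apply: (measurableT_comp (measurable_poweR _)).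
  by apply: measurableT_comp => //; exact/measurable_EFinP.
have fF0 : finite_norm nu p%:E F0.
  rewrite /finite_norm (_ : Lnorm _ _ _ = Lnorm nu p%:E (EFin \o f))//.
  rewrite unlock; congr poweR; apply: ge0_ae_eq_integral => //.
  - by apply: mpow; exact: measurable_funP.
  - exact: mpow.
  - by move=> x _; exact: poweR_ge0.
  - by move=> x _; exact: poweR_ge0.
  - by apply: filterS F0f => x /= /(_ I) -> _.
by exists (HB.pack_for L F0 (isFinLebesgue.Build _ T R nu p%:E p1 F0 fF0)).
Qed.

Definition LnormB (f g : T -> R) : \bar R :=
  Lnorm nu p%:E (fun z => (f z - g z)%:E).

Record C0_positive_contraction_semigroup (S : R -> L -> L) : Prop := {
  sg_linear : forall t a (F H K : L), 0 <= t ->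
    K = (fun z => a * F z + H z) %[ae nu] ->
    S t K = (fun z => a * S t F z + S t H z) %[ae nu] ;
  sg_zero : forall F, S 0 F = F ;
  sg_add : forall s t F, 0 <= s -> 0 <= t -> S (s + t) F = S s (S t F) ;
  sg_continuous : forall F t0, 0 <= t0 ->
    LnormB (S t F) (S t0 F) @[t --> within [set t | 0 <= t] (nbhs t0)]
      --> 0%E ;
  sg_positive : forall t (F : L), 0 <= t ->
    {ae nu, forall z, 0 <= (F z : R)} -> {ae nu, forall z, 0 <= (S t F z : R)} ;
  sg_contraction : forall t (F : L), 0 <= t ->
    (Lnorm nu p%:E (fun z => (S t F z)%:E)
     <= Lnorm nu p%:E (fun z => (F z)%:E))%E }.

(* Graph of the infinitesimal generator. *)
Definition generator (S : R -> L -> L) (F H : L) : Prop :=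
  LnormB (fun z => h^-1 * (S h F z - F z)) H @[h --> 0^'+] --> 0%E.

End Semigroups.

Section Extension.
Context {R : realType} {d : nat}.
Local Notation E := 'rV[R]_d.
Context {nu : {measure set (R * E) -> \bar R}} {p : R} {p1 : (1 <= p%:E)%E}.
Local Notation L := (LspaceType nu p1).

(* C_b is not contained in L^p(nu), because nu is infinite: S extends the
   operators A t if it agrees with them on the intersection of C_b and L^p(nu). *)
Definition extends_Cb (S : R -> L -> L)
    (A : R -> (R * E -> R) -> R * E -> R) : Prop :=
  forall t f (F : L), 0 <= t -> Cb f -> F = f %[ae nu] ->
    S t F = A t f %[ae nu].

(* The domain C^{1,2}_c is contained in L^p(nu), opG maps it to L^p(nu), and
   the resulting operator is contained in the generator of S. *)
Definition generator_extends_opG (q : R -> E -> 'M[R]_d) (b : R -> E -> E)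
    (S : R -> L -> L) : Prop :=
  forall f, C12c f -> exists F H : L,
    [/\ F = f %[ae nu], H = opG q b f %[ae nu] & generator S F H].

End Extension.

(* Main.v *)
Require Import Defs.
From HB Require Import structures.
From mathcomp Require Import all_boot all_order all_algebra.
From mathcomp Require Import all_classical all_reals all_analysis.
From mathcomp Require Import measurable_realfun.
From mathcomp Require Import ring lra.
Set Implicit Arguments.
Unset Strict Implicit.
Unset Printing Implicit Defensive.
Import Order.TTheory GRing.Theory Num.Theory.
Import numFieldNormedType.Exports.
Local Open Scope classical_set_scope.
Local Open Scope ring_scope.

(* [T(t) f = int f dK_t] for the probability kernel [K_t] that maps (s,x) to the
   law of (s - t, y), y distributed as p_{s,s-t}(x,.).  The evolution law makes K_t
   a semigroup of kernels, and [nu = int mu_t dt] is K_t-invariant because (mu_t) is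
   an evolution system and Lebesgue measure is translation invariant; by Jensen's
   inequality [f |-> int f dK_t] is then a positive contraction of L^p(nu).
   All the analysis comes from a maximum principle, with the Lyapunov functions as
   barriers at infinity.  Comparing a solution started at a cut-off function with
   its initial datum shows that p_{t,s}(x,.) concentrates at x, at a rate linear in
   t - s.  Hence T(t) f -> f pointwise as t -> 0 for continuous f, and (s,x) |->
   p_{s,s-t}(x,.) is measurable.  Strong continuity follows by dominated convergence
   for f in C_b with bounded time support; such f are dense in L^p(nu), which also
   gives uniqueness.  For f in C^{1,2}_c the same comparison shows that
   (T(h) f - f)/h converges pointwise to [opG f] and is bounded by sup |opG f|,
   and dominated convergence applies again. *)

(** * Maximum principle *)

(** Two facts must be recovered from [evolution_operator]. The evolution law comes from restarting a
    solution at a later time and using uniqueness. The dependence of G(t,s)f on s, needed because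
    K_t moves initial and final time together, comes from the concentration estimate. For the
    generator, the formula d/ds G(t,s)f = -G(t,s)A(s)f is bypassed: f itself is compared with the
    solution started from its slice, and the sign factor [sg] turns one upper estimate into both
    inequalities. The coefficients may be unbounded in space, so a comparison function is either the
    Lyapunov barrier or a cut-off, whose image under A(t) is bounded because its support is compact.
    The operators are defined on all of L^p at once by integration against K_t, instead of being
    extended from C_b by density. The price is that the integrals exist only for nu-a.e. point, so
    linearity and composition hold a.e. Although nu is infinite, a set bounded in time has finite
    measure. Multiples of indicators of such slabs are therefore the dominating functions, and for t
    <= 1 the operator T(t) widens a time support by at most 1. *)

Section PosSemidef.
Context {R : realType} {d : nat}.
Implicit Types (Q H : 'M[R]_d) (x : 'rV[R]_d).

Definition qform Q x : R := (x *m Q *m x^T) 0 0.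

Lemma qformE Q x : qform Q x = \sum_(i < d) \sum_(j < d) Q i j * x 0 j * x 0 i.
Proof.
rewrite /qform mxE exchange_big/=; apply: eq_bigr => j _.
rewrite !mxE mulr_suml; apply: eq_bigr => i _.
by rewrite [x 0 i * _]mulrC mulrAC.
Qed.

Lemma qformD Q x y : Q^T = Q ->
  qform Q (x + y) = qform Q x + (x *m Q *m y^T) 0 0 *+ 2 + qform Q y.
Proof.
move=> QT; have e : (y *m Q *m x^T) 0 0 = (x *m Q *m y^T) 0 0.
  by rewrite -[LHS]/(_) -{1}[y *m Q *m x^T]trmxK mxE !trmx_mul trmxK QT mulmxA.
rewrite /qform linearD /= !(mulmxDl, mulmxDr) !mxE; move: e; rewrite !mxE => ->.
by rewrite mulr2n; ring.
Qed.

Lemma psd_diag_ge0 Q i : (forall x, 0 <= qform Q x) -> 0 <= Q i i.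
Proof.
move=> /(_ (delta_mx 0 i)); rewrite /qform trmx_delta -rowE.
by rewrite -colE !mxE.
Qed.

(** If Q_ii = 0, the form at c e_i + e_j is affine in c with slope 2 Q_ij. A nonzero slope would
    allow a c at which the value is -1. *)
Lemma psd_diag_eq0 Q i j : Q^T = Q -> (forall x, 0 <= qform Q x) ->
  Q i i = 0 -> Q i j = 0.
Proof.
move=> QT Q0 Qii.
have key (c : R) : 0 <= c * Q i j *+ 2 + Q j j.
  have := Q0 (c *: delta_mx 0 i + delta_mx 0 j).
  rewrite qformD // /qform linearZ /= trmx_delta trmx_delta.
  rewrite -!scalemxAl -!scalemxAr -!rowE -!colE !mxE Qii !mulr0 add0r.
  by [].
apply/eqP; case: eqVneq => // Qij.
have := key (- (Q j j + 1) / (2 * Q i j)).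
have -> : - (Q j j + 1) / (2 * Q i j) * Q i j *+ 2 + Q j j = -1.
  by rewrite mulr2n; field.
by rewrite ler0N1.
Qed.

(* Cholesky: subtracting the rank-one matrix [Q_i^T Q_i / Q_ii] kills the i-th
   diagonal entry and keeps Q positive semidefinite. *)
Lemma psd_trace_le0 Q H : Q^T = Q -> (forall x, 0 <= qform Q x) ->
  (forall x, qform H x <= 0) -> \tr (Q *m H) <= 0.
Proof.
have [n] := ubnP #|[pred i | Q i i != 0]|; elim: n Q => // n IH Q leQn QT Q0 H0.
have [Qd|/existsNP[i /eqP Qii]] := pselect (forall i, Q i i = 0).
  suff -> : Q = 0 by rewrite mul0mx mxtrace0.
  by apply/matrixP => i j; rewrite mxE (psd_diag_eq0 _ QT).
have Qi0 : 0 < Q i i by rewrite lt_neqAle eq_sym Qii psd_diag_ge0.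
pose v := row i Q.
pose Q' := Q - (Q i i)^-1 *: (v^T *m v).
have Q'E k l : Q' k l = Q k l - Q i k * Q i l / Q i i.
  by rewrite !mxE big_ord1 !mxE; ring.
have -> : \tr (Q *m H) = \tr (Q' *m H) + (Q i i)^-1 * qform H v.
  rewrite /Q' mulmxBl raddfB /= -scalemxAl mxtraceZ.
  rewrite -[v^T *m v *m H]mulmxA [\tr (v^T *m _)]mxtrace_mulC /qform.
  by rewrite [\tr (v *m H *m v^T)]/mxtrace big_ord1 subrK.
have Hv : (Q i i)^-1 * qform H v <= 0 by rewrite pmulr_rle0 ?invr_gt0.
suff HQ' : \tr (Q' *m H) <= 0 by lra.
apply: IH => //.
(* The induction is on the number of nonzero diagonal entries: an index j with Q_jj = 0 has a
   vanishing row, so it keeps a zero, and i gains one. *)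
- rewrite -ltnS (leq_trans _ leQn) // ltnS; apply: proper_card.
  apply/properP; split; last by exists i; rewrite !inE// Q'E mulfK// subrr eqxx.
  apply/fintype.subsetP => j; rewrite !inE; apply: contra_neq => Qj.
  have Qij : Q i j = 0 by rewrite -QT mxE (psd_diag_eq0 _ QT).
  by rewrite Q'E Qj Qij mul0r mul0r subrr.
- by rewrite /Q' linearB /= linearZ /= trmx_mul trmxK QT.
- move=> x; set s := (x *m v^T) 0 0.
  have sE : (x *m Q) 0 i = s.
    by rewrite /s !mxE; apply: eq_bigr => k _; rewrite !mxE -{1}QT mxE.
  have sE' : (v *m x^T) 0 0 = s.
    by rewrite -[v *m x^T]trmxK trmx_mul trmxK [LHS]mxE.
  have e1 : qform Q' x = qform Q x - (Q i i)^-1 * s ^+ 2.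
    rewrite /qform /Q' mulmxBr mulmxBl -scalemxAr -scalemxAl mulmxA -mulmxA.
    rewrite [LHS]mxE [X in _ + X]mxE [X in _ - X]mxE.
    by rewrite -[x *m v^T *m v *m x^T]mulmxA [X in _ * X]mxE big_ord1 sE'.
  have dE (A : 'rV_d) : (A *m (delta_mx 0 i)^T) 0 0 = A 0 i.
    rewrite mxE (bigD1 i)//= big1 => [|j /negPf ji]; rewrite !mxE ?eqxx ?ji/=.
      by rewrite mulr1 addr0.
    by rewrite mulr0.
  have e2 c : (x *m Q *m (c *: delta_mx 0 i)^T) 0 0 = c * s.
    rewrite linearZ/= -scalemxAr mxE; congr (_ * _).
    by rewrite dE.
  have e3 c : qform Q (c *: delta_mx 0 i) = c ^+ 2 * Q i i.
    rewrite /qform linearZ/= -!scalemxAl -scalemxAr -rowE mxE mxE dE.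
    by rewrite mxE mulrA.
  (* Completing the square: Q' at x is Q at the point of x + R e_i where the form is smallest. *)
  have -> : qform Q' x = qform Q (x + (- (s / Q i i)) *: delta_mx 0 i).
    by rewrite qformD // e1 e2 e3; field.
  exact: Q0.
Qed.

End PosSemidef.

Lemma continuous_pair_right (T U : topologicalType) (t : T) :
  continuous (fun x : U => (t, x)).
Proof. by move=> x; apply: cvg_pair; [exact: cvg_cst|exact: cvg_id]. Qed.

Lemma continuous_pair_left (T U : topologicalType) (x : U) :
  continuous (fun t : T => (t, x)).
Proof. by move=> t; apply: cvg_pair; [exact: cvg_id|exact: cvg_cst]. Qed.

Section ContinuousAt.
Context {R : realType} {T : topologicalType}.
Implicit Types (f g : T -> R) (x : T).

Lemma continuous_atD f g x : continuous_at x f -> continuous_at x g ->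
  continuous_at x (fun y => f y + g y).
Proof. by move=> cf cg; apply: cvgD. Qed.

Lemma continuous_atB f g x : continuous_at x f -> continuous_at x g ->
  continuous_at x (fun y => f y - g y).
Proof. by move=> cf cg; apply: cvgB. Qed.

Lemma continuous_atM f g x : continuous_at x f -> continuous_at x g ->
  continuous_at x (fun y => f y * g y).
Proof. by move=> cf cg; apply: cvgM. Qed.

Lemma continuous_at_cst (c : R) x : continuous_at x (fun _ : T => c).
Proof. exact: cvg_cst. Qed.

End ContinuousAt.

(** * Directional derivatives from continuous partial derivatives *)

Section DirectionalDerivatives.
Context {R : realType} {d : nat}.
Local Notation E := 'rV[R]_d.
Implicit Types (g : E -> R) (x v : E).

Lemma rV_coord_le x i : `|x 0 i| <= `|x|.
Proof.
rewrite [leRHS]/Num.norm/= mx_normrE.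
exact: (le_bigmax _ (fun ij : 'I_1 * 'I_d => `|x ij.1 ij.2|) (0, i)).
Qed.

Lemma rV_norm_le x (c : R) : 0 <= c -> (forall i, `|x 0 i| <= c) -> `|x| <= c.
Proof.
move=> c0 xc; rewrite [leLHS]/Num.norm/= mx_normrE.
by apply/bigmax_leP; split => //= -[i j] _; rewrite ord1.
Qed.

Lemma rV_norm_le_enorm x : `|x| <= enorm x.
Proof.
apply: rV_norm_le => [|i]; first exact: sqrtr_ge0.
rewrite -sqrtr_sqr; apply: ler_wsqrtr; rewrite (bigD1 i)//= lerDl.
by apply: sumr_ge0 => j _; exact: sqr_ge0.
Qed.

Lemma is_derive_line g (z v : E) (t : R) (D : R) :
  is_derive (t *: v + z) v g D ->
  is_derive t (1 : R) (fun s : R => g (s *: v + z)) D.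
Proof.
have e : (fun h : R => h^-1 *: (((fun s : R => g (s *: v + z)) \o shift t) (h *: 1) - g (t *: v + z)))
  = (fun h : R => h^-1 *: ((g \o shift (t *: v + z)) (h *: v) - g (t *: v + z))).
  apply/funext => h /=; congr (_ *: (g _ - _)).
  by rewrite [h *: 1]mulr1 scalerDl addrA.
move=> [dg <-]; split; first by move: dg; rewrite /derivable -e.
by rewrite /derive -e.
Qed.

Lemma mean_value_bound (h dh : R -> R) (c e a : R) :
  (forall t : R, `|t| <= `|a| -> is_derive t (1 : R) h (dh t)) ->
  (forall t, `|t| <= `|a| -> `|dh t - c| <= e) ->
  `|h a - h 0 - a * c| <= e * `|a|.
Proof.
move=> hd he.
have e0 : 0 <= e by apply: le_trans (he 0 _); rewrite ?normr0.
have key (l r : R) : l <= r -> (forall t, l <= t <= r -> `|t| <= `|a|) ->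
    exists2 t, `|t| <= `|a| & h r - h l = dh t * (r - l).
  move=> lr sub.
  have hd' (t : R) : t \in `]l, r[ -> is_derive t (1 : R) h (dh t).
    rewrite in_itv/= => /andP[/ltW lt /ltW tr].
    by apply: hd; apply: sub; rewrite lt tr.
  have cont : {within `[l, r], continuous h}.
    apply: derivable_within_continuous => t; rewrite in_itv/= => ltr.
    exact: (@ex_derive _ _ _ _ _ _ _ (hd t (sub t ltr))).
  have [t + ->] := @MVT_segment R h dh l r lr hd' cont.
  by rewrite in_itv/= => ltr; exists t => //; exact: sub.
case: (leP 0 a) => a0.
  have [|t ta ->] := key 0 a a0.
    by move=> t /andP[t0 ta]; rewrite !ger0_norm.
  rewrite subr0 mulrC -mulrBr normrM mulrC ler_wpM2r//.
  exact: he.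
have [|t ta] := key a 0 (ltW a0).
  by move=> t /andP[t0 ta]; rewrite !ler0_norm ?lerN2// ltW.
rewrite sub0r -opprB => /(congr1 -%R); rewrite opprK => ->.
rewrite mulrN opprK mulrC -mulrBr normrM mulrC ler_wpM2r//.
exact: he.
Qed.

(** The path from x to y changes one coordinate at a time. It stays in the sup-norm ball around x,
    and the mean value theorem applies on each of its d pieces. *)
Lemma partial_increment_bound g x (e r : R) :
  (forall i y, derivable g y (basis_vec i)) ->
  (forall i y, `|y - x| < r -> `|partial i g y - partial i g x| <= e) ->
  forall y, `|y - x| < r ->
  `|g y - g x - \sum_(i < d) (y - x) 0 i * partial i g x|
    <= e * \sum_(i < d) `|(y - x) 0 i|.
Proof.
move=> dg He y yr.
pose z (k : nat) : E := \row_j (if (j < k)%N then y 0 j else x 0 j).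
have zd : z d = y by apply/rowP => j; rewrite mxE ltn_ord.
have z0 : z 0%N = x by apply/rowP => j; rewrite mxE.
have -> : g y - g x = \sum_(k < d) (g (z k.+1) - g (z k)).
  rewrite -{1}zd -{1}z0 -(big_mkord xpredT (fun k => g (z k.+1) - g (z k))).
  by rewrite telescope_sumr.
rewrite -sumrB mulr_sumr (le_trans (ler_norm_sum _ _ _))//.
apply: ler_sum => k _.
pose a := (y - x) 0 k.
have zS : z k.+1 = a *: basis_vec k + z k.
  apply/rowP => j; rewrite /a !mxE /= ltnS leq_eqVlt.
  have [->|jk] := eqVneq j k; first by rewrite eqxx ltnn/= mulr1 subrK.
  by rewrite val_eqE (negPf jk) /= mulr0 add0r.
have zk : z k = 0 *: basis_vec k + z k by rewrite scale0r add0r.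
rewrite zS [in X in _ - X - _]zk.
apply: (@mean_value_bound (fun t : R => g (t *: basis_vec k + z k))
  (fun t : R => partial k g (t *: basis_vec k + z k))) => t ta.
  by apply: is_derive_line; apply/derivableP.
apply: He; apply: le_lt_trans yr.
apply: rV_norm_le => // j; rewrite !mxE /=.
have [->|jk] := eqVneq j k.
  rewrite mulr1 ltnn addrK (le_trans ta)// /a.
  exact: rV_coord_le.
rewrite mulr0 add0r; case: ifP => _; last by rewrite subrr normr0.
by have := rV_coord_le (y - x) j; rewrite !mxE.
Qed.

(** [C2] speaks of partial derivatives only, while the second-derivative test for an elliptic
    operator needs derivatives along every direction v. *)
Lemma is_derive_partial g x v :
  (forall i y, derivable g y (basis_vec i)) ->
  (forall i, {for x, continuous (partial i g)}) ->
  is_derive x v g (\sum_(i < d) v 0 i * partial i g x).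
Proof.
move=> dg cg; set D := \sum_(i < d) _.
suff H : h^-1 *: ((g \o shift x) (h *: v) - g x) @[h --> 0^'] --> D.
  split; first by apply/cvg_ex; exists D.
  exact: cvg_lim H.
pose S := \sum_(i < d) `|v 0 i|.
have S0 : 0 <= S by exact: sumr_ge0.
apply/cvgrPdist_le => /= e e0.
have eS : 0 < e / (S + 1) by rewrite divr_gt0// ltr_wpDl.
have nearx : \forall y \near x,
    forall i, `|partial i g y - partial i g x| <= e / (S + 1).
  refine (@filter_forall _ _
    (fun i y => `|partial i g y - partial i g x| <= e / (S + 1)) (nbhs x) _ _).
  move=> i; have /cvgrPdist_le/(_ _ eS) := cg i.
  by apply: filterS => y; rewrite distrC.
have /nbhs_ballP[r /= r0 xr] := nearx.
have rv : 0 < r / (`|v| + 1) by rewrite divr_gt0// ltr_wpDl.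
near=> h.
have h0 : h != 0 by near: h; exact: nbhs_dnbhs_neq.
have hr : `|h| < r / (`|v| + 1).
  near: h; apply: nbhs_dnbhs; apply/nbhs_ballP; exists (r / (`|v| + 1)) => // y.
  by rewrite -ball_normE/= sub0r normrN.
have hv : `|(h *: v + x) - x| < r.
  rewrite addrK normrZ (@le_lt_trans _ _ (`|h| * (`|v| + 1)))//.
    by rewrite ler_wpM2l// lerDl.
  by rewrite -ltr_pdivlMr// ltr_wpDl.
have := @partial_increment_bound g x (e / (S + 1)) r dg _ _ hv.
have -> : \sum_(i < d) (h *: v + x - x) 0 i * partial i g x = h * D.
  by rewrite mulr_sumr; apply: eq_bigr => i _; rewrite addrK mxE mulrA.
have -> : \sum_(i < d) `|(h *: v + x - x) 0 i| = `|h| * S.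
  by rewrite mulr_sumr; apply: eq_bigr => i _; rewrite addrK mxE normrM.
move=> /(_ _)/le_trans => H.
have {}H : `|g (h *: v + x) - g x - h * D| <= `|h| * e.
  apply: H; last first.
    rewrite mulrCA ler_wpM2l// -mulrAC ler_pdivrMr ?ltr_wpDl//.
    by rewrite ler_wpM2l ?ltW// ltrDl.
  by move=> i y yx; apply: xr; rewrite -ball_normE/= distrC.
rewrite distrC -(ler_pM2l (_ : 0 < `|h|)) ?normr_gt0// -normrM mulrBr.
by rewrite mulVKf.
Unshelve. all: by end_near. Qed.

End DirectionalDerivatives.

Section MaximumPrinciple.
Context {R : realType} {d : nat}.
Local Notation E := 'rV[R]_d.

(** If c were positive, [dh], which vanishes at 0, would be positive just to the right of 0, and the
    mean value theorem would give a value of h above h 0. *)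
Lemma max_derivatives1 (h dh : R -> R) (c : R) :
  (forall t : R, is_derive t (1 : R) h (dh t)) -> is_derive (0 : R) (1 : R) dh c ->
  (forall t, h t <= h 0) -> dh 0 = 0 /\ c <= 0.
Proof.
move=> hd dhd hmax.
have dh0 : dh 0 = 0.
  have h0 : is_derive (0 : R) (1 : R) h 0.
    apply: (@derive1_at_max _ h (-1) 1 0) => //.
    by rewrite in_itv/= ltrN10 ltr01.
  by rewrite -(@derive_val _ _ _ _ _ _ _ (hd 0)) (@derive_val _ _ _ _ _ _ _ h0).
split=> //; rewrite leNgt; apply/negP => c0.
have : t^-1 *: ((dh \o shift 0) (t *: 1) - dh 0) @[t --> 0^'] --> c.
  by case: dhd => /cvg_ex[l hl]; rewrite /derive (cvg_lim _ hl)// => <-.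
move=> /cvgrPdist_lt/(_ _ c0)/=.
move=> /nbhs_ballP[r /= r0 rP].
have rr : r / 2 < r by rewrite gtr_pMr// invf_lt1// ltr1n.
have r20 : 0 < r / 2 by rewrite divr_gt0.
have cont : {within `[0, r / 2], continuous h}.
  apply: derivable_within_continuous => t _.
  exact: (@ex_derive _ _ _ _ _ _ _ (hd t)).
have [t] := @MVT R h dh 0 (r / 2) r20 (fun t _ => hd t) cont.
rewrite in_itv/= => /andP[t0 tr] e.
have : 0 < dh t.
  have := rP t; rewrite -ball_normE/= sub0r normrN gtr0_norm// => /(_ (lt_trans tr rr)).
  move=> /(_ (lt0r_neq0 t0)); rewrite dh0 subr0 addr0 [_ *: 1]mulr1.
  rewrite ltr_norml => /andP[_]; rewrite ltrBlDl ltrDr.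
  by rewrite pmulr_rgt0// invr_gt0.
have := hmax (r / 2); rewrite -subr_le0 e subr0 => le0 dt.
by move: le0; rewrite leNgt mulr_gt0.
Qed.

Lemma C2_max_derivatives (g : E -> R) (x : E) : C2 g ->
  (forall y, g y <= g x) ->
  (forall i, partial i g x = 0) /\
  forall v : E, \sum_(i < d) \sum_(j < d)
    v 0 i * v 0 j * partial j (partial i g) x <= 0.
Proof.
move=> [_ dg cg ddg cdg] gmax.
have main (v : E) : \sum_(i < d) v 0 i * partial i g x = 0 /\
    \sum_(i < d) \sum_(j < d) v 0 i * v 0 j * partial j (partial i g) x <= 0.
  pose h (t : R) := g (t *: v + x).
  pose dh (t : R) := \sum_(i < d) v 0 i * partial i g (t *: v + x).
  have hd (t : R) : is_derive t (1 : R) h (dh t).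
    by apply: is_derive_line; apply: is_derive_partial => // i; exact: cg.
  have := @max_derivatives1 h dh
    (\sum_(i < d) v 0 i * \sum_(j < d) v 0 j * partial j (partial i g) x) hd.
  rewrite /dh /h !scale0r !add0r => -[|t|-> c0].
  - rewrite (_ : (fun t : R => _) =
      \sum_(i < d) (fun t : R => v 0 i *: partial i g (t *: v + x))); last first.
      by apply/funext => t; rewrite fct_sumE.
    apply: is_derive_sum => i.
    apply: (@is_deriveZ _ _ _ (fun t : R => partial i g (t *: v + x))).
    apply: is_derive_line; rewrite scale0r add0r.
    apply: (@is_derive_partial _ _ (partial i g) x v) => [j y|j].
      exact (ddg j i y).
    exact (cdg j i x).
  - exact: gmax.
  - split=> //; apply: le_trans c0; rewrite le_eqVlt; apply/orP; left.
    apply/eqP; apply: eq_bigr => i _; rewrite mulr_sumr.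
    by apply: eq_bigr => j _; rewrite mulrA.
split=> [i|v]; last by have [] := main v.
have [+ _] := main (basis_vec i); rewrite (bigD1 i)//= mxE !eqxx mul1r.
rewrite big1 ?addr0// => j ji; by rewrite mxE (negPf ji) mul0r.
Qed.

Variables (q : R -> E -> 'M[R]_d) (b : R -> E -> E).

Lemma elliptic_qform_ge0 : elliptic q -> forall t x v, 0 <= qform (q t x) v.
Proof.
move=> [_ [eta inf0 etaP]] t x v; rewrite qformE; apply: le_trans (etaP t x v).
rewrite mulr_ge0 ?exprn_ge0 ?sqrtr_ge0//.
have [hi|hi] := pselect (has_inf (range eta)); last first.
  by move: inf0; rewrite inf_out// ltxx.
by apply: le_trans (ltW inf0) _; apply: ge_inf; [case: hi|exists (t, x)].
Qed.

(** The gradient vanishes at the maximum, which removes the drift; what remains is the trace of Q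
    times the negative semidefinite Hessian. *)
Lemma opA_max_le0 t (g : E -> R) x : elliptic q -> C2 g ->
  (forall y, g y <= g x) -> opA q b t g x <= 0.
Proof.
move=> ell g2 gmax; have [g1 gH] := C2_max_derivatives g2 gmax.
rewrite /opA [X in _ + X]big1 ?addr0 => [|i _]; last by rewrite g1 mulr0.
pose H : 'M[R]_d := \matrix_(j, i) partial i (partial j g) x.
suff : \tr (q t x *m H) <= 0.
  rewrite /mxtrace; apply: le_trans; rewrite le_eqVlt; apply/orP; left.
  apply/eqP; apply: eq_bigr => i _; rewrite mxE; apply: eq_bigr => j _.
  by rewrite mxE.
apply: psd_trace_le0; [by case: ell|exact: elliptic_qform_ge0|] => v.
rewrite qformE; apply: le_trans (gH v); rewrite le_eqVlt; apply/orP; left.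
apply/eqP; apply: eq_bigr => i _; apply: eq_bigr => j _; rewrite mxE.
by ring.
Qed.


(** The shape f + (k g + k0) covers every combination needed later: differences with k = -1,
    subtraction of the barrier and of constants, and the multiple k f as f + ((k - 1) f + 0). *)
Lemma is_derive_affine (f g : E -> R) (k k0 : R) x v :
  derivable f x v -> derivable g x v ->
  is_derive x v (fun y => f y + (k * g y + k0)) ('D_v f x + k * 'D_v g x).
Proof.
move=> df dg; rewrite -[X in is_derive _ _ _ X]addr0 -addrA.
apply: (@is_deriveD _ _ _ f (fun y => k * g y + k0)); first exact: derivableP.
apply: (@is_deriveD _ _ _ (fun y => k * g y) (cst k0)).
by apply: (@is_deriveZ _ _ _ g); exact: derivableP.
Qed.

Lemma partial_affine (f g : E -> R) (k k0 : R) i :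
  (forall y, derivable f y (basis_vec i)) ->
  (forall y, derivable g y (basis_vec i)) ->
  partial i (fun y => f y + (k * g y + k0)) =
  (fun y => partial i f y + (k * partial i g y + 0)).
Proof.
move=> df dg; apply/funext => y; rewrite addr0.
exact: (@derive_val _ _ _ _ _ _ _ (is_derive_affine k k0 (df y) (dg y))).
Qed.

Lemma partial2_affine (f g : E -> R) (k k0 : R) i j x : C2 f -> C2 g ->
  partial i (partial j (fun y => f y + (k * g y + k0))) x =
  partial i (partial j f) x + k * partial i (partial j g) x.
Proof.
move=> [f0 f1 f2 f3 f4] [g0 g1 g2 g3 g4].
rewrite (partial_affine k k0 (f1 j) (g1 j)).
by rewrite (partial_affine k 0 (f3 i j) (g3 i j)) addr0.
Qed.

Lemma continuous_affine (T : topologicalType) (f g : T -> R) (k k0 : R) x :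
  {for x, continuous f} -> {for x, continuous g} ->
  {for x, continuous (fun y => f y + (k * g y + k0))}.
Proof.
move=> cf cg; apply: continuous_atD => //.
apply: continuous_atD; last exact: continuous_at_cst.
by apply: continuous_atM => //; exact: continuous_at_cst.
Qed.

Lemma C2_affine (f g : E -> R) (k k0 : R) : C2 f -> C2 g ->
  C2 (fun y => f y + (k * g y + k0)).
Proof.
move=> [f0 f1 f2 f3 f4] [g0 g1 g2 g3 g4]; split.
- by move=> x; apply: continuous_affine; [exact: f0|exact: g0].
- by move=> i x; apply: (@ex_derive _ _ _ _ _ _ _ (is_derive_affine _ _ (f1 i x) (g1 i x))).
- move=> i x; rewrite partial_affine//.
  by apply: continuous_affine; [exact: f2|exact: g2].
- move=> i j x; rewrite partial_affine//.
  by apply: (@ex_derive _ _ _ _ _ _ _ (is_derive_affine _ _ (f3 i j x) (g3 i j x))).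
- move=> i j x; rewrite partial_affine// partial_affine//.
  by apply: continuous_affine; [exact: f4|exact: g4].
Qed.

Lemma opA_affine t (f g : E -> R) (k k0 : R) x : C2 f -> C2 g ->
  opA q b t (fun y => f y + (k * g y + k0)) x =
  opA q b t f x + k * opA q b t g x.
Proof.
move=> f2 g2; rewrite /opA mulrDr addrACA; congr (_ + _).
  rewrite mulr_sumr -big_split/=; apply: eq_bigr => i _.
  rewrite mulr_sumr -big_split/=; apply: eq_bigr => j _.
  by rewrite partial2_affine// mulrDr; congr (_ + _); rewrite mulrCA.
rewrite mulr_sumr -big_split/=; apply: eq_bigr => i _.
have [_ f1 _ _ _] := f2; have [_ g1 _ _ _] := g2.
by rewrite (partial_affine k k0 (f1 i) (g1 i)) addr0 mulrDr mulrCA.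
Qed.

Lemma C12_slice (J : set R) (u : R * E -> R) t : C12 J u -> J t ->
  C2 (fun x => u (t, x)).
Proof.
move=> u12 Jt; have pairc (h : R * E -> R) (x : E) : {for (t, x), continuous h} ->
    {for x, continuous (fun y : E => h (t, y))}.
  move=> hc; apply: (@continuous_comp _ _ _ (fun y : E => (t, y)) h) => //.
  exact: continuous_pair_right.
split.
- by move=> x; have [_ [+ _ _ _]] := u12 (t, x) Jt; exact: pairc.
- by move=> i x; have [[_ + _] _] := u12 (t, x) Jt; exact.
- move=> i x; have [_ [_ _ + _]] := u12 (t, x) Jt => /(_ i)/pairc; exact.
- by move=> i j x; have [[_ _ +] _] := u12 (t, x) Jt; exact.
- move=> i j x; have [_ [_ _ _ +]] := u12 (t, x) Jt => /(_ i j)/pairc; exact.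
Qed.

(** One-sided, because the maximum over a time interval may sit at its right end, where only earlier
    times can be compared. *)
Lemma is_derive_left_max (h : R -> R) (s t0 D : R) : s < t0 ->
  is_derive t0 (1 : R) h D -> (forall t, s <= t <= t0 -> h t <= h t0) -> 0 <= D.
Proof.
move=> st0 [dh Dh] hmax; rewrite leNgt; apply/negP => D0.
have : t^-1 *: ((h \o shift t0) (t *: 1) - h t0) @[t --> 0^'] --> D.
  by move: dh Dh => /cvg_ex[l hl]; rewrite /derive (cvg_lim _ hl)// => <-.
move=> /cvgrPdist_lt/(_ (- D)); rewrite oppr_gt0 => /(_ D0)/nbhs_ballP[r /= r0 rP].
pose t := Num.min (r / 2) (t0 - s).
have tp : 0 < t by rewrite lt_min divr_gt0//= subr_gt0.
have tr : t < r.
  by rewrite gt_min gtr_pMr// invf_lt1// ltr1n.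
have := rP (- t); rewrite -ball_normE/= sub0r opprK gtr0_norm// => /(_ tr).
rewrite oppr_eq0 => /(_ (lt0r_neq0 tp)); rewrite [_ *: 1]mulr1.
rewrite ltr_norml opprK => /andP[+ _]; rewrite ltrBrDr gtrDl => H.
have : h (- t + t0) <= h t0.
  have : t <= t0 - s by rewrite ge_min lexx orbT.
  by move: tp => tp' ts; apply: hmax; lra.
rewrite -subr_le0 => hh; move: H; rewrite ltNge; apply/negP; rewrite negbK.
by rewrite mulr_le0// invr_le0 oppr_le0 ltW.
Qed.

(** The local Lyapunov functions may take negative values, so phi - m serves as barrier. The sign of
    m keeps it a supersolution: A(t)(phi - m) <= l phi <= l (phi - m). *)
Lemma tends_to_infty_lbound (phi : E -> R) : continuous phi ->
  tends_to_infty phi -> exists2 m : R, m <= 0 & forall x, m <= phi x.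
Proof.
move=> cphi phioo; have [r rP] := phioo 0.
pose K := [set x : E | `|x| <= Num.max r 0].
have cK : compact K.
  apply: bounded_closed_compact.
    exists (Num.max r 0); split; first exact: num_real.
    by move=> M rM x /= /le_trans; apply; exact: ltW.
  rewrite (_ : K = (fun x : E => `|x|) @^-1` [set y | y <= Num.max r 0])//.
  by apply: closed_comp; [move=> x _; exact: norm_continuous|exact: closed_le].
have K0 : K !=set0 by exists 0; rewrite /K/= normr0 le_max lexx orbT.
have [x xK xm] := compact_EVT_min K0 cK (continuous_subspaceT cphi).
exists (Num.min (phi x) 0); first by rewrite ge_min lexx orbT.
move=> y; have [yK|] := boolP (y \in K); first by rewrite ge_min xm.
rewrite notin_setE/= => /negP; rewrite -ltNge gt_max => /andP[ry _].
rewrite ge_min; apply/orP; right; apply/ltW/rP.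
exact: lt_le_trans ry (rV_norm_le_enorm y).
Qed.

Lemma compact_slab (s T r : R) : compact [set z : R * E | s <= z.1 <= T /\ `|z.2| <= r].
Proof.
rewrite (_ : mkset _ = `[s, T]%classic `*` [set x : E | `|x| <= r]); last first.
  by apply/seteqP; split => -[t x] /=; rewrite in_itv.
apply: compact_setX; first exact: segment_compact.
apply: bounded_closed_compact.
  exists r; split; first exact: num_real.
  by move=> M rM x /= /le_trans; apply; exact: ltW.
rewrite (_ : mkset _ = (fun x : E => `|x|) @^-1` [set y | y <= r])//.
by apply: closed_comp; [move=> x _; exact: norm_continuous|exact: closed_le].
Qed.

(* The Lyapunov function is the barrier at infinity: [w - (c + e)(t - s) -
   e exp(l(t - s)) phi] cannot have a positive maximum on [s, T] x R^d. *)
Lemma maximum_principle (s T c M : R) (w : R * E -> R) :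
  elliptic q -> local_lyapunov q b ->
  {within [set z | s <= z.1 <= T], continuous w} ->
  (forall t x, s <= t <= T -> w (t, x) <= M) ->
  (forall t x, s < t <= T -> derivable (fun r => w (r, x)) t 1) ->
  (forall t, s < t <= T -> C2 (fun y => w (t, y))) ->
  (forall t x, s < t <= T ->
    time_deriv w (t, x) <= opA q b t (fun y => w (t, y)) x + c) ->
  (forall x, w (s, x) <= 0) ->
  forall t x, s <= t <= T -> w (t, x) <= c * (t - s).
Proof.
move=> ell lyap wc wM dw w2 wA w0 t1 x1 t1sT.
have [||phi [l [phi2 l0 phioo phiA]]] := lyap `[s, T]%classic.
- exact: interval_is_interval.
- exact: compact_bounded (@segment_compact _ s T).
have [m m0 mphi] := tends_to_infty_lbound (let: And5 c _ _ _ _ := phi2 in c) phioo.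
have psi0 x : 0 <= phi x - m by rewrite subr_ge0.
pose ex (t : R) := expR (l * (t - s)).
have ex1 t : s <= t -> 1 <= ex t.
  by move=> st; rewrite -expR0 ler_expR mulr_ge0 ?subr_ge0// ltW.
(* exp(l(t - s)) (phi - m) is a supersolution of the equation, and the extra e in the slope c + e
   makes the final inequality strict. *)
pose Z (e : R) (z : R * E) :=
  w z - ((c + e) * (z.1 - s) + e * (ex z.1 * (phi z.2 - m))).
suff HZ e : 0 < e -> Z e (t1, x1) <= 0.
  apply/ler_addgt0Pr => e e0.
  (* The correction to w at (t1, x1) is e times a fixed factor at most K, so rescaling e by K makes
     it smaller than any given amount; the summand 1 keeps K positive. *)
  pose K := t1 - s + ex t1 * (phi x1 - m) + 1.
  have K0 : 0 < K.
    have := psi0 x1; have/ex1 := proj1 (andP t1sT); move: t1sT => /andP[? ?] ? ?.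
    by rewrite ltr_wpDl// addr_ge0 ?subr_ge0// mulr_ge0// (le_trans ler01).
  have := HZ (e / K) (divr_gt0 e0 K0); rewrite /Z/= subr_le0 => /le_trans; apply.
  rewrite [X in X + _]mulrDl -addrA lerD2l -mulrDr.
  rewrite -[leRHS](divfK (lt0r_neq0 K0)) (ler_pM2l (divr_gt0 e0 K0)).
  by rewrite /K lerDl.
move=> e0; rewrite leNgt; apply/negP => Zpos.
have sT : s <= T by case/andP: t1sT => /le_trans; exact.
pose B := `|M| + `|c + e| * (T - s).
have ZB t x : s <= t <= T -> Z e (t, x) <= B - e * (phi x - m).
  move=> /[dup] stT /andP[st tT]; rewrite /Z /= opprD addrA lerB//.
    rewrite /B lerD//; first by rewrite (le_trans (wM _ _ stT))// ler_norm.
    rewrite -mulNr (le_trans (ler_norm _))// normrM normrN ler_wpM2l//.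
    by rewrite ger0_norm ?subr_ge0// lerB.
  by rewrite (ler_pM2l e0) ler_peMl// ex1.
(* Beyond this radius e (phi - m) exceeds B, which bounds the rest of Z, so Z is nonpositive there.
   The radius [rho] must also enclose x1. *)
have [r rP] := phioo (m + B / e).
pose rho := Num.max r `|x1|.
have Zout t x : s <= t <= T -> rho < `|x| -> Z e (t, x) <= 0.
  move=> stT; rewrite gt_max => /andP[rx _]; apply: le_trans (ZB _ _ stT) _.
  rewrite subr_le0 -ler_pdivrMl// mulrC lerBrDl; apply/ltW/rP.
  exact: lt_le_trans rx (rV_norm_le_enorm x).
pose K := [set z : R * E | s <= z.1 <= T /\ `|z.2| <= rho].
have K1 : K (t1, x1) by split => //=; rewrite le_max lexx orbT.
have Zc : {within K, continuous (Z e)}.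
  apply: (@continuous_subspaceW _ _ _ [set z | s <= z.1 <= T]).
    by move=> z [].
  apply: within_continuousB => //; apply: continuous_subspaceT => z.
  have c1 : {for z, continuous (fun z : R * E => z.1 - s)}.
    by apply: continuous_atB; [exact: cvg_fst|exact: continuous_at_cst].
  have c2 : {for z, continuous (fun z : R * E => ex z.1)}.
    apply: (@continuous_comp _ _ _ (fun z : R * E => l * (z.1 - s)) expR).
      by apply: continuous_atM; [exact: continuous_at_cst|exact: c1].
    exact: continuous_expR.
  have c3 : {for z, continuous (fun z : R * E => phi z.2 - m)}.
    apply: continuous_atB; last exact: continuous_at_cst.
    apply: (@continuous_comp _ _ _ snd phi); first exact: cvg_snd.
    by case: phi2 => + _ _ _ _; exact.
  change {for z, continuous (fun x : R * E =>
    (c + e) * (x.1 - s) + e * (ex x.1 * (phi x.2 - m)))}.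
  apply: continuous_atD.
    by apply: continuous_atM; [exact: continuous_at_cst|exact: c1].
  apply: continuous_atM; first exact: continuous_at_cst.
  by apply: continuous_atM; [exact: c2|exact: c3].
have [[t0 x0]] := compact_EVT_max (ex_intro _ _ K1) (@compact_slab s T rho) Zc.
rewrite inE => -[/= stT x0rho] ZmaxK.
have Zp : 0 < Z e (t0, x0).
  by apply: lt_le_trans Zpos _; apply: ZmaxK; rewrite inE.
have Zmax t x : s <= t <= T -> Z e (t, x) <= Z e (t0, x0).
  move=> tsT; have [xr|xr] := leP `|x| rho; first by apply: ZmaxK; rewrite inE.
  exact: le_trans (Zout _ _ tsT xr) (ltW Zp).
have st0 : s < t0.
  rewrite lt_neqAle; case/andP: stT => -> _; rewrite andbT.
  apply/eqP => st0; move: Zp; rewrite -st0 ltNge; apply/negP; rewrite negbK.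
  rewrite /Z/= subrr mulr0 add0r subr_le0 (le_trans (w0 _))//.
  by rewrite mulr_ge0// ?mulr_ge0 ?expR_ge0//; exact: ltW.
have st0T : s < t0 <= T by rewrite st0; case/andP: stT.
have wt : is_derive t0 (1 : R) (fun r : R => w (r, x0)) (time_deriv w (t0, x0)).
  by rewrite /time_deriv/= derive1E; apply: derivableP; exact: dw.
have Zt : is_derive t0 (1 : R) (fun r : R => Z e (r, x0))
    (time_deriv w (t0, x0) - ((c + e) + e * (l * ex t0 * (phi x0 - m)))).
  have d1 (k a : R) : is_derive t0 (1 : R) (fun r : R => k * (r - a)) k.
    have := @is_deriveZ _ _ _ (fun r : R => r - a) k t0 1 1 _.
    rewrite [k *: 1]mulr1; apply.
    rewrite -[X in is_derive _ _ _ X]subr0.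
    exact: is_deriveB (is_derive_id t0 1) (is_derive_cst a t0 1).
  have d2 : is_derive t0 (1 : R) (fun r : R => ex r) (ex t0 * l).
    exact: (@is_derive1_comp _ expR (fun r : R => l * (r - s)) t0 _ _
      (is_derive_expR _) (d1 l s)).
  apply: is_deriveB wt _; apply: (is_deriveD (d1 _ _)).
  rewrite [l * _]mulrC.
  apply: (@is_deriveZ _ _ _ (fun r : R => ex r * (phi x0 - m))).
  have := @is_deriveZ _ _ _ (fun r : R => ex r) (phi x0 - m) t0 1 _ d2.
  rewrite [_ *: (ex t0 * l)]mulrC => dex.
  rewrite (_ : (fun r : R => _) = (phi x0 - m) \*: ex)//.
  by apply/funext => r'; rewrite mulrC.
have Zt0 : 0 <= time_deriv w (t0, x0) - ((c + e) + e * (l * ex t0 * (phi x0 - m))).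
  apply: (is_derive_left_max st0 Zt) => t /andP[st tt0]; apply: Zmax.
  by rewrite st (le_trans tt0)//; case/andP: stT.
pose k0 := e * ex t0 * m - (c + e) * (t0 - s).
have ZE : (fun x => Z e (t0, x)) = (fun x => w (t0, x) + (- (e * ex t0) * phi x + k0)).
  by apply/funext => x; rewrite /Z /k0/=; ring.
have ZC2 : C2 (fun x => Z e (t0, x)) by rewrite ZE; exact (C2_affine (- (e * ex t0)) k0 (w2 t0 st0T) phi2).
have : opA q b t0 (fun x => Z e (t0, x)) x0 <= 0.
  by apply: opA_max_le0 => // y; apply: Zmax.
rewrite ZE (opA_affine t0 (- (e * ex t0)) k0 x0 (w2 t0 st0T) phi2).
have := wA t0 x0 st0T; have := phiA t0 x0; rewrite /= in_itv/= => /(_ stT).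
have ee : 0 < e * ex t0 by rewrite mulr_gt0// expR_gt0.
move: Zt0; set a1 := time_deriv _ _; set a2 := opA _ _ _ _ _; set a3 := opA _ _ _ _ _.
move=> h1 h2 h3 h4.
(* The inequalities at (t0, x0) chain to e <= e (ex t0) l m, whose right side is nonpositive,
   against 0 < e. *)
have : e * ex t0 * a2 <= e * ex t0 * (l * phi x0) by rewrite ler_pM2l// -subr_le0.
have : e * ex t0 * l * m <= 0 by rewrite mulr_ge0_le0// mulr_ge0// ltW.
move: h1 h3 h4; rewrite mulNr.
move: (ex t0) ee => x ee; nra.
Qed.

End MaximumPrinciple.

(** * Cut-off functions *)

Lemma continuous_at_sum {R : realType} (T : topologicalType) (I : Type)
    (r : seq I) (F : I -> T -> R) x : (forall i, continuous_at x (F i)) ->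
  continuous_at x (fun y => \sum_(i <- r) F i y).
Proof.
move=> cF; elim: r => [|i r IH].
  rewrite (_ : (fun y => _) = fun=> 0); last by apply/funext => y; rewrite big_nil.
  exact: continuous_at_cst.
rewrite (_ : (fun y => _) = fun y => F i y + \sum_(j <- r) F j y); last first.
  by apply/funext => y; rewrite big_cons.
exact: continuous_atD.
Qed.

Section Bump.
Context {R : realType} {d : nat}.
Local Notation E := 'rV[R]_d.

(** The n-th power of the positive part, of class C^(n-1). Its cube is the C^2 profile of the
    cut-off function, with explicit derivatives. *)
Definition pospow (n : nat) (r : R) : R := Num.max 0 r ^+ n.

Lemma pospow_le0 n r : r <= 0 -> pospow n.+1 r = 0.
Proof. by move=> r0; rewrite /pospow max_l// expr0n. Qed.

Lemma pospow_ge0 n r : 0 <= pospow n r.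
Proof. by rewrite exprn_ge0// le_max lexx. Qed.

Lemma continuous_pospow n : continuous (pospow n).
Proof.
move=> r; apply: (@continuous_comp _ _ _ (fun r : R => Num.max 0 r) (fun r : R => r ^+ n)).
  by apply: continuous_max; [exact: cvg_cst|exact: cvg_id].
exact: exprn_continuous.
Qed.

Lemma is_derive_pospow n (r : R) :
  is_derive r (1 : R) (pospow n.+2) (n.+2%:R * pospow n.+1 r).
Proof.
have [r0|r0|r0] := ltgtP r 0.
- rewrite pospow_le0 ?ltW// mulr0.
  apply: (@near_eq_is_derive _ _ _ (cst 0)).
  by apply: filterS (lt_nbhsl r0) => y y0; rewrite pospow_le0// ltW.
- apply: (@near_eq_is_derive _ _ _ (fun y : R => y ^+ n.+2)).
    by apply: filterS (lt_nbhsr r0) => y y0; rewrite /pospow max_r// ltW.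
  rewrite /pospow max_r ?ltW//.
  have := is_deriveX n.+2 (is_derive_id r (1 : R)).
  by rewrite /= [_ *: 1]mulr1 exprfctE.
- rewrite r0 pospow_le0// mulr0.
  suff H : h^-1 *: ((pospow n.+2 \o shift 0) (h *: 1) - pospow n.+2 0) @[h --> 0^'] --> (0 : R).
    split; first by apply/cvg_ex; exists 0.
    exact: cvg_lim H.
  apply/cvgrPdist_le => /= e e0; near=> h.
  have h1 : `|h| <= 1.
    near: h; apply: nbhs_dnbhs; apply/nbhs_ballP; exists 1 => //= y.
    by rewrite -ball_normE/= sub0r normrN => /ltW.
  have he : `|h| <= e.
    near: h; apply: nbhs_dnbhs; apply/nbhs_ballP; exists e => //= y.
    by rewrite -ball_normE/= sub0r normrN => /ltW.
  have h0 : h != 0 by near: h; exact: nbhs_dnbhs_neq.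
  rewrite sub0r normrN addr0 [h *: 1]mulr1 (pospow_le0 n.+1 (lexx 0)) subr0.
  rewrite [_ *: _]mulrC normrM normfV ler_pdivrMr ?normr_gt0// /pospow.
  have m0 : `|Num.max 0 h| <= `|h|.
    by case: (leP 0 h) => hh; rewrite ?normr0.
  rewrite normrX exprS (@le_trans _ _ (`|Num.max 0 h| * e))//.
    rewrite ler_wpM2l// (le_trans _ (le_trans m0 he))//.
    by rewrite exprS ler_piMr// exprn_ile1// (le_trans m0).
  by rewrite mulrC (ler_pM2l e0).
Unshelve. all: by end_near. Qed.

Lemma is_derive_line_inv (g : E -> R) (x v : E) (D : R) :
  is_derive (0 : R) (1 : R) (fun s : R => g (s *: v + x)) D -> is_derive x v g D.
Proof.
have e : (fun h : R => h^-1 *: (((fun s : R => g (s *: v + x)) \o shift 0) (h *: 1) - g (0 *: v + x)))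
  = (fun h : R => h^-1 *: ((g \o shift x) (h *: v) - g x)).
  apply/funext => h /=; congr (_ *: (g _ - _)).
    by rewrite [h *: 1]mulr1 addr0.
  by rewrite scale0r add0r.
move=> [dg <-]; split; first by move: dg; rewrite /derivable e.
by rewrite /derive e.
Qed.

Lemma is_derive_comp_dir (P : E -> R) (c : R -> R) (x v : E) (D C : R) :
  is_derive x v P D -> is_derive (P x) (1 : R) c C ->
  is_derive x v (fun y => c (P y)) (C * D).
Proof.
move=> PD cC; apply: is_derive_line_inv.
apply: (@is_derive1_comp _ c (fun s : R => P (s *: v + x)) 0 C D).
  by rewrite scale0r add0r.
by apply: is_derive_line; rewrite scale0r add0r.
Qed.

Lemma is_derive_coord (x v : E) j : is_derive x v (fun y : E => y 0 j) (v 0 j).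
Proof.
apply: is_derive_line_inv.
rewrite (_ : (fun s : R => _) = (fun s : R => v 0 j * s + x 0 j)); last first.
  by apply/funext => s; rewrite !mxE mulrC.
rewrite -[X in is_derive _ _ _ X]addr0.
apply: (@is_deriveD _ _ _ (fun s : R => v 0 j * s) (cst (x 0 j))).
rewrite -[X in is_derive _ _ _ X]mulr1.
exact: (@is_deriveZ _ _ _ id).
Qed.

Variables (x0 : E) (k : R).

Definition paraboloid (x : E) : R := 1 - k * \sum_(j < d) (x 0 j - x0 0 j) ^+ 2.

(** For k = r^-2 this is the cube of the positive part of 1 - |x - x0|^2 / r^2, with the Euclidean
    norm. *)
Definition cutoff (x : E) : R := pospow 3 (paraboloid x).

Lemma is_derive_paraboloid (x v : E) :
  is_derive x v paraboloid (- (k * \sum_(j < d) 2 * (x 0 j - x0 0 j) * v 0 j)).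
Proof.
have dj j : is_derive x v (fun y : E => (y 0 j - x0 0 j) ^+ 2)
    (2 * (x 0 j - x0 0 j) * v 0 j).
  have dj' : is_derive x v (fun y : E => y 0 j - x0 0 j) (v 0 j).
    rewrite -[X in is_derive _ _ _ X]subr0.
    exact: is_deriveB (is_derive_coord x v j) (is_derive_cst (x0 0 j) x v).
  by have /= := is_deriveX 2 dj'; rewrite exprfctE expr1.
have ds : is_derive x v (fun y : E => \sum_(j < d) (y 0 j - x0 0 j) ^+ 2)
    (\sum_(j < d) 2 * (x 0 j - x0 0 j) * v 0 j).
  rewrite (_ : (fun y : E => _) =
    \sum_(j < d) (fun y : E => (y 0 j - x0 0 j) ^+ 2)).
    exact: is_derive_sum.
  by apply/funext => y; rewrite fct_sumE.
rewrite -[X in is_derive _ _ _ X]sub0r.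
have H := is_deriveB (is_derive_cst (1 : R) x v) (is_deriveZ k ds).
exact H.
Qed.

Lemma continuous_paraboloid : continuous paraboloid.
Proof.
move=> x; apply: continuous_atB; first exact: continuous_at_cst.
apply: continuous_atM; first exact: continuous_at_cst.
have cj j : continuous_at x (fun y : E => (y 0 j - x0 0 j) ^+ 2).
  apply: (@continuous_comp _ _ _ (fun y : E => y 0 j - x0 0 j) (fun r : R => r ^+ 2)).
    apply: continuous_atB; first exact: coord_continuous.
    exact: continuous_at_cst.
  exact: exprn_continuous.
exact: continuous_at_sum.
Qed.

Lemma partial_cutoff i :
  partial i cutoff = fun x => pospow 2 (paraboloid x) * (- 6 * k * (x 0 i - x0 0 i)).
Proof.
apply/funext => x.
have := is_derive_comp_dir (is_derive_paraboloid x (basis_vec i))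
  (is_derive_pospow 1 (paraboloid x)).
move=> /(@derive_val _ _ _ _ _ _ _) ; rewrite /partial => ->.
rewrite (bigD1 i)//= big1 ?addr0 => [|j ji]; last first.
  by rewrite mxE (negPf ji) andbF mulr0.
by rewrite mxE !eqxx/=; ring.
Qed.

Lemma partial2_cutoff i j x :
  is_derive x (basis_vec i) (partial j cutoff)
   (2 * pospow 1 (paraboloid x) * (- 2 * k * (x 0 i - x0 0 i)) *
      (- 6 * k * (x 0 j - x0 0 j)) +
    pospow 2 (paraboloid x) * (- 6 * k * (i == j)%:R)).
Proof.
rewrite partial_cutoff.
have d1 : is_derive x (basis_vec i) (fun x => pospow 2 (paraboloid x))
    (2 * pospow 1 (paraboloid x) * (- 2 * k * (x 0 i - x0 0 i))).
  have := is_derive_comp_dir (is_derive_paraboloid x (basis_vec i))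
    (is_derive_pospow 0 (paraboloid x)).
  rewrite (bigD1 i)//= big1 ?addr0 => [|l li]; last first.
    by rewrite mxE (negPf li) andbF mulr0.
  rewrite mxE !eqxx/= mulr1 => H.
  by apply: is_derive_eq H _; ring.
have d2 : is_derive x (basis_vec i) (fun x : E => - 6 * k * (x 0 j - x0 0 j))
    (- 6 * k * (i == j)%:R).
  apply: (@is_deriveZ _ _ _ (fun x : E => x 0 j - x0 0 j)).
  rewrite -[X in is_derive _ _ _ X]subr0.
  have dj := is_derive_coord x (basis_vec i) j.
  rewrite mxE eqxx eq_sym/= in dj.
  exact: is_deriveB dj (is_derive_cst (x0 0 j) x (basis_vec i)).
apply: is_derive_eq (is_deriveM d1 d2) _.
by rewrite addrC [X in X + _]mulrC.
Qed.

Lemma continuous_affine_coord (c : R) i :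
  continuous (fun x : E => c * (x 0 i - x0 0 i)).
Proof.
move=> x; apply: continuous_atM; first exact: continuous_at_cst.
apply: continuous_atB; first exact: coord_continuous.
exact: continuous_at_cst.
Qed.

Lemma continuous_pospow_paraboloid n : continuous (fun x => pospow n (paraboloid x)).
Proof.
move=> x; apply: (@continuous_comp _ _ _ paraboloid (pospow n)).
  exact: continuous_paraboloid.
exact: continuous_pospow.
Qed.

Lemma C2_cutoff : C2 cutoff.
Proof.
split.
- exact: (@continuous_pospow_paraboloid 3).
- move=> i x; have H := is_derive_comp_dir (is_derive_paraboloid x (basis_vec i))
    (is_derive_pospow 1 (paraboloid x)).
  exact: (@ex_derive _ _ _ _ _ _ _ H).
- move=> i x; rewrite partial_cutoff; apply: continuous_atM.
    exact: (@continuous_pospow_paraboloid 2).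
  exact: continuous_affine_coord.
- by move=> i j x; have := partial2_cutoff i j x => /(@ex_derive _ _ _ _ _ _ _).
- move=> i j x; rewrite (_ : partial i _ = fun x =>
    2 * pospow 1 (paraboloid x) * (- 2 * k * (x 0 i - x0 0 i)) *
      (- 6 * k * (x 0 j - x0 0 j)) +
    pospow 2 (paraboloid x) * (- 6 * k * (i == j)%:R)); last first.
    apply/funext => y.
    by have := partial2_cutoff i j y => /(@derive_val _ _ _ _ _ _ _).
  apply: continuous_atD; last first.
    apply: continuous_atM; last exact: continuous_at_cst.
    exact: (@continuous_pospow_paraboloid 2).
  apply: continuous_atM; last exact: continuous_affine_coord.
  apply: continuous_atM; last exact: continuous_affine_coord.
  apply: continuous_atM; first exact: continuous_at_cst.
  exact: (@continuous_pospow_paraboloid 1).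
Qed.

Lemma cutoff_ge0 x : 0 <= cutoff x. Proof. exact: pospow_ge0. Qed.

Lemma cutoff_center : cutoff x0 = 1.
Proof.
rewrite /cutoff /paraboloid big1 ?mulr0 ?subr0 => [|j _]; last first.
  by rewrite subrr expr0n.
by rewrite /pospow max_r// expr1n.
Qed.

Lemma cutoff_le1 x : 0 <= k -> cutoff x <= 1.
Proof.
move=> k0; rewrite /cutoff /pospow exprn_ile1 ?le_max ?lexx// ge_max ler01/=.
rewrite /paraboloid gerBl mulr_ge0// sumr_ge0// => j _; exact: sqr_ge0.
Qed.

(** The distance in the hypothesis is the sup norm, which is at most the Euclidean norm inside the
    cut-off, so the sup-norm ball contains the support. *)
Lemma cutoff_out (r : R) x : 0 < r -> k = r ^- 2 -> r <= `|x - x0| -> cutoff x = 0.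
Proof.
move=> r0 kr rx; rewrite /cutoff pospow_le0// /paraboloid subr_le0 kr.
rewrite ler_pdivlMl ?exprn_gt0// mulr1.
have : r <= enorm (x - x0) by apply: le_trans rx (rV_norm_le_enorm _).
move=> /(ler_pM (ltW r0) (ltW r0))/(_ (le_trans rx (rV_norm_le_enorm _))).
rewrite -!expr2 sqr_sqrtr; last by apply: sumr_ge0 => j _; exact: sqr_ge0.
by move=> /le_trans; apply; apply: ler_sum => j _; rewrite !mxE.
Qed.

End Bump.

(** * Comparison estimates for solutions *)

Section Coefficients.
Context {R : realType} {d : nat}.
Local Notation E := 'rV[R]_d.

Lemma bounded_inP (T : Type) (A : set T) (f : T -> R) :
  [bounded f z | z in A] <-> exists M, forall z, A z -> `|f z| <= M.
Proof.
split=> [[M [_ MP]]|[M MP]]; first by exists (M + 1) => z; apply: MP; rewrite ltrDl.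
exists M; split; first exact: num_real.
by move=> N MN z Az; apply: le_trans (MP z Az) (ltW MN).
Qed.

Lemma continuous_enorm : continuous (@enorm R d).
Proof.
move=> x; apply: (@continuous_comp _ _ _ (fun x : E => \sum_(i < d) x 0 i ^+ 2) Num.sqrt).
  apply: continuous_at_sum => i.
  apply: (@continuous_comp _ _ _ (fun x : E => x 0 i) (fun r : R => r ^+ 2)).
    exact: coord_continuous.
  exact: exprn_continuous.
exact: sqrt_continuous.
Qed.

Lemma parabolic_dist_refl (z : R * E) : parabolic_dist z z = 0.
Proof.
rewrite /parabolic_dist !subrr normr0 addr0 /enorm big1 => [|i _].
  by rewrite sqrtr0 expr0n sqrtr0.
by rewrite mxE expr0n.
Qed.

Lemma continuous_parabolic_dist (w : R * E) :
  continuous (fun z => parabolic_dist z w).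
Proof.
move=> z; apply: (@continuous_comp _ _ _
  (fun z : R * E => enorm (z.2 - w.2) ^+ 2 + `|z.1 - w.1|) Num.sqrt); last exact: sqrt_continuous.
apply: continuous_atD.
  apply: (@continuous_comp _ _ _ (fun z : R * E => enorm (z.2 - w.2)) (fun r : R => r ^+ 2)).
    apply: (@continuous_comp _ _ _ (fun z : R * E => z.2 - w.2) (@enorm R d)).
      by apply: cvgB; [exact: cvg_snd|exact: cvg_cst].
    exact: continuous_enorm.
  exact: exprn_continuous.
apply: (@continuous_comp _ _ _ (fun z : R * E => z.1 - w.1) (fun r : R => `|r|)).
  by apply: continuous_atB; [exact: cvg_fst|exact: continuous_at_cst].
exact: norm_continuous.
Qed.

Lemma loc_parabolic_holder_continuous (alpha : R) (g : R * E -> R) : 0 < alpha ->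
  loc_parabolic_holder alpha g -> continuous g.
Proof.
move=> a0 hg z0.
have [C CP] := hg _ (@compact_slab R d (z0.1 - 1) (z0.1 + 1) (`|z0.2| + 1)).
apply/cvgrPdist_le => /= e e0.
(* Chosen so that (|C| + 1) r^alpha = e. The absolute value is there because the Hölder constant may
   be negative. *)
pose r := (e / (`|C| + 1)) `^ alpha^-1.
have C1 : 0 < `|C| + 1 by rewrite ltr_wpDl.
have r0 : 0 < r by rewrite powR_gt0// divr_gt0.
have near1 : \forall z \near z0, parabolic_dist z z0 < r.
  have := @continuous_parabolic_dist z0 z0.
  by move=> /cvgr_lt; apply; rewrite parabolic_dist_refl.
have near2 : \forall z \near z0, ball z0 1 z by exact: nbhsx_ballx.
near=> z.
have zr : parabolic_dist z z0 < r by near: z.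
have [b1 b2] : ball z0 1 z by near: z.
rewrite distrC.
apply: (@le_trans _ _ (C * parabolic_dist z z0 `^ alpha)).
  apply: CP; rewrite /=.
    move: b1 b2; rewrite -!ball_normE/= => b1 b2; split.
      by move: b1; rewrite ltr_norml => /andP[? ?]; lra.
    rewrite -[z.2](subrK z0.2) (le_trans (ler_normD _ _))// addrC lerD2l.
    by rewrite distrC ltW.
  by split; [lra|rewrite lerDl].
have p0 : 0 <= parabolic_dist z z0 by exact: sqrtr_ge0.
apply: (@le_trans _ _ ((`|C| + 1) * r `^ alpha)).
  apply: (@le_trans _ _ (`|C| * parabolic_dist z z0 `^ alpha)).
    by rewrite ler_wpM2r ?powR_ge0// ler_norm.
  rewrite ler_pM ?powR_ge0// ?lerDl//.
  by rewrite ge0_ler_powR ?nnegrE// ?ltW.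
have q0 : 0 <= e / (`|C| + 1) by apply: divr_ge0; exact: ltW.
by rewrite /r -powRrM mulVf ?gt_eqF// powRr1// mulrC divfK// gt_eqF.
Unshelve. all: by end_near. Qed.

Variables (q : R -> E -> 'M[R]_d) (b : R -> E -> E).

Lemma continuous_at_opA (u : R * E -> R) z : coefficients_holder q b ->
  (forall i, {for z, continuous (space_deriv i u)}) ->
  (forall i j, {for z, continuous (space_deriv2 i j u)}) ->
  continuous_at z (fun z => opA q b z.1 (fun x => u (z.1, x)) z.2).
Proof.
move=> [alpha /andP[a0 _] [hq hb]] u1 u2; apply: continuous_atD.
  apply: continuous_at_sum => i; apply: continuous_at_sum => j.
  apply: continuous_atM; last exact: u2.
  exact: (loc_parabolic_holder_continuous a0 (hq i j)).
apply: continuous_at_sum => i; apply: continuous_atM; last exact: u1.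
exact: (loc_parabolic_holder_continuous a0 (hb i)).
Qed.

Lemma near_eq0_partial (f : E -> R) i (x : E) : (\forall y \near x, f y = 0) ->
  \forall y \near x, partial i f y = 0.
Proof.
move=> /nbhs_interior; apply: filterS => y f0.
rewrite /partial (_ : 'D_(basis_vec i) f y = 'D_(basis_vec i) (cst 0) y).
  by rewrite derive_cst.
by apply: near_eq_derive; apply: filterS f0 => z ->.
Qed.

Lemma near_eq0_opA (f : E -> R) t (x : E) : (\forall y \near x, f y = 0) ->
  opA q b t f x = 0.
Proof.
move=> f0; rewrite /opA big1 ?add0r => [|i _].
  apply: big1 => i _; have := near_eq0_partial i f0.
  by move=> /nbhs_singleton ->; rewrite mulr0.
apply: big1 => j _; have := near_eq0_partial i (near_eq0_partial j f0).
by move=> /nbhs_singleton ->; rewrite mulr0.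
Qed.

(** The coefficients are bounded only on compact sets. The bound is uniform in x because the cut-off
    vanishes in a neighbourhood of every x with |x| > |x0| + r. *)
Lemma opA_cutoff_bounded (x0 : E) (k r a c : R) : coefficients_holder q b ->
  0 < r -> k = r ^- 2 ->
  exists2 C, 0 <= C & forall t x, a <= t <= c -> `|opA q b t (cutoff x0 k) x| <= C.
Proof.
move=> hqb r0 kr.
pose K := [set z : R * E | a <= z.1 <= c /\ `|z.2| <= `|x0| + r].
pose F (z : R * E) := opA q b z.1 (cutoff x0 k) z.2.
have [_ _ c1 _ c2] := C2_cutoff x0 k.
have cF : continuous F.
  move=> z; apply: (@continuous_at_opA (fun z => cutoff x0 k z.2)) => //.
    move=> i; apply: (@continuous_comp _ _ _ snd (partial i (cutoff x0 k))).
      exact: cvg_snd.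
    exact: c1.
  move=> i j; apply: (@continuous_comp _ _ _ snd (partial i (partial j (cutoff x0 k)))).
    exact: cvg_snd.
  exact: c2.
have : compact (F @` K).
  by apply: continuous_compact; [exact: continuous_subspaceT|exact: compact_slab].
move=> /compact_bounded/(@bounded_inP _ (F @` K) id)[M MP].
exists (Num.max M 0); first by rewrite le_max lexx orbT.
move=> t x act; rewrite le_max; have [xr|xr] := leP `|x| (`|x0| + r).
  by rewrite -[opA _ _ _ _ _]/(F (t, x)) MP//; exists (t, x).
rewrite near_eq0_opA ?normr0 ?lexx ?orbT//.
have : \forall y \near x, `|x0| + r < `|y|.
  by have := @norm_continuous _ _ x => /cvgr_gt; apply.
apply: filterS => y xy; apply: (cutoff_out r0 kr).
have h : `|y| <= `|y - x0| + `|x0| by rewrite -{1}(subrK x0 y) ler_normD.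
by rewrite -(lerD2r `|x0|) (le_trans _ h)// addrC ltW.
Qed.

End Coefficients.

Section Solutions.
Context {R : realType} {d : nat}.
Local Notation E := 'rV[R]_d.
Variables (q : R -> E -> 'M[R]_d) (b : R -> E -> E).

Lemma solution_restrict s r f u : s <= r -> bounded_classical_solution q b s f u ->
  bounded_classical_solution q b r (fun x => u (r, x)) u.
Proof.
move=> sr [cu bu u12 ut _]; split => //.
- by apply: continuous_subspaceW cu => z /=; exact: le_trans.
- move/bounded_inP : bu => [M MP]; apply/bounded_inP; exists M => z /= rz.
  by apply: MP; exact: le_trans rz.
- by move=> z /= rz; apply: u12; exact: le_lt_trans rz.
- by move=> t x rt; apply: ut; exact: le_lt_trans rt.
Qed.

Lemma solution_Cb s t f u : s < t -> bounded_classical_solution q b s f u ->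
  Cb (fun x => u (t, x)).
Proof.
move=> st [_ bu u12 _ _]; split.
  by have [] := C12_slice u12 st.
move/bounded_inP : bu => [M MP]; apply/bounded_inP; exists M => x _.
by apply: MP => /=; exact: ltW.
Qed.

Lemma Cb_cutoff (x0 : E) (k : R) : 0 <= k -> Cb (cutoff x0 k).
Proof.
move=> k0; split; first by have [] := C2_cutoff x0 k.
apply/bounded_inP; exists 1 => x _.
by rewrite ger0_norm ?cutoff_ge0// cutoff_le1.
Qed.

Hypothesis holder_qb : coefficients_holder q b.
Hypothesis elliptic_q : elliptic q.
Hypothesis lyapunov_loc : local_lyapunov q b.

(* As the cut-off function is at most the indicator of a ball, this gives
   [p_{t,s}(x0, {|y - x0| >= r}) <= C (t - s)]. *)
Lemma cutoff_solution_lower (x0 : E) (r a c : R) : 0 < r ->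
  exists2 C, 0 <= C & forall s t u, a <= s -> s <= t -> t <= c ->
    bounded_classical_solution q b s (cutoff x0 (r ^- 2)) u ->
    1 - u (t, x0) <= C * (t - s).
Proof.
move=> r0; set k := r ^- 2.
have k0 : 0 <= k by rewrite invr_ge0 exprn_ge0// ltW.
have [C C0 CP] := opA_cutoff_bounded x0 a c holder_qb r0 (erefl k).
exists C => // s t u as_ st tc [cu bu u12 ut us].
have [cc0 _ _ _ _] := C2_cutoff x0 k.
rewrite -(cutoff_center x0 k).
(* This w vanishes at time s and satisfies w_t = A(t) w - A(t) eta <= A(t) w + C, with eta the
   cut-off, so it grows at most like C (t - s). *)
pose w z := cutoff x0 k z.2 - u z.
have du t' x : s < t' -> is_derive t' (1 : R) (fun r => u (r, x)) (time_deriv u (t', x)).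
  move=> st'; rewrite /time_deriv/= derive1E; apply: derivableP.
  by have [[]] := u12 (t', x) st'.
have dw t' x : s < t' -> is_derive t' (1 : R) (fun r => w (r, x)) (- time_deriv u (t', x)).
  move=> st'; rewrite -[- _]sub0r.
  have H := is_deriveB (is_derive_cst (cutoff x0 k x) t' (1 : R)) (du t' x st').
  exact H.
have [M MP] := iffLR (bounded_inP _ _) bu.
have wE t' : (fun x => w (t', x)) = (fun x => cutoff x0 k x + (- 1 * u (t', x) + 0)).
  by apply/funext => x; rewrite /w/= mulN1r addr0.
have uC2 t' : s < t' -> C2 (fun x => u (t', x)) by move=> st'; exact: (C12_slice u12 st').
have w2 t' : s < t' -> C2 (fun x => w (t', x)).
  by move=> st'; rewrite wE; exact (C2_affine (-1) 0 (C2_cutoff x0 k) (uC2 t' st')).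
apply: (@maximum_principle R d q b s t C (1 + M) w) => //.
- apply: within_continuousB.
    apply: continuous_subspaceT => z.
    apply: (@continuous_comp _ _ _ snd (cutoff x0 k)); first exact: cvg_snd.
    exact: cc0.
  by apply: continuous_subspaceW cu => z /= /andP[].
- move=> t' x /andP[st' _]; rewrite /w lerD ?cutoff_le1//.
  by rewrite (le_trans (ler_norm _))// normrN MP.
- by move=> t' x /andP[st' _]; exact: (@ex_derive _ _ _ _ _ _ _ (dw t' x st')).
- by move=> t' /andP[st' _]; exact: w2.
- move=> t' x /andP[st' t't].
  rewrite wE (opA_affine q b t' (-1) 0 x (C2_cutoff x0 k) (uC2 t' st')).
  rewrite /time_deriv/= derive1E (@derive_val _ _ _ _ _ _ _ (dw t' x st')).
  rewrite ut// mulN1r addrAC lerDr.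
  have := CP t' x; rewrite (le_trans as_ (ltW st')) (le_trans t't tc) => /(_ isT).
  by rewrite ler_norml => /andP[? _]; rewrite -lerBlDr sub0r.
- by move=> x; rewrite /w/= us subrr.
- by rewrite st lexx.
Qed.

End Solutions.

(** * Solutions started from a slice of a compactly supported function *)

Section CompactSupport.
Context {R : realType} {d : nat}.
Local Notation E := 'rV[R]_d.
Variables (q : R -> E -> 'M[R]_d) (b : R -> E -> E).
Hypothesis holder_qb : coefficients_holder q b.

Lemma continuous_opG f : C12 [set: R] f -> continuous (opG q b f).
Proof.
move=> f12 z; have [_ [_ ft f1 f2]] := f12 z I.
by apply: continuous_atB; [exact: continuous_at_opA|exact: ft].
Qed.

Lemma opG_near_eq0 (f : R * E -> R) (z : R * E) :
  (\forall w \near z, f w = 0) -> opG q b f z = 0.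
Proof.
move=> f0; rewrite /opG near_eq0_opA; last first.
  have := @continuous_pair_right R E z.1 z.2 _.
  by move=> /(_ [set w | f w = 0]); apply; rewrite -surjective_pairing.
rewrite sub0r /time_deriv derive1E.
have f1 : \forall t \near z.1, f (t, z.2) = cst 0 t.
  have := @continuous_pair_left R E z.2 z.1 _.
  by move=> /(_ [set w | f w = 0]); apply; rewrite -surjective_pairing.
by rewrite (near_eq_derive (1 : R) f1) derive_cst oppr0.
Qed.

Lemma closure_support_near_eq0 (f : R * E -> R) (z : R * E) :
  ~ closure [set z | f z != 0] z -> \forall w \near z, f w = 0.
Proof.
move=> nz; have : nbhs z (~` closure [set z | f z != 0]).
  by apply: open_nbhs_nbhs; split => //; apply: closed_openC; exact: closed_closure.
apply: filterS => w wc; apply/eqP; apply: contra_notT wc => fw.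
exact: subset_closure.
Qed.

Lemma compact_support_bounded (f g : R * E -> R) : continuous g ->
  compact (closure [set z | f z != 0]) ->
  (forall z, ~ closure [set z | f z != 0] z -> g z = 0) ->
  exists M, forall z, `|g z| <= M.
Proof.
move=> cg cK g0; have : compact (g @` closure [set z | f z != 0]).
  by apply: continuous_compact => //; exact: continuous_subspaceT.
move=> /compact_bounded/(bounded_inP _ id)[M MP].
exists (Num.max M 0) => z; rewrite le_max.
have [zK|zK] := pselect (closure [set z | f z != 0] z).
  by rewrite MP//; exists z.
by rewrite g0// normr0 lexx orbT.
Qed.

Lemma C12c_continuous (f : R * E -> R) : C12c f -> continuous f.
Proof. by move=> [f12 _] z; have [_ [+ _ _ _]] := f12 z I. Qed.

Lemma C12c_bounded (f : R * E -> R) : C12c f -> exists M, forall z, `|f z| <= M.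
Proof.
move=> fc; apply: (compact_support_bounded (f := f)); [exact: C12c_continuous|by case: fc|].
by move=> z /closure_support_near_eq0/nbhs_singleton.
Qed.

Lemma C12c_opG_bounded (f : R * E -> R) : C12c f ->
  exists M, forall z, `|opG q b f z| <= M.
Proof.
move=> [f12 fc]; apply: (compact_support_bounded (f := f)) => //.
  exact: continuous_opG.
by move=> z /closure_support_near_eq0; exact: opG_near_eq0.
Qed.

Lemma C12c_time_support (f : R * E -> R) : C12c f ->
  exists2 T, 0 <= T & forall z, T < `|z.1| -> f z = 0 /\ opG q b f z = 0.
Proof.
move=> [f12 fc].
have : compact (fst @` closure [set z | f z != 0]).
  apply: continuous_compact => //; apply: continuous_subspaceT => z.
  exact: cvg_fst.
move=> /compact_bounded/(bounded_inP _ id)[M MP].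
exists (Num.max M 0); first by rewrite le_max lexx orbT.
move=> z; rewrite gt_max => /andP[Mz _].
have nz : ~ closure [set z | f z != 0] z.
  by move=> cz; move: Mz; rewrite ltNge => /negP; apply; apply: MP; exists z.
have fz := closure_support_near_eq0 nz.
by split; [exact: nbhs_singleton fz|exact: opG_near_eq0].
Qed.

Lemma C2_scale (f : E -> R) (k : R) : C2 f -> C2 (fun x => k * f x).
Proof.
move=> f2; have := C2_affine (k - 1) 0 f2 f2.
by under [X in C2 X]eq_fun do rewrite addr0 mulrBl mul1r addrC subrK.
Qed.

Lemma opA_scale t (f : E -> R) (k : R) x : C2 f ->
  opA q b t (fun x => k * f x) x = k * opA q b t f x.
Proof.
move=> f2; have := opA_affine q b t (k - 1) 0 x f2 f2.
under [X in opA _ _ _ X]eq_fun do rewrite addr0 mulrBl mul1r addrC subrK.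
by move=> ->; rewrite mulrBl mul1r addrC subrK.
Qed.

Hypothesis elliptic_q : elliptic q.
Hypothesis lyapunov_loc : local_lyapunov q b.

(* Comparison of [sg (u - f)] with [(t - r) (sg g0 + e + M (1 - eta))], where g0
   is the value of [opG f] at the point and eta a cut-off function there. *)
Lemma solution_opG_upper (f : R * E -> R) (s0 : R) (x0 : E) (sg e : R) :
  C12c f -> `|sg| <= 1 -> 0 < e ->
  exists2 h0, 0 < h0 & forall h u, 0 < h < h0 ->
    bounded_classical_solution q b (s0 - h) (fun x => f (s0 - h, x)) u ->
    sg * (u (s0, x0) - f (s0, x0)) <= h * (sg * opG q b f (s0, x0) + e).
Proof.
move=> fc sg1 e0; have [f12 _] := fc.
have [Mf fM] := C12c_bounded fc.
have [M0 gM] := C12c_opG_bounded fc.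
set g := opG q b f in gM *; set g0 := g (s0, x0).
have M00 : 0 <= M0 by apply: le_trans (gM (0, 0)).
have sgle y M : `|y| <= M -> sg * y <= M.
  move=> yM; rewrite (le_trans (ler_norm _))// normrM.
  by rewrite -[M]mul1r ler_pM.
pose M := 2 * M0.
have e20 : 0 < e / 2 by rewrite divr_gt0.
have : continuous g by exact: continuous_opG.
move=> /(_ (s0, x0))/cvgrPdist_le/(_ _ e20)/nbhs_ballP[r /= r0 gr].
pose k := r ^- 2.
have k0 : 0 <= k by rewrite invr_ge0 exprn_ge0// ltW.
have [C C0 CP] := opA_cutoff_bounded x0 (s0 - 1) s0 holder_qb r0 (erefl k).
pose eta := cutoff x0 k.
have eta2 : C2 eta by exact: C2_cutoff.
have MC0 : 0 <= M * C by rewrite !mulr_ge0.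
have MC1 : 0 < M * C + 1 by rewrite ltr_wpDl.
(* The three bounds on h keep the times in [s0 - 1, s0], where C is valid, keep them within r of s0,
   and make h M C at most e / 2. *)
exists (Num.min (Num.min 1 r) (e / 2 / (M * C + 1))).
  by rewrite !lt_min ltr01 r0 divr_gt0.
move=> h u; rewrite !lt_min -!andbA => /and4P[h0 h1 hr hMC] [cu bu u12 ut us].
have hMC' : h * (M * C) <= e / 2.
  rewrite (@le_trans _ _ (h * (M * C + 1)))// ?ler_wpM2l ?lerDl ?ltW//.
  by rewrite -ltr_pdivlMr.
pose s := s0 - h.
have [Mu uM] := iffLR (bounded_inP _ _) bu.
pose a x := sg * g0 + e / 2 + M * (1 - eta x).
pose w z := sg * (u z - f z) - (z.1 - s) * a z.2.
(* Inside the ball this is the continuity of [opG f]. Outside it eta vanishes, and M = 2 M0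
   dominates |g| + |g0|. *)
have gest t x : s < t <= s0 -> sg * g (t, x) <= a x.
  move=> /andP[st ts]; rewrite /a -addrA -lerBlDl -mulrBr.
  have [xr|xr] := ltP `|x - x0| r.
    rewrite ler_wpDr ?mulr_ge0// ?subr_ge0 ?cutoff_le1//.
    apply: sgle; rewrite distrC; apply: gr; split => /=; rewrite -ball_normE/=.
      by rewrite ger0_norm ?subr_ge0//; move: st; rewrite /s; lra.
    by rewrite distrC.
  rewrite /eta (cutoff_out r0)// subr0 mulr1 ler_wpDl ?(ltW e20)//.
  apply: sgle; rewrite (le_trans (ler_normB _ _))//.
  by have := gM (t, x); have := gM (s0, x0); rewrite -/g0 /M; lra.
have uC2 t : s < t -> C2 (fun x => u (t, x)) by move=> st; exact: (C12_slice u12 st).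
have fC2 t : C2 (fun x => f (t, x)) by exact: (C12_slice f12 I).
have wE t : (fun x => w (t, x)) = (fun x =>
    ((t - s) * M * eta x + (sg * u (t, x) + - ((t - s) * (sg * g0 + e / 2 + M)))) + (- sg * f (t, x) + 0)).
  by apply/funext => x; rewrite /w /a/=; ring.
have w2 t : s < t -> C2 (fun x => w (t, x)).
  move=> st; rewrite wE.
  exact (C2_affine (- sg) 0 (C2_affine sg _ (C2_scale ((t - s) * M) eta2) (uC2 t st)) (fC2 t)).
have dw t x : s < t -> is_derive t (1 : R) (fun r => w (r, x))
    (sg * (time_deriv u (t, x) - time_deriv f (t, x)) - a x).
  move=> st.
  have du : is_derive t (1 : R) (fun r => u (r, x)) (time_deriv u (t, x)).
    rewrite /time_deriv/= derive1E; apply: derivableP.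
    by have [[]] := u12 (t, x) st.
  have df : is_derive t (1 : R) (fun r => f (r, x)) (time_deriv f (t, x)).
    rewrite /time_deriv/= derive1E; apply: derivableP.
    by have [[]] := f12 (t, x) I.
  have d1 := is_deriveZ sg (is_deriveB du df).
  have d2 : is_derive t (1 : R) (fun r => a x * (r - s)) (a x).
    have H := is_deriveZ (a x) (is_deriveB (is_derive_id t (1 : R)) (is_derive_cst s t (1 : R))).
    by apply: is_derive_eq H _; rewrite subr0 [_ *: 1]mulr1.
  rewrite (_ : (fun r => w (r, x)) = (fun r => sg * (u (r, x) - f (r, x)) - a x * (r - s))).
    exact (is_deriveB d1 d2).
  by apply/funext => r'; rewrite /w/= [a x * _]mulrC.
(* w_t - A(t) w = sg g - a - (t - s) M A(t) eta, where the first difference is nonpositive and the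
   last term is at most h M C. Over a time h this costs h (h M C) <= h e / 2, and a(x0) = sg g0 + e
   / 2 because eta is 1 at x0. *)
have : w (s0, x0) <= h * (M * C) * (s0 - s).
  apply: (@maximum_principle R d q b s s0 _ (Mu + Mf + h * M0) w
    elliptic_q lyapunov_loc).
  - apply: within_continuousB.
      move=> z; apply: continuous_atM; first exact: continuous_at_cst.
      apply: continuous_atB; last first.
        by apply: continuous_subspaceT; exact: C12c_continuous.
      by apply: (continuous_subspaceW _ cu) => y /= /andP[].
    apply: continuous_subspaceT => z; apply: continuous_atM.
      by apply: continuous_atB; [exact: cvg_fst|exact: continuous_at_cst].
    apply: continuous_atD; first exact: continuous_at_cst.
    apply: continuous_atM; first exact: continuous_at_cst.
    apply: continuous_atB; first exact: continuous_at_cst.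
    apply: (@continuous_comp _ _ _ snd eta); first exact: cvg_snd.
    by case: eta2 => + _ _ _ _; exact.
  - move=> t x /andP[st ts]; rewrite /w/=.
    have e1 : sg * (u (t, x) - f (t, x)) <= Mu + Mf.
      by apply: sgle; rewrite (le_trans (ler_normB _ _))// lerD// uM.
    have e2 : - M0 <= a x.
      have E1 : sg * - g0 <= M0 by apply: sgle; rewrite normrN; exact: gM.
      have E2 : 0 <= M * (1 - eta x).
        by rewrite mulr_ge0// ?subr_ge0 ?cutoff_le1// mulr_ge0.
      by move: E1 E2 e20; rewrite /a mulrN; lra.
    have e3 : (t - s) * - M0 <= (t - s) * a x by rewrite ler_wpM2l ?subr_ge0.
    have e4 : (t - s) * M0 <= h * M0.
      by rewrite ler_wpM2r//; move: ts; rewrite /s; lra.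
    by move: e1 e3 e4; rewrite mulrN; lra.
  - by move=> t x /andP[st _]; exact: (@ex_derive _ _ _ _ _ _ _ (dw t x st)).
  - by move=> t /andP[st _]; exact: w2.
  - move=> t x /[dup] stT /andP[st ts].
    rewrite wE (opA_affine q b t (- sg) 0 x (C2_affine sg _ (C2_scale ((t - s) * M) eta2) (uC2 t st)) (fC2 t)).
    rewrite (opA_affine q b t sg _ x (C2_scale ((t - s) * M) eta2) (uC2 t st)).
    rewrite opA_scale//.
    rewrite /time_deriv/= derive1E (@derive_val _ _ _ _ _ _ _ (dw t x st)).
    rewrite ut//; have := gest t x stT; rewrite /g /opG/= => G1.
    have G2 : - C <= opA q b t eta x.
      have := CP t x; rewrite ts andbT => /(_ _)/ler_normlW; rewrite -/eta => G2.
      rewrite lerNl; have := CP t x; rewrite ts andbT -/eta => G3.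
      rewrite (le_trans (ler_norm _))// normrN G3//.
      by apply: le_trans (ltW st); rewrite /s lerD2l lerN2 ltW.
    have G3 : (t - s) * M * - C <= (t - s) * M * opA q b t eta x.
      by rewrite ler_wpM2l// mulr_ge0 ?subr_ge0 ?(ltW st)//; exact: mulr_ge0.
    have G4 : (t - s) * (M * C) <= h * (M * C).
      by rewrite ler_wpM2r//; move: ts; rewrite /s; lra.
    move: G1 G3 G4; rewrite mulrN -mulrA.
    set A1 := opA _ _ _ _ _; set A2 := opA _ _ _ _ _; set A3 := opA _ _ _ _ _.
    set B1 := time_deriv _ _; rewrite !mulrBr mulNr; lra.
  - move=> x; rewrite /w /= us subrr mulr0 subrr mul0r subr0//.
  - by rewrite lexx andbT /s gerBl ltW.
have -> : s0 - s = h by rewrite /s opprB addrCA subrr addr0.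
rewrite /w/= /a /eta cutoff_center subrr mulr0 addr0.
have -> : s0 - s = h by rewrite /s opprB addrCA subrr addr0.
have : h * (M * C) * h <= e / 2 * h by rewrite ler_wpM2r// ltW.
by rewrite !mulrDr; lra.
Qed.

End CompactSupport.

Section CompactSupportBound.
Context {R : realType} {d : nat}.
Local Notation E := 'rV[R]_d.
Variables (q : R -> E -> 'M[R]_d) (b : R -> E -> E).
Hypothesis elliptic_q : elliptic q.
Hypothesis lyapunov_loc : local_lyapunov q b.

(** w = sg (u - f) starts at 0 and solves w_t = A(t) w + sg (opG f). With sg = 1 and sg = -1 this
    bounds |u - f| by M0 (t - s) uniformly in x, which dominates the difference quotients. *)
Lemma solution_opG_bound (f : R * E -> R) (M0 sg : R) s t u x : C12c f ->
  (forall z, `|opG q b f z| <= M0) -> `|sg| <= 1 -> s <= t ->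
  bounded_classical_solution q b s (fun y => f (s, y)) u ->
  sg * (u (t, x) - f (t, x)) <= M0 * (t - s).
Proof.
move=> fc gM sg1 st0 [cu bu u12 ut us]; have [f12 _] := fc.
have [Mf fM] := C12c_bounded fc.
have [Mu uM] := iffLR (bounded_inP _ _) bu.
have M00 : 0 <= M0 by apply: le_trans (gM (0, 0)).
have sgle y M : `|y| <= M -> sg * y <= M.
  move=> yM; rewrite (le_trans (ler_norm _))// normrM.
  by rewrite -[M]mul1r ler_pM.
pose w z := sg * (u z - f z).
have uC2 r : s < r -> C2 (fun x => u (r, x)) by move=> sr; exact: (C12_slice u12 sr).
have fC2 r : C2 (fun x => f (r, x)) by exact: (C12_slice f12 I).
have wE r : (fun x => w (r, x)) =
    (fun x => sg * u (r, x) + (- sg * f (r, x) + 0)).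
  by apply/funext => y; rewrite /w/=; ring.
have dw r y : s < r -> is_derive r (1 : R) (fun r => w (r, y))
    (sg * (time_deriv u (r, y) - time_deriv f (r, y))).
  move=> sr.
  have du : is_derive r (1 : R) (fun r => u (r, y)) (time_deriv u (r, y)).
    rewrite /time_deriv/= derive1E; apply: derivableP.
    by have [[]] := u12 (r, y) sr.
  have df : is_derive r (1 : R) (fun r => f (r, y)) (time_deriv f (r, y)).
    rewrite /time_deriv/= derive1E; apply: derivableP.
    by have [[]] := f12 (r, y) I.
  exact (is_deriveZ sg (is_deriveB du df)).
apply: (@maximum_principle R d q b s t _ (Mu + Mf) w elliptic_q lyapunov_loc).
- move=> z; apply: continuous_atM; first exact: continuous_at_cst.
  apply: continuous_atB; last first.
    by apply: continuous_subspaceT; exact: C12c_continuous.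
  by apply: (continuous_subspaceW _ cu) => y /= /andP[].
- move=> r y /andP[sr rt]; rewrite /w/=.
  by apply: sgle; rewrite (le_trans (ler_normB _ _))// lerD// uM.
- by move=> r y /andP[sr _]; exact: (@ex_derive _ _ _ _ _ _ _ (dw r y sr)).
- move=> r /andP[sr _]; rewrite wE.
  exact (C2_affine (- sg) 0 (C2_scale sg (uC2 r sr)) (fC2 r)).
- move=> r y /andP[sr rt]; rewrite wE.
  rewrite (opA_affine q b r (- sg) 0 y (C2_scale sg (uC2 r sr)) (fC2 r)) opA_scale//; last exact: uC2.
  rewrite /time_deriv/= derive1E (@derive_val _ _ _ _ _ _ _ (dw r y sr)) ut//.
  have := sgle _ _ (gM (r, y)); rewrite /opG/= mulrBr.
  set A1 := opA _ _ _ _ _; set A2 := opA _ _ _ _ _.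
  set B1 := time_deriv _ _; rewrite mulrBr mulNr; lra.
- by move=> y; rewrite /w us subrr mulr0.
- by rewrite st0 lexx.
Qed.

End CompactSupportBound.

(** * Invariant Markov kernels on L^p *)

Section MeasureBind.
Local Open Scope ereal_scope.
Context {d1 d2 : measure_display} {X : measurableType d1} {Y : measurableType d2}.
Context {R : realType} (m : {measure set X -> \bar R}).
Variable k : X -> {measure set Y -> \bar R}.
Hypothesis mk : forall B, measurable B -> measurable_fun [set: X] (k ^~ B).

(** The measure m followed by the kernel k. Invariance of nu, composition of kernels and the
    disintegration of nu are all identities for measures of this form. *)
Definition mbind (B : set Y) : \bar R := \int[m]_x k x B.

Let mbind0 : mbind set0 = 0.
Proof. by rewrite /mbind; under eq_integral do rewrite measure0; rewrite integral0. Qed.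

Let mbind_ge0 B : 0 <= mbind B. Proof. by apply: integral_ge0. Qed.

Let mbind_sigma_additive : semi_sigma_additive mbind.
Proof.
move=> F mF tF mUF; rewrite [X in _ --> X](_ : _ = \sum_(n <oo) mbind (F n)).
  by apply: is_cvg_nneseries => n _ _; exact: mbind_ge0.
rewrite -integral_nneseries//; last by move=> n; exact: mk.
apply: eq_integral => x _; apply/esym/cvg_lim => //.
exact: measure_semi_sigma_additive.
Qed.

HB.instance Definition _ := isMeasure.Build _ _ _ mbind
  mbind0 mbind_ge0 mbind_sigma_additive.

Definition mbind_measure : {measure set Y -> \bar R} := mbind.

Import HBNNSimple.

Let integral_mbind_nnsfun (f : {nnsfun Y >-> R}) :
  \int[mbind]_y (f y)%:E = \int[m]_x \int[k x]_y (f y)%:E.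
Proof.
transitivity (\sum_(r \in range f) (r%:E * mbind (f @^-1` [set r]))).
  by rewrite integralT_nnsfun sintegralE.
transitivity (\int[m]_x \sum_(r \in range f) (r%:E * k x (f @^-1` [set r]))); last first.
  by apply: eq_integral => x _; rewrite integralT_nnsfun sintegralE.
have mf r : measurable_fun [set: X] (fun x => k x (f @^-1` [set r])).
  by apply: mk; exact: measurable_sfunP.
rewrite ge0_integral_fsum//.
- apply: eq_fsbigr => r /set_mem[y _ <-].
  by rewrite ge0_integralZl// lee_fin.
- by move=> r; exact: measurable_funeM.
- move=> r x _; have [r0|r0] := leP 0%R r; first by rewrite mule_ge0.
  by rewrite preimage_nnfun0// measure0 mule0.
Qed.

Lemma integral_mbind (f : Y -> \bar R) : (forall y, 0 <= f y) ->
  measurable_fun [set: Y] f -> \int[mbind_measure]_y f y = \int[m]_x \int[k x]_y f y.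
Proof.
move=> f0 mf; pose f_ := nnsfun_approx measurableT mf.
have f_f y : (f_ n y)%:E @[n --> \oo] --> f y by exact: cvg_nnsfun_approx.
have f_mono y : {homo (fun n => (f_ n y)%:E) : a b / (a <= b)%N >-> a <= b}.
  by move=> a b ab; rewrite lee_fin; exact/lefP/nd_nnsfun_approx.
have mf_ n : measurable_fun [set: Y] (fun y => (f_ n y)%:E) by exact/measurable_EFinP.
have f_0 n y : 0 <= (f_ n y)%:E by rewrite lee_fin.
have mono (mm : {measure set Y -> \bar R}) :
    \int[mm]_y (f_ n y)%:E @[n --> \oo] --> \int[mm]_y f y.
  rewrite [X in _ --> X](_ : _ = \int[mm]_y limn (fun n => (f_ n y)%:E)).
    exact: cvg_monotone_convergence.
  by apply: eq_integral => y _; apply/esym/cvg_lim.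
apply: (cvg_unique _ (mono _)) => //.
have -> : (fun n => \int[mbind_measure]_y (f_ n y)%:E) =
    (fun n => \int[m]_x \int[k x]_y (f_ n y)%:E).
  by apply/funext => n; exact: integral_mbind_nnsfun.
rewrite /= [X in _ --> X](_ : _ =
    \int[m]_x limn (fun n => \int[k x]_y (f_ n y)%:E)).
  apply: cvg_monotone_convergence => //.
  - by move=> n; exact: measurable_fun_integral_kernel.
  - by move=> n x _; exact: integral_ge0.
  - by move=> x _ a b ab; apply: ge0_le_integral => // y _; exact: f_mono.
by apply: eq_integral => x _; apply/esym/cvg_lim.
Qed.

End MeasureBind.

Section MarkovKernel.
Context {disp : measure_display} {T : measurableType disp} {R : realType}.
Variable K : T -> probability T R.
Hypothesis mK : forall B, measurable B -> measurable_fun [set: T] (fun z => K z B).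

(* 0 where [f] is not [K z]-integrable, which for [f] in L^p(nu) and an
   invariant [K] is a null set. *)
Definition Kint (f : T -> R) (z : T) : R := fine (\int[K z]_y (f y)%:E).

Lemma measurable_ge0_kernel_integral (f : T -> \bar R) : (forall y, 0 <= f y)%E ->
  measurable_fun [set: T] f -> measurable_fun [set: T] (fun z => \int[K z]_y f y)%E.
Proof. by move=> f0 mf; exact: measurable_fun_integral_kernel. Qed.

Lemma measurable_Kint f : measurable_fun [set: T] f ->
  measurable_fun [set: T] (Kint f).
Proof.
move=> mf; apply: (@measurableT_comp _ _ _ _ _ _ (@fine R) _ (fun z => (\int[K z]_y (f y)%:E)%E)) => /=.
  exact: fine_measurable.
under eq_fun do rewrite integralE.
have mf' : measurable_fun [set: T] (EFin \o f) by exact/measurable_EFinP.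
by apply: emeasurable_funB; apply: measurable_ge0_kernel_integral => //;
  [exact: measurable_funepos|exact: measurable_funeneg].
Qed.

End MarkovKernel.

(** * Jensen's inequality for powers *)

Section Jensen.
Local Open Scope ereal_scope.
Context {disp : measure_display} {T : measurableType disp} {R : realType}.
Variable P : probability T R.

Lemma probability_Jensen_powR (f : T -> R) (p : R) : (1 <= p)%R ->
  measurable_fun [set: T] f ->
  (\int[P]_y `|(f y)%:E|) `^ p <= \int[P]_y (`|f y| `^ p)%:E.
Proof.
rewrite le_eqVlt => /predU1P[<- mf|p1 mf].
  rewrite poweRe1 ?integral_ge0//.
  by under [leRHS]eq_integral do rewrite powRr1//.
have p0 : (0 < p)%R by rewrite (lt_trans ltr01).
have pp0 : (0 < p / (p - 1))%R by rewrite divr_gt0// subr_gt0.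
have := @hoelder _ _ _ P f (cst 1%R) p (p / (p - 1)) mf (measurable_cst _) p0 pp0.
rewrite invf_div -[X in (X + _)%R]mul1r -mulrDl addrCA subrr addr0 divff ?gt_eqF//.
move=> /(_ (erefl _)) H.
have {}H : 'N[P]_1[EFin \o (f \* cst 1)%R] <= 'N[P]_p%:E[EFin \o f].
  apply: le_trans H _.
  have -> : 'N[P]_(p / (p - 1))%:E[EFin \o cst 1%R] = 1.
    rewrite [LHS]Lnorm_cst1 [X in X `^ _](_ : _ = 1) ?poweR1r//.
    exact: probability_setT.
  by rewrite mule1.
have -> : \int[P]_y (`|f y| `^ p)%:E = 'N[P]_p%:E [EFin \o f] `^ p.
  by rewrite poweR_Lnorm ?gt_eqF//.
apply: gt0_ler_poweR; rewrite ?in_itv/= ?leey ?andbT ?(ltW p0)//; last first.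
- apply: le_trans H; rewrite Lnorm1 le_eqVlt; apply/orP; left; apply/eqP.
  by apply: eq_integral => y _; rewrite /= mulr1.
- exact: Lnorm_ge0.
- exact: integral_ge0.
Qed.

Lemma integrable_powR (f : T -> R) (p : R) : (1 <= p)%R ->
  measurable_fun [set: T] f ->
  \int[P]_y (`|f y| `^ p)%:E < +oo -> P.-integrable setT (EFin \o f).
Proof.
move=> p1 mf fp; apply/integrableP; split; first exact/measurable_EFinP.
apply: (@lty_poweRy _ _ p); first by rewrite gt_eqF// (lt_le_trans ltr01).
by apply: le_lt_trans fp; exact: probability_Jensen_powR.
Qed.

End Jensen.

(** * Contraction of L^p by a kernel with invariant measure *)

Section InvariantKernel.
Context {disp : measure_display} {T : measurableType disp} {R : realType}.
Context (nu : {measure set T -> \bar R}) (p : R).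
Hypothesis p1 : 1 <= p.

(** The p-th power of the L^p norm. Without the outer root, invariance and the convergence theorems
    for integrals apply directly. *)
Definition Ipow (f : T -> R) : \bar R := (\int[nu]_z (`|f z| `^ p)%:E)%E.

Let p0 : 0 < p. Proof. exact: lt_le_trans p1. Qed.

Lemma Ipow_ge0 f : (0 <= Ipow f)%E.
Proof. by apply: integral_ge0 => z _; rewrite lee_fin powR_ge0. Qed.

Lemma Lnorm_Ipow f : Lnorm nu p%:E (EFin \o f) = (Ipow f `^ p^-1)%E.
Proof. by rewrite unlock. Qed.

Lemma le_Lnorm f g : (Ipow f <= Ipow g)%E ->
  (Lnorm nu p%:E (EFin \o f) <= Lnorm nu p%:E (EFin \o g))%E.
Proof.
move=> fg; rewrite !Lnorm_Ipow; apply: gt0_ler_poweR => //.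
- by rewrite invr_ge0 ltW.
- by rewrite in_itv/= Ipow_ge0 leey.
- by rewrite in_itv/= Ipow_ge0 leey.
Qed.

Lemma Lfun_Ipow f : f \in Lfun nu p%:E <->
  measurable_fun [set: T] f /\ (Ipow f < +oo)%E.
Proof.
split=> [/andP[/[1!inE]/= mf /[1!inE]/= ff]|[mf ff]].
  split => //; move: ff; rewrite /finite_norm Lnorm_Ipow.
  by apply: lty_poweRy; rewrite invr_neq0// gt_eqF.
rewrite inE; apply/andP; split; rewrite inE//=.
by rewrite /finite_norm Lnorm_Ipow poweR_lty.
Qed.

Lemma measurable_Ipow_fun (f : T -> R) : measurable_fun [set: T] f ->
  measurable_fun [set: T] (fun z => (`|f z| `^ p)%:E).
Proof.
move=> mf; apply/measurable_EFinP.
apply: (measurableT_comp (measurable_powR p)).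
exact: measurableT_comp.
Qed.

Variable K : T -> probability T R.
Hypothesis mK : forall B, measurable B -> measurable_fun [set: T] (fun z => K z B).
Hypothesis invK : forall B, measurable B -> (\int[nu]_z K z B = nu B)%E.

Lemma invariant_integral (f : T -> \bar R) : (forall y, 0 <= f y)%E ->
  measurable_fun [set: T] f ->
  (\int[nu]_z \int[K z]_y f y = \int[nu]_z f z)%E.
Proof.
move=> f0 mf; rewrite -(integral_mbind nu mK)//.
by apply: eq_measure_integral => A mA _; exact: invK.
Qed.

(** Valid at every z: if the right side is infinite there is nothing to prove, and otherwise f is
    [K z]-integrable, so [Kint] is the true integral and not its default value. *)
Lemma powR_Kint_le (f : T -> R) z : measurable_fun [set: T] f ->
  ((`|Kint K f z| `^ p)%:E <= \int[K z]_y (`|f y| `^ p)%:E)%E.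
Proof.
move=> mf; have [->|] := eqVneq (\int[K z]_y (`|f y| `^ p)%:E)%E +oo%E.
  exact: leey.
rewrite -ltey => foo; have fi := integrable_powR p1 mf foo.
apply: le_trans (probability_Jensen_powR (K z) p1 mf).
rewrite -poweR_EFin; apply: gt0_ler_poweR; first exact: ltW.
- by rewrite in_itv/= leey lee_fin normr_ge0.
- by rewrite in_itv/= leey andbT integral_ge0.
rewrite -abse_EFin /Kint fineK; last exact: integrable_fin_num.
by apply: le_abse_integral => //; exact/measurable_EFinP.
Qed.

Lemma Ipow_Kint_le (f : T -> R) : measurable_fun [set: T] f ->
  (Ipow (Kint K f) <= Ipow f)%E.
Proof.
move=> mf; rewrite /Ipow -[leRHS]invariant_integral//; last first.
  exact: measurable_Ipow_fun.
apply: ge0_le_integral => //.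
- by apply: measurable_Ipow_fun; exact: measurable_Kint.
- apply: measurable_ge0_kernel_integral => //.
  exact: measurable_Ipow_fun.
- by move=> z _; exact: powR_Kint_le.
Qed.

Lemma Kint_Lfun f : f \in Lfun nu p%:E -> Kint K f \in Lfun nu p%:E.
Proof.
move=> /Lfun_Ipow[mf foo]; apply/Lfun_Ipow; split; first exact: measurable_Kint.
exact: le_lt_trans (Ipow_Kint_le mf) foo.
Qed.

Lemma Kint_integrable_ae f : f \in Lfun nu p%:E ->
  {ae nu, forall z, (K z).-integrable setT (EFin \o f)}.
Proof.
move=> /Lfun_Ipow[mf foo].
have H : nu.-integrable setT (fun z => \int[K z]_y (`|f y| `^ p)%:E)%E.
  apply/integrableP; split.
    apply: measurable_ge0_kernel_integral => //.
    exact: measurable_Ipow_fun.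
  under eq_integral do rewrite gee0_abs ?integral_ge0//.
  by rewrite invariant_integral//; exact: measurable_Ipow_fun.
have := integrable_ae measurableT H; apply: filterS => z /(_ I) zfin.
by apply: (integrable_powR p1 mf); rewrite ltey_eq zfin.
Qed.

(** Invariance turns nu N = 0 into K z N = 0 for nu-a.e. z. Hence [Kint] acts on classes modulo
    nu. *)
Lemma Kint_ae_eq f g : measurable_fun [set: T] f -> measurable_fun [set: T] g ->
  f = g %[ae nu] -> Kint K f = Kint K g %[ae nu].
Proof.
move=> mf mg [N [mN N0 fgN]].
have H : (\int[nu]_z `|K z N| = 0)%E.
  by under eq_integral do rewrite gee0_abs//; rewrite invK.
have := (ae_eq_integral_abs nu measurableT (mK mN)).1 H.
apply: filterS => z /(_ I)/= KN _; congr fine.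
apply: ae_eq_integral => //; [exact/measurable_EFinP|exact/measurable_EFinP|].
exists N; split => // y /= fgy; apply: fgN => /= fgy'; apply: fgy => _.
by rewrite fgy'.
Qed.

Lemma Kint_linear_ae (a : R) f g : f \in Lfun nu p%:E -> g \in Lfun nu p%:E ->
  {ae nu, forall z, Kint K (fun y => a * f y + g y) z = a * Kint K f z + Kint K g z}.
Proof.
move=> fL gL.
have := Kint_integrable_ae gL; have := Kint_integrable_ae fL.
apply: filterS2 => z fi gi; rewrite /Kint.
have afi := integrableZl measurableT a fi.
under eq_integral do rewrite EFinD EFinM.
rewrite integralD//= integralZl//= fineD ?fineM//.
- exact: (integrable_fin_num _ fi).
- by rewrite -integralZl//; exact: (integrable_fin_num _ afi).
- exact: (integrable_fin_num _ gi).
Qed.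

Lemma Kint_ge0_ae (f : T -> R) : measurable_fun [set: T] f -> {ae nu, forall z, 0 <= f z} ->
  {ae nu, forall z, 0 <= Kint K f z}.
Proof.
move=> mf f0; have mnf : measurable_fun [set: T] (fun z => `|f z|).
  exact: measurableT_comp.
have : f = (fun z => `|f z|) %[ae nu] by apply: filterS f0 => z + _; move/ger0_norm.
move=> /(Kint_ae_eq mf mnf); apply: filterS => z /(_ I) ->.
by apply: fine_ge0; apply: integral_ge0 => y _; rewrite lee_fin.
Qed.

End InvariantKernel.

Section KernelComposition.
Context {disp : measure_display} {T : measurableType disp} {R : realType}.
Context (nu : {measure set T -> \bar R}) (p : R).
Hypothesis p1 : 1 <= p.
Variables K1 K2 K12 : T -> probability T R.
Hypothesis mK2 : forall B, measurable B -> measurable_fun [set: T] (fun z => K2 z B).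
Hypothesis mK12 : forall B, measurable B -> measurable_fun [set: T] (fun z => K12 z B).
Hypothesis invK12 : forall B, measurable B -> (\int[nu]_z K12 z B = nu B)%E.
Hypothesis K12E : forall z B, measurable B -> K12 z B = (\int[K1 z]_w K2 w B)%E.

Lemma kernel_comp_integral z (f : T -> \bar R) : (forall y, 0 <= f y)%E ->
  measurable_fun [set: T] f ->
  (\int[K12 z]_y f y = \int[K1 z]_w \int[K2 w]_y f y)%E.
Proof.
move=> f0 mf; rewrite -(integral_mbind (K1 z) mK2)//.
by apply: eq_measure_integral => A mA _; exact: K12E.
Qed.

(** The composition formula is available for nonnegative functions. At a point z where f is
    [K12 z]-integrable, the [K2]-integrals of its positive and negative parts are [K1 z]-integrable,
    hence finite [K1 z]-a.e., and may be subtracted there. *)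
Lemma Kint_comp_ae (f : T -> R) : f \in Lfun nu p%:E ->
  Kint K12 f = Kint K1 (Kint K2 f) %[ae nu].
Proof.
move=> fL; have /Lfun_Ipow[//|mf _] := fL.
have := Kint_integrable_ae p1 mK12 invK12 fL; apply: filterS => z fi _.
have mEf : measurable_fun [set: T] (EFin \o f) by exact/measurable_EFinP.
pose P w := (\int[K2 w]_y ((EFin \o f)^\+ y))%E.
pose N w := (\int[K2 w]_y ((EFin \o f)^\- y))%E.
have mfp := measurable_funepos mEf; have mfn := measurable_funeneg mEf.
have mP : measurable_fun [set: T] P by exact: measurable_ge0_kernel_integral.
have mN : measurable_fun [set: T] N by exact: measurable_ge0_kernel_integral.
have iP : (K1 z).-integrable setT P.
  apply/integrableP; split => //.
  under eq_integral do rewrite gee0_abs ?integral_ge0//.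
  rewrite -kernel_comp_integral//; have := integrable_funepos measurableT fi.
  by move=> /integrableP[_]; under eq_integral do rewrite gee0_abs//.
have iN : (K1 z).-integrable setT N.
  apply/integrableP; split => //.
  under eq_integral do rewrite gee0_abs ?integral_ge0//.
  rewrite -kernel_comp_integral//; have := integrable_funeneg measurableT fi.
  by move=> /integrableP[_]; under eq_integral do rewrite gee0_abs//.
rewrite /Kint; congr fine.
rewrite integralE !kernel_comp_integral// -integralB//.
apply: ae_eq_integral => //.
- exact: emeasurable_funB.
- by apply/measurable_EFinP; exact: measurable_Kint.
have aP := integrable_ae measurableT iP; have aN := integrable_ae measurableT iN.
apply: filterS2 aP aN => w /(_ I) Pw /(_ I) Nw _.
have e : (\int[K2 w]_y (f y)%:E = P w - N w)%E by exact: integralE.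
by rewrite /= /Kint fineK e// fin_numB Pw Nw.
Qed.

End KernelComposition.

Section LnormDistance.
Context {disp : measure_display} {T : measurableType disp} {R : realType}.
Context {nu : {measure set T -> \bar R}} {p : R} {p1 : (1 <= p%:E)%E}.
Local Notation L := (LspaceType nu p1).
Local Notation dist f g := (Lnorm nu p%:E (fun z => (f z - g z)%:E)).
Implicit Types f g h : T -> R.

Lemma Lspace_Lfun (F : L) : (F : T -> R) \in Lfun nu p%:E.
Proof.
rewrite inE; apply/andP; split; rewrite inE/=.
  have H : measurable_fun [set: T] (F : T -> measurableTypeR R).
    exact: measurable_funP.
  exact H.
exact: Lebesgue_finite.
Qed.

Lemma dist_triangle f g h : measurable_fun [set: T] f ->
  measurable_fun [set: T] g -> measurable_fun [set: T] h ->
  (dist f h <= dist f g + dist g h)%E.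
Proof.
move=> mf mg mh.
have -> : (fun z => (f z - h z)%:E) = EFin \o ((f \- g) \+ (g \- h)).
  by apply/funext => z /=; rewrite addrA subrK.
by apply: minkowski_EFin => //; exact: measurable_funB.
Qed.

Lemma distC f g : dist f g = dist g f.
Proof.
rewrite -(Lnorm_abse nu (fun z => (f z - g z)%:E)).
rewrite -(Lnorm_abse nu (fun z => (g z - f z)%:E)).
by congr Lnorm; apply/funext => z /=; rewrite distrC.
Qed.

Lemma ae_eq_Lnorm f g : measurable_fun [set: T] f -> measurable_fun [set: T] g ->
  f = g %[ae nu] -> Lnorm nu p%:E (EFin \o f) = Lnorm nu p%:E (EFin \o g).
Proof.
move=> mf mg fg; rewrite !Lnorm_Ipow.
suff -> : Ipow nu p f = Ipow nu p g by [].
apply: (ge0_ae_eq_integral measurableT (measurable_Ipow_fun p mf)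
  (measurable_Ipow_fun p mg)).
- by move=> z _; rewrite lee_fin powR_ge0.
- by move=> z _; rewrite lee_fin powR_ge0.
- by apply: filterS fg => z /(_ I) + _ => ->.
Qed.

Lemma ae_eq_dist f f' g g' : measurable_fun [set: T] f -> measurable_fun [set: T] f' ->
  measurable_fun [set: T] g -> measurable_fun [set: T] g' ->
  f = f' %[ae nu] -> g = g' %[ae nu] -> dist f g = dist f' g'.
Proof.
move=> mf mf' mg mg' ff' gg'.
apply: (@ae_eq_Lnorm (f \- g) (f' \- g')); [exact: measurable_funB|exact: measurable_funB|].
by apply: filterS2 ff' gg' => z /(_ I) e1 /(_ I) e2 _ /=; rewrite e1 e2.
Qed.

Lemma dist_eq0 f g : measurable_fun [set: T] f -> measurable_fun [set: T] g ->
  dist f g = 0%E -> f = g %[ae nu].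
Proof.
move=> mf mg /Lnorm_eq0_eq0 fg.
have : ae_eq nu setT (fun z => (f z - g z)%:E) (cst 0%E).
  apply: fg; first by apply/measurable_EFinP; exact: measurable_funB.
  exact: lt_le_trans p1.
by apply: filterS => z /(_ I)/= [] /eqP; rewrite subr_eq0 => /eqP.
Qed.

End LnormDistance.

Section EFinConvergence.
Context {T : Type} {F : set_system T} {FF : Filter F} {R : realType}.

Lemma ge0_cvge0P (X : T -> \bar R) : (forall x, 0 <= X x)%E ->
  X @ F --> 0%E <-> forall e : R, 0 < e -> \forall x \near F, (X x <= e%:E)%E.
Proof.
move=> X0; split=> [/fine_cvgP[Xfin /cvgrPdist_le Xc] e e0|H].
  have := Xc e e0; apply: filterS2 Xfin => x xfin.
  by rewrite sub0r normrN ger0_norm ?fine_ge0// -lee_fin fineK.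
apply/fine_cvgP; split.
  apply: filterS (H 1 ltr01) => x x1.
  by rewrite ge0_fin_numE// (le_lt_trans x1)// ltry.
apply/cvgrPdist_le => e e0; apply: filterS (H e e0) => x xe.
rewrite sub0r normrN ger0_norm ?fine_ge0// -lee_fin fineK//.
by rewrite ge0_fin_numE// (le_lt_trans xe)// ltry.
Qed.

End EFinConvergence.

(** * From a semigroup of invariant kernels to a strongly continuous semigroup on L^p *)

Section KernelSemigroup.
Context {disp : measure_display} {T : measurableType disp} {R : realType}.
Context {nu : {measure set T -> \bar R}} {p : R} {p1 : (1 <= p%:E)%E}.
Local Notation L := (LspaceType nu p1).
Local Notation dist f g := (Lnorm nu p%:E (fun z => (f z - g z)%:E)).
Variable K : R -> T -> probability T R.
Hypothesis mK : forall t, 0 <= t -> forall B, measurable B ->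
  measurable_fun [set: T] (fun z => K t z B).
Hypothesis invK : forall t, 0 <= t -> forall B, measurable B ->
  (\int[nu]_z K t z B = nu B)%E.
Hypothesis K0 : forall z B, measurable B -> K 0 z B = \d_z B.
Hypothesis KD : forall s t, 0 <= s -> 0 <= t -> forall z B, measurable B ->
  K (s + t) z B = (\int[K s z]_w K t w B)%E.
Hypothesis K_dense : forall f, f \in Lfun nu p%:E -> forall e : R, 0 < e ->
  exists g, [/\ g \in Lfun nu p%:E, (dist f g <= e%:E)%E &
    dist (Kint (K t) g) g @[t --> 0^'+] --> 0%E].

Let p1' : 1 <= p. Proof. by move: p1; rewrite lee_fin. Qed.

Let mL (F : L) : measurable_fun [set: T] (F : T -> R).
Proof. by have /(Lfun_Ipow _ p1')[] := Lspace_Lfun F. Qed.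

Lemma dist_Kint_le t f g : 0 <= t -> f \in Lfun nu p%:E -> g \in Lfun nu p%:E ->
  (dist (Kint (K t) f) (Kint (K t) g) <= dist f g)%E.
Proof.
move=> t0 fL gL.
have /(Lfun_Ipow _ p1')[mf _] := fL; have /(Lfun_Ipow _ p1')[mg _] := gL.
have mfg : measurable_fun [set: T] (fun y => -1 * g y + f y).
  by apply: measurable_funD => //; exact: measurable_funM.
have -> : dist f g = Lnorm nu p%:E (EFin \o (fun y => -1 * g y + f y)).
  by congr Lnorm; apply/funext => y /=; rewrite mulN1r addrC.
apply: le_trans (le_Lnorm p1' (Ipow_Kint_le p1' (mK t0) (invK t0) mfg)).
rewrite le_eqVlt; apply/orP; left; apply/eqP.
apply: (@ae_eq_Lnorm _ _ _ _ p (Kint (K t) f \- Kint (K t) g)).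
- by apply: measurable_funB; apply: measurable_Kint => //; exact: mK.
- by apply: measurable_Kint => //; exact: mK.
have := Kint_linear_ae p1' (mK t0) (invK t0) (-1) gL fL.
by apply: filterS => z -> _ /=; rewrite mulN1r addrC.
Qed.

Lemma Kint_semigroup_exists : exists S : R -> L -> L,
  C0_positive_contraction_semigroup S /\
  forall t (F : L), 0 <= t -> S t F = Kint (K t) F %[ae nu].
Proof.
(* Nothing is asked for t < 0, where F is only a witness that makes the choice of S total. *)
have ex t (F : L) : exists H : L, 0 <= t -> H = Kint (K t) F %[ae nu].
  have [t0|t0] := leP 0 t; last by exists F.
  have [H HF] := @Lspace_of_Lfun _ _ _ _ _ p1 _
    (Kint_Lfun p1' (mK t0) (invK t0) (Lspace_Lfun F)).
  by exists H.
pose S t F := projT1 (cid (ex t F)).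
have SE t F : 0 <= t -> S t F = Kint (K t) F %[ae nu].
  by rewrite /S; case: cid.
have mS t F : 0 <= t -> measurable_fun [set: T] (Kint (K t) (F : L)).
  by move=> t0; apply: measurable_Kint => //; exact: mK.
have Sadd s t F : 0 <= s -> 0 <= t -> S (s + t) F = S s (S t F).
  move=> s0 t0; apply/LspaceP.
  have st0 : 0 <= s + t by exact: addr_ge0.
  apply: ae_eq_trans (SE _ _ st0) _.
  apply: ae_eq_trans (ae_eq_sym (SE _ _ s0)).
  have H1 := Kint_comp_ae p1' (mK t0) (mK st0) (invK st0)
    (KD s0 t0) (Lspace_Lfun F).
  apply: (ae_eq_trans H1).
  apply: (Kint_ae_eq (mK s0) (invK s0)) => //; first exact: mS.
  exact/ae_eq_sym/SE.
have Sdist t (F H : L) : 0 <= t -> (dist (S t F) (S t H) <= dist F H)%E.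
  move=> t0; apply: le_trans (dist_Kint_le t0 (Lspace_Lfun F) (Lspace_Lfun H)).
  rewrite le_eqVlt; apply/orP; left; apply/eqP; apply: ae_eq_dist => //.
  - exact: mS.
  - exact: mS.
  - exact: SE.
  - exact: SE.
have S00 F : S 0 F = F.
  apply/LspaceP; apply: ae_eq_trans (SE 0 F (lexx 0)) _.
  apply: aeW => z _; rewrite /Kint (eq_measure_integral (dirac z)); last first.
    by move=> A mA _; exact: K0.
  by rewrite integral_dirac// ?diracT ?mul1e//; exact/measurable_EFinP.
(* An e / 3 argument with an approximant g from [K_dense], contractivity controlling the image of F
   - g. The value h = 0, which the right limit at 0 omits, is handled apart. *)
have cont0 F (e : R) : 0 < e -> exists2 r, 0 < r & forall h, 0 <= h -> h < r ->
    (dist (S h F) F <= e%:E)%E.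
  move=> e0; have e30 : 0 < e / 3 by rewrite divr_gt0.
  have [g [gL Fg gc]] := K_dense (Lspace_Lfun F) e30.
  have /(Lfun_Ipow _ p1')[mg _] := gL.
  move: gc => /(ge0_cvge0P (fun t => Lnorm_ge0 _ _ _))/(_ _ e30)[r /= r0 rP].
  exists r => // h; rewrite le_eqVlt => /predU1P[<- _|h0 hr].
    rewrite S00 (_ : (fun z => _) = cst 0%E) ?Lnorm0 ?lee_fin ?(ltW e0)//.
      by rewrite gt_eqF// lte_fin (lt_le_trans ltr01).
    by apply/funext => z; rewrite subrr.
  have hg : (dist (Kint (K h) g) g <= (e / 3)%:E)%E.
    by apply: rP => //=; rewrite sub0r normrN gtr0_norm.
  have -> : dist (S h F) F = dist (Kint (K h) F) F.
    by apply: ae_eq_dist => //; [exact/mS/ltW|exact/SE/ltW|exact: ae_eq_refl].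
  have mKg : measurable_fun [set: T] (Kint (K h) g).
    by apply: measurable_Kint => //; exact/mK/ltW.
  apply: (le_trans (@dist_triangle _ _ _ nu p p1 _ _ _ (mS h F (ltW h0)) mKg (mL F))).
  have -> : e%:E = ((e / 3)%:E + ((e / 3)%:E + (e / 3)%:E))%E.
    by rewrite -!EFinD; congr EFin; lra.
  apply: leeD.
    exact: le_trans (dist_Kint_le (ltW h0) (Lspace_Lfun F) gL) Fg.
  apply: (le_trans (@dist_triangle _ _ _ nu p p1 _ _ _ mKg mg (mL F))).
  by apply: leeD => //; rewrite distC.
exists S; split; last by move=> t F; exact: SE.
split.
- move=> t a F H G t0 GE; apply: ae_eq_trans (SE _ _ t0) _.
  have mFH : measurable_fun [set: T] (fun z => a * F z + H z).
    by apply: measurable_funD => //; exact: measurable_funM.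
  apply: ae_eq_trans (Kint_ae_eq (mK t0) (invK t0) (mL G) mFH GE) _.
  have := Kint_linear_ae p1' (mK t0) (invK t0) a (Lspace_Lfun F) (Lspace_Lfun H).
  apply: filterS3 (SE _ F t0) (SE _ H t0) => z /(_ I) -> /(_ I) -> -> _.
  by [].
- exact: S00.
- exact: Sadd.
(* Both one-sided limits reduce to time 0: the semigroup law factors out the smaller of t and t0,
   and contractivity removes it. *)
- move=> F t0 t00; apply/(ge0_cvge0P (fun t => Lnorm_ge0 _ _ _)) => e e0.
  have [r r0 rP] := cont0 F e e0.
  rewrite near_withinE; apply/nbhs_ballP; exists r => // t.
  rewrite -ball_normE/= => t0r tp; rewrite /LnormB.
  have [tt0|tt0] := leP t t0.
    have h0 : 0 <= t0 - t by rewrite subr_ge0.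
    have -> : S t0 F = S t (S (t0 - t) F) by rewrite -Sadd// addrC subrK.
    apply: le_trans (Sdist _ _ _ tp) _; rewrite distC; apply: rP => //.
    by move: t0r; rewrite ger0_norm.
  have h0 : 0 <= t - t0 by rewrite subr_ge0 ltW.
  have -> : S t F = S t0 (S (t - t0) F) by rewrite -Sadd// addrC subrK.
  apply: le_trans (Sdist _ _ _ t00) _; apply: rP => //.
  by move: t0r; rewrite distrC ger0_norm.
- move=> t F t0 F0; have := Kint_ge0_ae (mK t0) (invK t0) (mL F) F0.
  by apply: filterS2 (SE t F t0) => z /(_ I) ->.
- move=> t F t0.
  apply: le_trans (le_Lnorm p1' (Ipow_Kint_le p1' (mK t0) (invK t0) (mL F))).
  rewrite le_eqVlt; apply/orP; left; apply/eqP.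
  by apply: ae_eq_Lnorm => //; [exact: mS|exact: SE].
Qed.

End KernelSemigroup.

(** * Approximation by bounded continuous functions *)

Section OpenApproximation.
Context {R : realType} {V : normedModType R}.
Variable U : set V.

(* Truncated at 1, so that [U = setT] needs no special treatment. *)
Let dists (x : V) := [set r : R | r = 1 \/ exists2 a, ~ U a & r = Num.min 1 `|x - a|].

Definition compl_dist (x : V) : R := inf (dists x).

Let dists_ge0 x r : dists x r -> 0 <= r.
Proof. by move=> [->|[a _ ->]] //; rewrite le_min ler01 normr_ge0. Qed.

Let compl_dist_le x r : dists x r -> compl_dist x <= r.
Proof. by move=> xr; apply: ge_inf => //; exists 0 => s; exact: dists_ge0. Qed.

Let le_compl_dist x c : (forall r, dists x r -> c <= r) -> c <= compl_dist x.
Proof. by move=> H; apply: lb_le_inf => //; exists 1; left. Qed.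

Lemma compl_dist_lipschitz x y : compl_dist x <= compl_dist y + `|x - y|.
Proof.
rewrite -lerBlDr; apply: le_compl_dist => r [->|[a Ua ->]].
  by rewrite lerBlDr ler_wpDr// compl_dist_le//; left.
have H : compl_dist x <= Num.min 1 `|x - a| by apply: compl_dist_le; right; exists a.
rewrite lerBlDr; apply: (le_trans H).
have := ler_distD y x a; have := normr_ge0 (x - y).
by rewrite [`|x - y| + _]addrC; move: `|x - y| `|x - a| `|y - a| => A B C;
  case: (leP 1 B); case: (leP 1 C); lra.
Qed.

Lemma continuous_compl_dist : continuous compl_dist.
Proof.
move=> x; apply/cvgrPdist_le => e e0; near=> y.
have xy : `|x - y| <= e.
  by near: y; apply: cvgr_dist_le => //; exact: cvg_id.
have h1 := compl_dist_lipschitz x y; have h2 := compl_dist_lipschitz y x.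
by rewrite distrC in h2; rewrite ler_norml; lra.
Unshelve. all: by end_near. Qed.

Lemma compl_dist_ge0 x : 0 <= compl_dist x.
Proof. by apply: le_compl_dist => r; exact: dists_ge0. Qed.

Lemma compl_dist_out x : ~ U x -> compl_dist x = 0.
Proof.
move=> Ux; apply/eqP; rewrite eq_le compl_dist_ge0 andbT; apply: compl_dist_le.
by right; exists x => //; rewrite subrr normr0 min_r.
Qed.

Lemma compl_dist_gt0 x : open U -> U x -> 0 < compl_dist x.
Proof.
move=> oU Ux; have /nbhs_ballP[r /= r0 xr] := open_nbhs_nbhs (conj oU Ux).
apply: (@lt_le_trans _ _ (Num.min 1 r)); first by rewrite lt_min ltr01 r0.
apply: le_compl_dist => s [->|[a Ua ->]]; first by rewrite ge_min lexx.
have ra : r <= `|x - a|.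
  by rewrite leNgt; apply/negP => xa; apply: Ua; apply: xr; rewrite -ball_normE.
by rewrite le_min !ge_min lexx ra orbT.
Qed.

(** Lipschitz functions increasing to the indicator of an open U. They carry statements about C_b
    over to open sets, and a pi-lambda argument then reaches all Borel sets. *)
Definition open_approx (n : nat) (x : V) : R := Num.min 1 (n%:R * compl_dist x).

Lemma continuous_open_approx n : continuous (open_approx n).
Proof.
move=> x; apply: (@continuous_comp _ _ _ (fun x => n%:R * compl_dist x)
  (fun r : R => Num.min 1 r)).
  apply: continuous_atM; first exact: continuous_at_cst.
  exact: continuous_compl_dist.
by apply: continuous_min; [exact: cvg_cst|exact: cvg_id].
Qed.

Lemma open_approx_ge0 n x : 0 <= open_approx n x.
Proof. by rewrite le_min ler01 mulr_ge0// compl_dist_ge0. Qed.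

Lemma open_approx_le1 n x : open_approx n x <= 1.
Proof. by rewrite ge_min lexx. Qed.

Lemma cvg_open_approx x : open U -> open_approx n x @[n --> \oo] --> (\1_U x : R).
Proof.
move=> oU; rewrite indicE; have [Ux|Ux] := pselect (U x); last first.
  rewrite memNset// (_ : (fun n => _) = cst 0); first exact: cvg_cst.
  by apply/funext => n; rewrite /open_approx compl_dist_out// mulr0 min_r.
rewrite mem_set//; apply: cvg_near_cst; near=> n.
rewrite /open_approx min_l// -ler_pdivrMr ?compl_dist_gt0// div1r.
near: n; exact: nbhs_infty_ger.
Unshelve. all: by end_near. Qed.

Lemma Cb_open_approx n : Cb (open_approx n).
Proof.
split; first exact: continuous_open_approx.
by apply/bounded_inP; exists 1 => x _; rewrite ger0_norm ?open_approx_ge0// open_approx_le1.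
Qed.

End OpenApproximation.

Section BorelProduct.
Context {R : realType} {d : nat}.
Local Notation E := 'rV[R]_d.

Lemma measurable_openE (U : set E) : open U -> measurable U.
Proof. by move=> oU; exact: sub_sigma_algebra. Qed.

Lemma rat_approx (x e : R) : 0 < e -> exists q : rat, `|x - ratr q| < e.
Proof.
move=> e0; have : x - e < x + e by lra.
move=> /rat_in_itvoo[q]; rewrite in_itv/= => /andP[h1 h2]; exists q.
by rewrite ltr_norml; lra.
Qed.

Lemma rat_row_approx (x : E) (e : R) : 0 < e ->
  exists q : 'rV[rat]_d, `|x - map_mx ratr q| < e.
Proof.
move=> e0; have e20 : 0 < e / 2 by rewrite divr_gt0.
have /choice[q qP] : forall i, exists q : rat, `|x 0 i - ratr q| < e / 2.
  by move=> i; exact: rat_approx.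
exists (\row_i q i); apply: (@le_lt_trans _ _ (e / 2)); last by lra.
by apply: rV_norm_le => [|i]; [exact: ltW|rewrite !mxE ltW].
Qed.

(** Each point of U lies in a box inside U with rational centre and radius 1 / (n + 1); there are
    countably many such boxes, and they are measurable. *)
Lemma measurable_open_prod (U : set (R * E)) : open U -> measurable U.
Proof.
move=> oU; pose r (n : nat) : R := n.+1%:R^-1.
have r0 n : 0 < r n by rewrite invr_gt0.
pose box (i : rat * 'rV[rat]_d * nat) : set (R * E) :=
  ball (ratr i.1.1 : R) (r i.2) `*` ball (map_mx ratr i.1.2 : E) (r i.2).
have -> : U = \bigcup_(i in [set i | box i `<=` U]) box i.
  apply/seteqP; split => [z Uz|z [i iU iz]]; last exact: iU.
  have /nbhs_ballP[e /= e0 ze] := open_nbhs_nbhs (conj oU Uz).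
  have [n ne] : exists n, r n < e / 2.
    have e20 : 0 < e / 2 by rewrite divr_gt0.
    have := near_infty_natSinv_lt (PosNum e20).
    by move=> [n _ /(_ n (leqnn n))/= nP]; exists n.
  have [a az] := rat_approx z.1 (r0 n); have [v vz] := rat_row_approx z.2 (r0 n).
  exists (a, v, n); last by split => /=; rewrite -ball_normE/= distrC.
  move=> y []; rewrite -!ball_normE/= => y1 y2.
  have e2 : r n + r n < e by rewrite [e]splitr ltrD.
  apply: ze; split; rewrite -ball_normE/=.
    apply: le_lt_trans (ler_distD (ratr a) _ _) (lt_trans _ e2).
    exact: ltrD.
  apply: le_lt_trans (ler_distD (map_mx ratr v) _ _) (lt_trans _ e2).
  exact: ltrD.
rewrite bigcup_mkcond; apply: countable_bigcupT_measurable => // i.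
case: ifP => // _; apply: measurableX; first exact: measurable_ball.
by apply: measurable_openE; exact: ball_open.
Qed.

Lemma open_measurable_fun (disp : measure_display) (T : measurableType disp)
    (f : T -> R) : (forall U, open U -> measurable (f @^-1` U)) ->
  measurable_fun [set: T] f.
Proof.
move=> fU; apply: (measurability _ (RGenOpens.measurableE R)).
move=> _ [_ [a [b ->] <-]]; rewrite setTI; apply: fU.
exact: interval_open.
Qed.

Lemma continuous_measurable_prod (f : R * E -> R) : continuous f ->
  measurable_fun [set: R * E] f.
Proof.
move=> cf; apply: open_measurable_fun => U oU; apply: measurable_open_prod.
by apply: open_comp => // x _; exact: cf.
Qed.

Lemma continuous_measurable_rV (f : E -> R) : continuous f ->
  measurable_fun [set: E] f.
Proof.
move=> cf; apply: open_measurable_fun => U oU; apply: measurable_openE.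
by apply: open_comp => // x _; exact: cf.
Qed.

Lemma Cb_Bb (f : E -> R) : Cb f -> Bb f.
Proof. by move=> [cf bf]; split => //; exact: continuous_measurable_rV. Qed.

Lemma measurable_borel_rV : @measurable _ E = <<s [set U : set E | open U] >>.
Proof. by []. Qed.

(** This makes the open sets a generating pi-system, where the product structure itself only offers
    measurable rectangles. The nontrivial inclusion is the Borel measurability of the two
    projections. *)
Lemma measurable_borel_prod :
  @measurable _ (R * E)%type = <<s [set U : set (R * E) | open U] >>.
Proof.
apply/seteqP; split; last first.
  apply: smallest_sub; first exact: sigma_algebra_measurable.
  by move=> U; exact: measurable_open_prod.
rewrite measurable_prod_measurableType; apply: smallest_sub.
  exact: smallest_sigma_algebra.
pose B := g_sigma_algebraType [set U : set (R * E) | open U].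
have mfst : measurable_fun [set: B] (fst : B -> R).
  apply: open_measurable_fun => U oU; apply: sub_sigma_algebra.
  by apply: open_comp => // x _; exact: cvg_fst.
have msnd : measurable_fun [set: B] (snd : B -> E).
  apply: (measurability _ measurable_borel_rV) => _ [U oU <-].
  rewrite setTI; apply: sub_sigma_algebra.
  by apply: open_comp => // x _; exact: cvg_snd.
move=> _ [J mJ [K mK <-]].
have -> : J `*` K = (fst @^-1` J) `&` (snd @^-1` K) by apply/seteqP; split=> -[].
apply: (@measurableI _ B).
  by rewrite -[X in measurable X]setTI; exact: mfst.
by rewrite -[X in measurable X]setTI; exact: msnd.
Qed.

End BorelProduct.

Section Convergence.
Context {disp : measure_display} {T : measurableType disp} {R : realType}.
Context (m : {measure set T -> \bar R}) (D : set T).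
Hypotheses (mD : measurable D) (mDoo : (m D < +oo)%E).

Lemma integrable_cst_in (M : R) : m.-integrable D (cst M%:E).
Proof.
apply/integrableP; split; first exact: measurable_cst.
rewrite /= integral_cst//=.
by apply: lte_mul_pinfty.
Qed.

Lemma bounded_convergence (f_ : nat -> T -> R) (f : T -> R) (M : R) :
  (forall n, measurable_fun [set: T] (f_ n)) -> measurable_fun [set: T] f ->
  (forall n x, D x -> `|f_ n x| <= M) ->
  (forall x, D x -> f_ n x @[n --> \oo] --> f x) ->
  [/\ m.-integrable D (EFin \o f),
   (\int[m]_(x in D) (`|f_ n x - f x|)%:E)%E @[n --> \oo] --> 0%E &
  (\int[m]_(x in D) (f_ n x)%:E)%E @[n --> \oo] --> (\int[m]_(x in D) (f x)%:E)%E].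
Proof.
move=> mf_ mf f_le f_f.
apply: (@dominated_convergence _ _ _ m _ mD (fun n => EFin \o f_ n) (EFin \o f)
  (cst M%:E)).
- by move=> n; apply/measurable_EFinP; exact: measurable_funTS.
- by apply/measurable_EFinP; exact: measurable_funTS.
- by apply: aeW => x Dx; apply: cvg_EFin; [exact: nearW|exact: f_f].
- exact: integrable_cst_in.
- by apply: aeW => x n Dx; rewrite /= lee_fin f_le.
Qed.

Lemma integral_dist_triangle (f g h : T -> R) : measurable_fun [set: T] f ->
  measurable_fun [set: T] g -> measurable_fun [set: T] h ->
  (\int[m]_(x in D) `|f x - h x|%:E <=
   \int[m]_(x in D) `|f x - g x|%:E + \int[m]_(x in D) `|g x - h x|%:E)%E.
Proof.
move=> mf mg mh; have mB (u v : T -> R) : measurable_fun [set: T] u ->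
    measurable_fun [set: T] v -> measurable_fun D (fun x => `|u x - v x|%:E).
  move=> mu mv; apply/measurable_EFinP; apply: measurable_funTS.
  by apply: measurableT_comp => //; exact: measurable_funB.
rewrite -ge0_integralD//; [|exact: mB|exact: mB].
apply: ge0_le_integral => //; [exact: mB| |].
  by apply: emeasurable_funD; exact: mB.
by move=> x _; rewrite -EFinD lee_fin ler_distD.
Qed.

End Convergence.

Section ContinuousApproximation.
Context {R : realType} {d : nat}.
Local Notation V := (R * 'rV[R]_d)%type.
Context (m : {measure set V -> \bar R}) (D : set V).
Hypotheses (mD : measurable D) (mDoo : (m D < +oo)%E).

(** The distance is that of L^1 on D, for which linearity and bounded limits are immediate; for
    bounded functions [Cb_slab_dense] converts it into an L^p distance. *)
Definition Cb_approximable (h : V -> R) := measurable_fun [set: V] h /\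
  forall e : R, 0 < e -> exists2 f, Cb f & (\int[m]_(x in D) `|h x - f x|%:E <= e%:E)%E.

Lemma Cb_approximable_Cb f : Cb f -> Cb_approximable f.
Proof.
move=> Cf; split; first by apply: continuous_measurable_prod; case: Cf.
move=> e e0; exists f => //.
rewrite (eq_integral (cst 0%E)) ?integral0 ?lee_fin ?ltW// => x _.
by rewrite subrr normr0.
Qed.

Lemma Cb_linear (T : topologicalType) (a : R) (f g : T -> R) :
  Cb f -> Cb g -> Cb (fun x => a * f x + g x).
Proof.
move=> [cf /bounded_inP[M fM]] [cg /bounded_inP[N gN]]; split.
  move=> x; apply: continuous_atD; last exact: cg.
  by apply: continuous_atM; [exact: continuous_at_cst|exact: cf].
apply/bounded_inP; exists (`|a| * M + N) => x _.
by rewrite (le_trans (ler_normD _ _))// lerD ?gN// normrM ler_wpM2l ?fM.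
Qed.

Lemma Cb_approximable_linear a h k : Cb_approximable h -> Cb_approximable k ->
  Cb_approximable (fun x => a * h x + k x).
Proof.
move=> [mh hP] [mk kP]; have mhk : measurable_fun [set: V] (fun x => a * h x + k x).
  by apply: measurable_funD => //; apply: measurable_funM.
split=> // e e0.
pose e' := e / (`|a| + 1).
have a0 : 0 < `|a| + 1 by rewrite ltr_wpDl.
have e'0 : 0 < e' by rewrite divr_gt0.
have [f Cf hf] := hP e' e'0; have [g Cg kg] := kP e' e'0.
exists (fun x => a * f x + g x); first exact: Cb_linear.
have mf : measurable_fun [set: V] f by apply: continuous_measurable_prod; case: Cf.
have mg : measurable_fun [set: V] g by apply: continuous_measurable_prod; case: Cg.
have mB (u v : V -> R) : measurable_fun [set: V] u ->
    measurable_fun [set: V] v -> measurable_fun D (fun x => `|u x - v x|%:E).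
  move=> mu mv; apply/measurable_EFinP; apply: measurable_funTS.
  by apply: measurableT_comp => //; exact: measurable_funB.
have maB : measurable_fun D (fun x => `|a|%:E * `|h x - f x|%:E)%E.
  by apply: measurable_funeM; exact: mB.
apply: (@le_trans _ _ (\int[m]_(x in D) (`|a|%:E * `|h x - f x|%:E + `|k x - g x|%:E))%E).
  apply: ge0_le_integral => //.
  - apply: mB => //; apply: measurable_funD => //; exact: measurable_funM.
  - by apply: emeasurable_funD => //; exact: mB.
  - move=> x _; rewrite -EFinM -EFinD lee_fin -normrM.
    by rewrite (le_trans _ (ler_normD _ _))// le_eqVlt; apply/orP; left; apply/eqP; congr `|_|; ring.
rewrite ge0_integralD//; last exact: mB.
rewrite ge0_integralZl_EFin//; last exact: mB.
apply: (@le_trans _ _ (`|a|%:E * e'%:E + e'%:E)%E).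
  by apply: leeD => //; apply: lee_wpmul2l.
rewrite -EFinM -EFinD lee_fin -[X in _ + X]mul1r -mulrDl.
by rewrite /e' mulrC divfK// gt_eqF.
Qed.

Lemma Cb_approximable_lim (h_ : nat -> V -> R) h M :
  (forall n, Cb_approximable (h_ n)) -> (forall n x, `|h_ n x| <= M) ->
  (forall x, h_ n x @[n --> \oo] --> h x) -> Cb_approximable h.
Proof.
move=> aph hM hh; have mh_ n : measurable_fun [set: V] (h_ n) by case: (aph n).
have mh : measurable_fun [set: V] h by apply: (measurable_fun_cvg mh_) => x _; exact: hh.
split=> // e e0; have e20 : 0 < e / 2 by rewrite divr_gt0.
have [_ H _] := bounded_convergence mD mDoo mh_ mh (fun n x _ => hM n x) (fun x _ => hh x).
have /ge0_cvge0P/(_ _ e20)[|N _ /(_ N (leqnn _))/= HN] := H.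
  by move=> n; apply: integral_ge0 => x _; rewrite lee_fin.
have [f Cf hf] := (aph N).2 _ e20; exists f => //.
have mf : measurable_fun [set: V] f by apply: continuous_measurable_prod; case: Cf.
apply: le_trans (integral_dist_triangle m mD mh (mh_ N) mf) _.
rewrite [e]splitr EFinD leeD//; apply: le_trans HN.
by under eq_integral do rewrite distrC.
Qed.

(** Dynkin's theorem from the open sets: complements follow by linearity from the constant 1, and
    disjoint unions are bounded limits of finite sums. *)
Lemma Cb_approximable_indic (B : set V) : measurable B -> Cb_approximable (\1_B).
Proof.
have E0 : Cb_approximable (cst 0).
  apply: Cb_approximable_Cb; split; first by move=> x; exact: continuous_at_cst.
  by apply/bounded_inP; exists 0 => x _; rewrite /cst normr0.
have E1 : Cb_approximable (cst 1).
  apply: Cb_approximable_Cb; split; first by move=> x; exact: continuous_at_cst.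
  by apply/bounded_inP; exists 1 => x _; rewrite /cst normr1.
rewrite measurable_borel_prod.
apply: (dynkin_induction (P := [set B | Cb_approximable \1_B])).
- exact: measurable_borel_prod.
- by move=> A B0 oA oB; exact: openI.
- by rewrite /= indicT.
- move=> U oU; apply: (@Cb_approximable_lim (open_approx U) _ 1).
  + by move=> n; apply: Cb_approximable_Cb; exact: Cb_open_approx.
  + by move=> n x; rewrite ger0_norm ?open_approx_ge0 ?open_approx_le1.
  + by move=> x; exact: cvg_open_approx.
- move=> S mS HS; have := Cb_approximable_linear (-1) HS E1.
  congr Cb_approximable; apply/funext => x.
  by rewrite indicC indicE; case: (x \in S) => /=; ring.
- move=> F mF tF HF.
  apply: (@Cb_approximable_lim (fun n => \1_(\bigcup_(i < n) F i)) _ 1).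
  + elim=> [|n IH].
      by rewrite (_ : \bigcup_(_ < _) _ = set0) ?indic0// II0 bigcup_set0.
    have := Cb_approximable_linear 1 IH (HF n).
    congr Cb_approximable; apply/funext => x; rewrite mul1r !indicE.
    rewrite (bigcup_mkord n.+1) big_ord_recr/= in_setU -bigcup_mkord.
    have [xn|xn] := boolP (x \in F n); last by rewrite orbF addr0.
    rewrite memNset ?add0r// => -[i /= ni xi].
    have := tF i n I I; move/set_mem in xn; move=> /(_ (ex_intro _ x (conj xi xn))).
    by move=> ii; rewrite ii ltnn in ni.
  + by move=> n x; rewrite indicE; case: (_ \in _); rewrite ?normr1 ?normr0.
  + move=> x; rewrite indicE; have [[k _ xk]|xF] := pselect ((\bigcup_i F i) x).
      rewrite mem_set; last by exists k.
      apply: cvg_near_cst; exists k.+1 => // n /= kn.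
      by rewrite indicE mem_set//; exists k.
    rewrite memNset//; apply: cvg_near_cst; apply: nearW => n.
    by rewrite indicE memNset// => -[k _ xk]; apply: xF; exists k.
Qed.

Import HBNNSimple.

Lemma Cb_approximable_bounded (h : V -> R) M : measurable_fun [set: V] h ->
  (forall x, `|h x| <= M) -> Cb_approximable h.
Proof.
(* The shift by M makes h nonnegative, so that increasing simple functions, bounded by 2 M,
   approximate it. *)
move=> mh hM; pose h' x := h x + M.
have h'0 x : 0 <= h' x by have := hM x; rewrite ler_norml /h'; lra.
have mh' : measurable_fun [set: V] h' by apply: measurable_funD.
have mEh' : measurable_fun [set: V] (EFin \o h') by exact/measurable_EFinP.
have E0 M' : Cb_approximable (cst M').
  apply: Cb_approximable_Cb; split; first by move=> x; exact: continuous_at_cst.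
  by apply/bounded_inP; exists `|M'|.
suff : Cb_approximable h'.
  move=> /(Cb_approximable_linear 1)/(_ (E0 (- M))).
  by congr Cb_approximable; apply/funext => x; rewrite /cst /h' mul1r addrK.
pose g := nnsfun_approx measurableT mEh'.
have gh' x n : 0 <= g n x <= h' x.
  rewrite fun_ge0 /= -lee_fin /g nnsfun_approxE.
  by apply: le_approx => // y _; rewrite lee_fin.
apply: (@Cb_approximable_lim g _ (M + M)).
- move=> n; rewrite (funext (fimfunEord (g n))).
  move: (fset_set _) => s'; elim: (size _) => [|k IH].
    rewrite (_ : (fun _ => _) = cst 0)//.
    by apply/funext => x; rewrite big_ord0.
  pose r := (finmap.enum_fset s')`_k.
  have mk : measurable (g n @^-1` [set r]) by exact: measurable_funPTI.
  have := Cb_approximable_linear r (Cb_approximable_indic mk) IH.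
  by congr Cb_approximable; apply/funext => x; rewrite big_ord_recr/= addrC.
- move=> n x; have /andP[g0 gh] := gh' x n; rewrite ger0_norm//.
  by apply: le_trans gh _; have := hM x; rewrite ler_norml /h'; lra.
- move=> x; have H : EFin \o g^~ x @ \oo --> (h' x)%:E.
    exact: (@cvg_nnsfun_approx _ _ _ _ measurableT _ mEh' (fun x _ => h'0 x) x I).
  exact: (fine_cvg H).
Qed.

End ContinuousApproximation.

(** * Dominated convergence and dense functions in L^p *)

Section DominatedLp.
Context {disp : measure_display} {T : measurableType disp} {R : realType}.
Context {nu : {measure set T -> \bar R}} {p : R} (p1 : 1 <= p).
Local Notation dist f g := (Lnorm nu p%:E (fun z => (f z - g z)%:E)).
Implicit Types f g h : T -> R.

Lemma le_Ipow f g : measurable_fun [set: T] f -> measurable_fun [set: T] g ->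
  (forall z, `|f z| <= `|g z|) -> (Ipow nu p f <= Ipow nu p g)%E.
Proof.
move=> mf mg fg; apply: ge0_le_integral => //.
- exact: measurable_Ipow_fun.
- exact: measurable_Ipow_fun.
- move=> z _; rewrite lee_fin ge0_ler_powR// ?nnegrE//.
  by rewrite (le_trans _ p1).
Qed.

Lemma le_Lfun f g : measurable_fun [set: T] f -> g \in Lfun nu p%:E ->
  (forall z, `|f z| <= `|g z|) -> f \in Lfun nu p%:E.
Proof.
move=> mf /(Lfun_Ipow _ p1)[mg goo] fg; apply/(Lfun_Ipow _ p1).
split; first exact: mf.
exact: le_lt_trans (le_Ipow mf mg fg) goo.
Qed.

Lemma le_dist_Ipow f g (e : R) : 0 <= e -> (Ipow nu p (f \- g)%R <= (e `^ p)%:E)%E ->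
  (dist f g <= e%:E)%E.
Proof.
move=> e0 H.
have p0 : p != 0 by rewrite gt_eqF// (lt_le_trans _ p1).
rewrite (_ : (fun z => _) = EFin \o (f \- g))// Lnorm_Ipow.
have -> : e%:E = ((e `^ p)%:E `^ p^-1)%E.
  by rewrite poweR_EFin -powRrM mulfV// powRr1.
apply: gt0_ler_poweR => //.
- by rewrite invr_ge0 (le_trans _ p1).
- by rewrite in_itv/= Ipow_ge0// leey.
- by rewrite in_itv/= lee_fin powR_ge0 leey.
Qed.

Lemma dominated_dist_cvg (f_ : nat -> T -> R) f g :
  (forall n, measurable_fun [set: T] (f_ n)) -> measurable_fun [set: T] f ->
  g \in Lfun nu p%:E -> (forall n z, `|f_ n z - f z| <= `|g z|) ->
  (forall z, f_ n z @[n --> \oo] --> f z) -> dist (f_ n) f @[n --> \oo] --> 0%E.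
Proof.
move=> mf_ mf /(Lfun_Ipow _ p1)[mg goo] fg f_f.
have p0 : 0 < p by exact: lt_le_trans p1.
have mB n : measurable_fun [set: T] (f_ n \- f) by exact: measurable_funB.
apply/ge0_cvge0P; first by move=> n; exact: Lnorm_ge0.
move=> e e0.
have h1 : {ae nu, forall z, [set: T] z ->
    (`|(f_ n \- f)%R z| `^ p)%:E @[n --> \oo] --> (cst 0%E z : \bar R)}.
  apply: aeW => z _; apply: cvg_EFin; first exact: nearW.
  apply/cvgrPdist_le => e' e'0; near=> n.
  rewrite sub0r normrN (ger0_norm (powR_ge0 _ _)).
  have -> : e' = (e' `^ p^-1) `^ p by rewrite -powRrM mulVf ?powRr1 ?(ltW e'0)// gt_eqF.
  rewrite ge0_ler_powR ?nnegrE ?powR_ge0 ?(ltW p0)//= distrC.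
  near: n; have /cvgrPdist_le := f_f z; apply; exact: powR_gt0.
have h2 : nu.-integrable [set: T] (fun z => (`|g z| `^ p)%:E).
  apply/integrableP; split; first exact: measurable_Ipow_fun.
  by under eq_integral do rewrite gee0_abs ?lee_fin ?powR_ge0//.
have h3 : {ae nu, forall z n, [set: T] z ->
    (`|(`|(f_ n \- f)%R z| `^ p)%:E| <= (`|g z| `^ p)%:E)%E}.
  apply: aeW => z n _; rewrite gee0_abs ?lee_fin ?powR_ge0//.
  by rewrite ge0_ler_powR ?nnegrE ?(ltW p0)//; exact: fg.
have [_ H _] := @dominated_convergence _ _ _ nu _ measurableT
  (fun n z => (`|(f_ n \- f)%R z| `^ p)%:E) (cst 0%E) (fun z => (`|g z| `^ p)%:E)
  (fun n => measurable_Ipow_fun p (mB n)) (measurable_cst _) h1 h2 h3.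
have Hp : (Ipow nu p (f_ n \- f)%R) @[n --> \oo] --> 0%E.
  move: H; apply: cvg_trans; apply: near_eq_cvg; apply: nearW => n.
  apply: eq_integral => z _.
  by rewrite /cst sube0 gee0_abs// lee_fin powR_ge0.
move: Hp => /(ge0_cvge0P (fun n => Ipow_ge0 nu p (f_ n \- f)%R))/(_ (e `^ p)).
move=> /(_ (powR_gt0 _ e0)); apply: filterS => n H'.
by apply: le_dist_Ipow => //; exact: ltW.
Unshelve. all: by end_near. Qed.

Lemma dominated_dist_cvg_at_right (f_ : R -> T -> R) f g :
  (forall t : R, 0 < t <= 1 -> measurable_fun [set: T] (f_ t)) -> measurable_fun [set: T] f ->
  g \in Lfun nu p%:E -> (forall (t : R) z, 0 < t <= 1 -> `|f_ t z - f z| <= `|g z|) ->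
  (forall z, f_ t z @[t --> 0^'+] --> f z) -> dist (f_ t) f @[t --> 0^'+] --> 0%E.
Proof.
move=> mf_ mf gL fg f_f.
have min1 (t : R) : 0 < t -> 0 < Num.min t 1 <= 1.
  by move=> t0; rewrite lt_min t0 ltr01 ge_min lexx orbT.
have near1 : \forall t \near 0^'+, Num.min t 1 = t :> R.
  by near=> t; rewrite min_l//; near: t; exact: nbhs_right_le.
(* The sequential criterion ranges over all positive sequences tending to 0. Truncating at 1 keeps
   them in the range where domination is assumed, without changing the limit. *)
suff H : dist (f_ (Num.min t 1)) f @[t --> 0^'+] --> 0%E.
  apply: cvg_trans H; apply: near_eq_cvg; apply: filterS near1 => t ->.
  by [].
apply/cvge_at_rightP => u [u0 ucvg].
apply: (@dominated_dist_cvg (fun n => f_ (Num.min (u n) 1)) f g) => //.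
- by move=> n; exact: mf_ (min1 _ (u0 n)).
- by move=> n z; exact: fg (min1 _ (u0 n)).
- move=> z; have H : f_ (Num.min t 1) z @[t --> 0^'+] --> f z.
    apply: cvg_trans (f_f z); apply: near_eq_cvg; apply: filterS near1 => t ->.
    by [].
  by have /cvg_at_rightP := H; apply.
Unshelve. all: by end_near. Qed.

End DominatedLp.

Lemma continuous_at_clip (R : realType) (T : topologicalType) (f : T -> R) (a c : R) x :
  continuous_at x f -> continuous_at x (fun y => Num.max a (Num.min c (f y))).
Proof.
move=> cf.
apply: (@continuous_comp _ _ _ f (fun r : R => Num.max a (Num.min c r))) => //.
apply: continuous_max; first exact: cvg_cst.
by apply: continuous_min; [exact: cvg_cst|exact: cvg_id].
Qed.

(** Clipping to [-N, N] is 1-Lipschitz and fixes a. *)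
Lemma clip_dist (R : realDomainType) (N a c : R) : `|a| <= N ->
  `|a - Num.max (- N) (Num.min N c)| <= `|a - c|.
Proof.
rewrite ler_norml => /andP[h1 h2].
have [Nc|cN] := leP N c.
  rewrite max_r; last by lra.
  by rewrite !ler0_norm; lra.
have [//|Nc] := leP (- N) c.
by rewrite !ger0_norm; lra.
Qed.

Section Density.
Context {R : realType} {d : nat}.
Local Notation V := (R * 'rV[R]_d)%type.
Context {nu : {measure set V -> \bar R}} {p : R} (p1 : 1 <= p).
Local Notation dist f g := (Lnorm nu p%:E (fun z => (f z - g z)%:E)).

(** Bounded in time but not in space: this already has finite measure for the nu at hand, because
    every mu_t is a probability measure. *)
Definition slab (r : R) : set V := [set z | `|z.1| <= r].

Hypothesis nu_slab : forall r, (nu (slab r) < +oo)%E.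

Lemma measurable_slab r : measurable (slab r).
Proof.
have -> : slab r = (fun z : V => `|z.1|) @^-1` `]-oo, r].
  by apply/seteqP; split => z /=; rewrite in_itv.
rewrite -[X in measurable X]setTI; apply: continuous_measurable_prod => //.
by move=> z; apply: (@continuous_comp _ _ _ fst (fun t : R => `|t|));
  [exact: cvg_fst|exact: norm_continuous].
Qed.

Lemma slab_Lfun (M r : R) : (fun z => M * \1_(slab r) z) \in Lfun nu p%:E.
Proof.
apply/(Lfun_Ipow _ p1); split.
  by apply: measurable_funM => //; apply: measurable_indic; exact: measurable_slab.
rewrite /Ipow (_ : (fun z => _) = (fun z => (`|M| `^ p)%:E * (\1_(slab r) z)%:E)%E).
  rewrite ge0_integralZl_EFin ?powR_ge0//; last first.
  - apply/measurable_EFinP; apply: measurable_indic; exact: measurable_slab.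
  rewrite integral_indic ?setIT//; last exact: measurable_slab.
  by apply: lte_mul_pinfty => //; rewrite lee_fin powR_ge0.
apply/funext => z; rewrite -EFinM indicE; case: (_ \in _); rewrite ?mulr1//.
by rewrite !mulr0 normr0 powR0// gt_eqF// (lt_le_trans _ p1).
Qed.

Lemma bounded_slab_Lfun (f : V -> R) M r : measurable_fun [set: V] f ->
  (forall z, `|f z| <= M) -> (forall z, r < `|z.1| -> f z = 0) -> f \in Lfun nu p%:E.
Proof.
move=> mf fM f0; apply: (le_Lfun p1 mf (slab_Lfun M r)) => z.
rewrite indicE; have [zr|zr] := leP `|z.1| r.
  by rewrite mem_set// mulr1 (le_trans (fM z))// ler_norm.
by rewrite f0// normr0.
Qed.

Definition time_cutoff (n : R) (z : V) : R := Num.max 0 (Num.min 1 (n + 1 - `|z.1|)).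

Lemma time_cutoff_itv n z : 0 <= time_cutoff n z <= 1.
Proof. by rewrite le_max lexx/= ge_max ler01/= ge_min lexx. Qed.

Lemma time_cutoff_in n z : `|z.1| <= n -> time_cutoff n z = 1.
Proof.
move=> zn; rewrite /time_cutoff min_l ?max_r//.
by lra.
Qed.

Lemma time_cutoff_out n z : n + 1 < `|z.1| -> time_cutoff n z = 0.
Proof. by move=> zn; rewrite /time_cutoff max_l// ge_min; apply/orP; right; lra. Qed.

Lemma continuous_time_cutoff n : continuous (time_cutoff n).
Proof.
move=> z; apply: continuous_at_clip; apply: continuous_atB; first exact: continuous_at_cst.
by apply: (@continuous_comp _ _ _ fst (fun t : R => `|t|));
  [exact: cvg_fst|exact: norm_continuous].
Qed.

Lemma truncation_dist (f : V -> R) (e : R) : f \in Lfun nu p%:E -> 0 < e ->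
  exists (N : R) (h : V -> R), [/\ 0 < N, measurable_fun [set: V] h, forall z, `|h z| <= N,
    forall z, N < `|z.1| -> h z = 0 & (dist f h <= e%:E)%E].
Proof.
move=> fL e0; have /(Lfun_Ipow _ p1)[mf _] := fL.
(* The same number n + 1 bounds the values and the time support. The error f - f 1_A is dominated by
   |f| itself. *)
pose A (n : nat) := [set z : V | `|f z| <= n.+1%:R] `&` slab n.+1%:R.
have mA n : measurable (A n).
  apply: measurableI; last exact: measurable_slab.
  have -> : [set z : V | `|f z| <= n.+1%:R] = (fun z => `|f z|) @^-1` `]-oo, n.+1%:R].
    by apply/seteqP; split => z /=; rewrite in_itv.
  by rewrite -[X in measurable X]setTI; exact: measurableT_comp.
pose h n z := f z * \1_(A n) z.
have mh n : measurable_fun [set: V] (h n).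
  by apply: measurable_funM => //; apply: measurable_indic.
have /ge0_cvge0P/(_ e e0)[|n _ /(_ n (leqnn _)) /= Hn] : dist (h n) f @[n --> \oo] --> 0%E.
- apply: (dominated_dist_cvg p1 mh mf fL).
    move=> n z; rewrite /h indicE; case: (_ \in _).
      by rewrite mulr1 subrr normr0.
    by rewrite mulr0 sub0r normrN.
  move=> z; apply: cvg_near_cst; near=> n.
  rewrite /h indicE mem_set ?mulr1//; split => /=.
    by rewrite (@le_trans _ _ n%:R)//; [near: n; exact: nbhs_infty_ger|rewrite ler_nat].
  by rewrite /slab /= (@le_trans _ _ n%:R)//; [near: n; exact: nbhs_infty_ger|rewrite ler_nat].
- by move=> n; exact: Lnorm_ge0.
exists n.+1%:R, (h n); split => //.
- move=> z; rewrite /h indicE; have [/set_mem[]//|_] := boolP (z \in A n).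
    by rewrite mulr1.
  by rewrite mulr0 normr0.
- move=> z zn; rewrite /h indicE memNset ?mulr0// => -[_] /=.
  by rewrite /slab /= leNgt zn.
- by rewrite distC.
Unshelve. all: by end_near. Qed.

Lemma Cb_slab_dense (f : V -> R) (e : R) : f \in Lfun nu p%:E -> 0 < e ->
  exists g : V -> R, [/\ Cb g, exists r, forall z, r < `|z.1| -> g z = 0, g \in Lfun nu p%:E
    & (dist f g <= e%:E)%E].
Proof.
move=> fL e0; have e20 : 0 < e / 2 by rewrite divr_gt0.
have /(Lfun_Ipow _ p1)[mf _] := fL.
have [N [h [N0 mh hN h0 fh]]] := truncation_dist fL e20.
pose D := slab (N + 1); have mD : measurable D by exact: measurable_slab.
(* As |h - g| <= 2 N, we have |h - g|^p <= c |h - g|. An L^1 error of (e / 2)^p / c thus becomes an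
   L^p error of e / 2. *)
pose c := (N + N) `^ (p - 1).
have c0 : 0 < c by rewrite powR_gt0// addr_gt0.
have e'0 : 0 < (e / 2) `^ p / c by rewrite divr_gt0// powR_gt0.
have [_ /(_ _ e'0)[phi Cphi Hphi]] := Cb_approximable_bounded mD (nu_slab _) mh hN.
have mphi : measurable_fun [set: V] phi.
  by apply: continuous_measurable_prod; case: Cphi.
pose psi z := Num.max (- N) (Num.min N (phi z)).
have psiN z : `|psi z| <= N.
  by rewrite /psi ler_norml le_max lexx/= ge_max ge_min lexx/= andbT; lra.
have cpsi : continuous psi.
  by move=> z; apply: continuous_at_clip; case: Cphi => /(_ z).
pose g z := time_cutoff N z * psi z.
have gN z : `|g z| <= N.
  have /andP[t0 t1] := time_cutoff_itv N z.
  by rewrite /g normrM (ger0_norm t0) (le_trans _ (psiN z))// ler_piMl.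
have g0 z : N + 1 < `|z.1| -> g z = 0.
  by move=> /time_cutoff_out; rewrite /g => ->; rewrite mul0r.
have cg : continuous g.
  by move=> z; apply: continuous_atM; [exact: continuous_time_cutoff|exact: cpsi].
have mg : measurable_fun [set: V] g by exact: continuous_measurable_prod.
exists g; split.
- by split => //; apply/bounded_inP; exists N.
- by exists (N + 1).
- exact: (@bounded_slab_Lfun g N (N + 1)).
apply: le_trans (dist_triangle (p1 := _) mf mh mg) _ => //.
rewrite [e]splitr EFinD leeD//; apply: (le_dist_Ipow p1); first exact: ltW.
(* Neither clipping at N nor the time cut-off increases the distance to h, since h is bounded by N
   and vanishes beyond time N. *)
have hg z : `|h z - g z| <= `|h z - phi z|.
  have [zN|zN] := leP `|z.1| N.
    by rewrite /g time_cutoff_in// mul1r; exact: clip_dist.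
  rewrite h0// !sub0r !normrN /g normrM.
  have /andP[t0 t1] := time_cutoff_itv N z.
  rewrite (ger0_norm t0); apply: (@le_trans _ _ `|psi z|); first by rewrite ler_piMl.
  have := @clip_dist _ N 0 (phi z); rewrite !sub0r !normrN normr0.
  by apply; exact: ltW.
have hgD z : ~ D z -> h z - g z = 0.
  rewrite /D /slab /= => /negP; rewrite -ltNge => zD.
  by rewrite g0// h0 ?subrr// (lt_trans _ zD)// ltrDl.
have mhphi : measurable_fun [set: V] (fun z => `|h z - phi z|%:E).
  apply/measurable_EFinP; apply: measurableT_comp => //; exact: measurable_funB.
apply: (@le_trans _ _ (\int[nu]_(z in D) (c%:E * `|h z - phi z|%:E))%E).
  rewrite /Ipow [leRHS]integral_mkcond; apply: ge0_le_integral => //.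
  - by apply: measurable_Ipow_fun; exact: measurable_funB.
  - have mc : measurable_fun D (fun z => c%:E * `|h z - phi z|%:E)%E.
      by apply: measurable_funeM; exact: measurable_funTS.
    exact: (measurable_restrictT _ mD).1.
  - move=> z _; rewrite patchE; case: ifPn => [_|/negP zD]; last first.
      rewrite /= hgD ?normr0 ?powR0//; first by rewrite gt_eqF// (lt_le_trans _ p1).
      by move=> Dz; apply: zD; rewrite inE.
    rewrite /= -EFinM lee_fin.
    have [->|hg0] := eqVneq (h z - g z) 0.
      rewrite normr0 powR0 ?mulr_ge0 ?(ltW c0)//.
      by rewrite gt_eqF// (lt_le_trans _ p1).
    have -> : `|h z - g z| `^ p = `|h z - g z| `^ (p - 1) * `|h z - g z|.
      rewrite -[X in _ * X](powRr1 (normr_ge0 _)) -powRD ?subrK//.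
      by apply/implyP => _; rewrite normr_eq0.
    apply: ler_pM; [exact: powR_ge0|by []| |exact: hg].
    rewrite ge0_ler_powR ?nnegrE ?subr_ge0//; first by rewrite addr_ge0 ?(ltW N0).
    by rewrite (le_trans (ler_normB _ _))// lerD.
rewrite ge0_integralZl_EFin//; last 2 first.
- exact: measurable_funTS.
- exact: ltW.
by rewrite -lee_pdivlMl//; apply: le_trans Hphi _; rewrite -EFinM lee_fin mulrC.
Qed.

End Density.

(** * Kernels and measures tested on bounded continuous functions *)

Section KernelMeasurability.
Context {d1 d2 : measure_display} {X : measurableType d1} {Y : measurableType d2}.
Context {R : realType} (k : X -> probability Y R) (G : set (set Y)).
Hypotheses (mG : @measurable _ Y = <<s G >>) (setIG : setI_closed G).

Lemma measurable_kernel_dynkin :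
  (forall B, G B -> measurable_fun [set: X] (fun x => k x B)) ->
  forall B, measurable B -> measurable_fun [set: X] (fun x => k x B).
Proof.
move=> kG B; rewrite mG.
apply: (dynkin_induction (P := [set B | measurable_fun [set: X] (fun x => k x B)])) => //.
- rewrite /= (_ : (fun x => _) = cst 1%E)//.
  by apply/funext => x; exact: probability_setT.
- move=> S mS HS /=; rewrite (_ : (fun x => _) = (fun x => 1 - k x S)%E).
    exact: emeasurable_funB.
  by apply/funext => x; rewrite probability_setC.
- move=> F mF tF HF /=.
  rewrite (_ : (fun x => _) = (fun x => \sum_(0 <= n <oo) k x (F n))%E).
    apply: ge0_emeasurable_sum => [n x _ _|n _]; [exact: measure_ge0|exact: HF].
  by apply/funext => x; rewrite measure_semi_bigcup//; exact: bigcup_measurable.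
Qed.

End KernelMeasurability.

Section CbProbability.
Context {R : realType} {d : nat}.
Local Notation E := 'rV[R]_d.

Lemma cvg_integral_open_approx (P : {measure set E -> \bar R}) (U : set E) :
  (P setT < +oo)%E -> open U ->
  (\int[P]_y (open_approx U n y)%:E)%E @[n --> \oo] --> P U.
Proof.
move=> PT oU; have mU : measurable U by exact: measurable_openE.
have m1 : measurable_fun [set: E] (\1_U : E -> R) by exact: measurable_indic.
have b1 n (x : E) : [set: E] x -> `|open_approx U n x| <= 1.
  by rewrite ger0_norm ?open_approx_ge0 ?open_approx_le1.
have [_ _] := bounded_convergence measurableT PT
  (fun n => continuous_measurable_rV (@continuous_open_approx _ _ U n)) m1 b1
  (fun x _ => cvg_open_approx oU).
by rewrite integral_indic// setIT.
Qed.

Lemma measure_eq_Cb (P Q : {measure set E -> \bar R}) :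
  (P setT < +oo)%E -> (Q setT < +oo)%E ->
  (forall f, Cb f -> (forall y, 0 <= f y) ->
    (\int[P]_y (f y)%:E = \int[Q]_y (f y)%:E)%E) ->
  forall B, measurable B -> P B = Q B.
Proof.
move=> PT QT PQ; apply: (measure_unique [set U : set E | open U] (fun=> setT)).
- exact: measurable_borel_rV.
- by move=> A B; exact: openI.
- by move=> _; exact: openT.
- by rewrite bigcup_const.
- move=> U oU; have H := cvg_integral_open_approx PT oU.
  apply/esym; apply: (cvg_unique _ _ H) => //.
  have := cvg_integral_open_approx QT oU.
  rewrite (_ : (fun n => _) = (fun n => \int[P]_y (open_approx U n y)%:E)%E)//.
  by apply/funext => n; rewrite PQ//; [exact: Cb_open_approx|exact: open_approx_ge0].
- by [].
Qed.

Lemma measurable_kernel_Cb (disp : measure_display) (X : measurableType disp)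
    (k : X -> probability E R) :
  (forall f, Cb f -> measurable_fun [set: X] (fun x => \int[k x]_y (f y)%:E)%E) ->
  forall B, measurable B -> measurable_fun [set: X] (fun x => k x B).
Proof.
move=> kf; apply: (measurable_kernel_dynkin measurable_borel_rV).
  by move=> A B; exact: openI.
move=> U oU.
apply: (emeasurable_fun_cvg (fun n x => (\int[k x]_y (open_approx U n y)%:E)%E)).
  by move=> n; apply: kf; exact: Cb_open_approx.
move=> x _; apply: cvg_integral_open_approx => //.
by rewrite [X in (X < _)%E](_ : _ = 1%E) ?ltry//; exact: probability_setT.
Qed.

End CbProbability.

(** * The evolution operator *)

Section EvolutionFacts.
Context {R : realType} {d : nat}.
Local Notation E := 'rV[R]_d.
Variables (q : R -> E -> 'M[R]_d) (b : R -> E -> E).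
Hypotheses (holder_qb : coefficients_holder q b) (elliptic_q : elliptic q)
  (lyapunov_loc : local_lyapunov q b).
Variables (G : R -> R -> (E -> R) -> E -> R) (pts : R -> R -> E -> probability E R).
Hypothesis evol_G : evolution_operator q b G pts.

Lemma evol_solution_exists s f : Cb f ->
  exists2 u, bounded_classical_solution q b s f u &
    forall t x, s <= t -> G t s f x = u (t, x).
Proof.
move=> Cf; have [u us _] := evol_wellposed evol_G s Cf; exists u => // t x.
rewrite le_eqVlt => /predU1P[<-|st]; last exact: (evol_solution evol_G Cf us).
by rewrite (evol_id evol_G s (Cb_Bb Cf)); have [_ _ _ _ ->] := us.
Qed.

Lemma evol_solutionE s t f u x : Cb f -> bounded_classical_solution q b s f u ->
  s <= t -> G t s f x = u (t, x).
Proof.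
move=> Cf us; rewrite le_eqVlt => /predU1P[<-|st]; last exact: (evol_solution evol_G Cf us).
by rewrite (evol_id evol_G s (Cb_Bb Cf)); have [_ _ _ _ ->] := us.
Qed.

Lemma Cb_evol s t f : s <= t -> Cb f -> Cb (G t s f).
Proof.
rewrite le_eqVlt => /predU1P[<-|st] Cf; first by rewrite (evol_id evol_G)//; exact: Cb_Bb.
have [u us uG] := evol_solution_exists s Cf.
have := solution_Cb st us; congr Cb; apply/funext => x.
by rewrite uG// ltW.
Qed.

(** The solution started at r solves, after s, the problem with datum G(s,r)f. Uniqueness identifies
    it with the solution defining G(t,s). *)
Lemma evol_comp r s t f x : r <= s -> s < t -> Cb f ->
  G t s (G s r f) x = G t r f x.
Proof.
rewrite le_eqVlt => /predU1P[<-|rs] st Cf.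
  by rewrite (evol_id evol_G r)//; exact: Cb_Bb.
have [u us uG] := evol_solution_exists r Cf.
have us' := solution_restrict (ltW rs) us.
rewrite [RHS]uG ?(ltW (lt_trans rs st))//.
have -> : G s r f = fun y => u (s, y) by apply/funext => y; rewrite uG// ltW.
by apply: evol_solutionE (ltW st) => //; exact: solution_Cb us.
Qed.

Lemma probability_ltoo (P : probability E R) : (P setT < +oo)%E.
Proof.
by rewrite [X in (X < _)%E](_ : _ = 1%E) ?ltry//; exact: probability_setT.
Qed.

Lemma Bb_integrable (P : probability E R) f : Bb f -> P.-integrable setT (EFin \o f).
Proof.
move=> [mf /bounded_inP[M fM]].
have := @bounded_convergence _ _ _ P _ measurableT (probability_ltoo P) (fun=> f) f M.
move=> /(_ (fun=> mf) mf (fun=> fM))[x _|]; [exact: cvg_cst|by []].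
Qed.

Lemma evol_bounded s t f x M : s <= t -> Bb f -> (forall y, `|f y| <= M) ->
  `|G t s f x| <= M.
Proof.
rewrite le_eqVlt => /predU1P[<-|st] Bf fM; first by rewrite (evol_id evol_G).
rewrite -lee_fin -abse_EFin (evol_int evol_G)//.
have mf : measurable_fun [set: E] (EFin \o f) by apply/measurable_EFinP; case: Bf.
apply: (le_trans (le_abse_integral _ measurableT mf)).
have -> : M%:E = (\int[pts t s x]_y (cst M%:E y))%E.
  rewrite integral_cst// [X in (_ * X)%E](_ : _ = 1%E) ?mule1//.
  exact: probability_setT.
apply: ge0_le_integral => //.
- exact: measurableT_comp.
- by move=> y _; rewrite lee_fin.
Qed.

(** Pointwise |g - g x0| <= e + 2 M (1 - eta), eta being the cut-off at x0; integration against
    p_{t,s}(x0,.) leaves 1 - G(t,s) eta. The constant C depends on the ball and the time window but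
    not on g, which later varies with the time step. *)
Lemma evol_concentration (x0 : E) (r a c : R) : 0 < r ->
  exists2 C : R, 0 <= C & forall (s t : R) (g : E -> R) (M e : R), a <= s -> s < t -> t <= c -> Bb g ->
    (forall y, `|g y| <= M) -> (forall y, `|y - x0| < r -> `|g y - g x0| <= e) ->
    `|G t s g x0 - g x0| <= e + (M + M) * (C * (t - s)).
Proof.
move=> r0; have [C C0 HC] := cutoff_solution_lower holder_qb elliptic_q lyapunov_loc x0 a c r0.
exists C => // s t g M e as_ st tc Bg gM ge.
pose k := r ^- 2.
have k0 : 0 <= k by rewrite invr_ge0 exprn_ge0// ltW.
have Ceta : Cb (cutoff x0 k) by exact: Cb_cutoff.
have [u us uG] := evol_solution_exists s Ceta.
have := HC _ _ _ as_ (ltW st) tc us; rewrite -uG ?(ltW st)// => HG.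
have e0 : 0 <= e by apply: le_trans (ge x0 _); rewrite ?subrr ?normr0.
have M0 : 0 <= M by exact: le_trans (gM x0).
apply: (@le_trans _ _ (e + (M + M) * (1 - G t s (cutoff x0 k) x0))); last first.
  by rewrite lerD2l ler_wpM2l// addr_ge0.
rewrite -lee_fin.
pose P := pts t s x0.
have mg : measurable_fun [set: E] g by case: Bg.
have meta : measurable_fun [set: E] (cutoff x0 k) by case: (Cb_Bb Ceta).
have fin1 : (\int[P]_y (cst (g x0)%:E y) = (g x0)%:E)%E.
  rewrite integral_cst// [X in (_ * X)%E](_ : _ = 1%E) ?mule1//.
  exact: probability_setT.
have fin2 : (\int[P]_y (cst (e + (M + M))%:E y) = (e + (M + M))%:E)%E.
  rewrite integral_cst// [X in (_ * X)%E](_ : _ = 1%E) ?mule1//.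
  exact: probability_setT.
have ig : P.-integrable setT (EFin \o g) by exact: Bb_integrable.
have ieta : P.-integrable setT (EFin \o cutoff x0 k) by apply: Bb_integrable; exact: Cb_Bb.
have ic z : P.-integrable setT (cst z%:E).
  exact: integrable_cst_in (probability_ltoo P) z.
have -> : `|G t s g x0 - g x0|%:E = `|\int[P]_y ((g y)%:E - (g x0)%:E)|%E.
  rewrite (integralB measurableT ig (ic (g x0))).
  by rewrite -(evol_int evol_G)// fin1.
have mB : measurable_fun [set: E] (fun y => (g y)%:E - (g x0)%:E)%E.
  by apply/measurable_EFinP; exact: measurable_funB.
apply: (le_trans (le_abse_integral _ measurableT mB)).
have -> : ((e + (M + M) * (1 - G t s (cutoff x0 k) x0))%:E =
  \int[P]_y ((e + (M + M))%:E - (M + M)%:E * (cutoff x0 k y)%:E))%E.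
  rewrite (integralB measurableT (ic (e + (M + M))) (integrableZl measurableT (M + M) ieta)).
  rewrite (integralZl measurableT ieta) fin2 -(evol_int evol_G _ st (Cb_Bb Ceta)).
  by rewrite -EFinM -EFinB; congr EFin; ring.
apply: ge0_le_integral => //.
- exact: measurableT_comp.
- apply/measurable_EFinP; apply: measurable_funB => //; exact: measurable_funM.
- move=> y _; rewrite -EFinB abse_EFin -EFinM -EFinB lee_fin.
  have h1 := cutoff_ge0 x0 k y; have h2 := cutoff_le1 x0 y k0.
  have [yr|ry] := ltP `|y - x0| r.
    apply: le_trans (ge y yr) _; rewrite -addrA lerDl -{1}[M + M]mulr1 -mulrBr.
    by apply: mulr_ge0; [rewrite addr_ge0|rewrite subr_ge0].
  rewrite (cutoff_out r0 (erefl : k = r ^- 2) ry) mulr0 subr0.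
  by rewrite (le_trans (ler_normB _ _))// ler_wpDl// lerD.
Qed.

Lemma Cb_slice (f : R * E -> R) s : Cb f -> Cb (fun x => f (s, x)).
Proof.
move=> [cf /bounded_inP[M fM]]; split.
  move=> x; apply: (@continuous_comp _ _ _ (fun y : E => (s, y)) f); last exact: cf.
  exact: continuous_pair_right.
by apply/bounded_inP; exists M => x _; exact: fM.
Qed.

Lemma evolution_semigroup0 (f : R * E -> R) z : Cb f -> evolution_semigroup G 0 f z = f z.
Proof.
move=> Cf; rewrite /evolution_semigroup subr0.
by rewrite (evol_id evol_G _ (Cb_Bb (Cb_slice _ Cf))); case: z.
Qed.

Lemma evolution_semigroup_small_time (f : R * E -> R) z (e : R) : Cb f -> 0 < e ->
  exists2 h0, 0 < h0 & forall h, 0 <= h < h0 -> `|evolution_semigroup G h f z - f z| <= e.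
Proof.
move=> Cf e0; have [cf /bounded_inP[M fM]] := Cf.
have e40 : 0 < e / 4 by rewrite divr_gt0.
have /cvgrPdist_le/(_ _ e40)/nbhs_ballP[r /= r0 zr] := cf z.
have [C C0 HC] := evol_concentration z.2 (z.1 - 1) z.1 r0.
have M0 : 0 <= M by exact: le_trans (fM z I).
pose D := (M + M) * C + 1.
have D0 : 0 < D by rewrite ltr_wpDl// mulr_ge0// addr_ge0.
(* The bounds on h keep z.1 - h in the time window and in the ball of radius r, and make the mass
   term at most e / 4. The other three quarters come from the oscillation of f on that ball: two in
   [gg], one in [zz]. *)
exists (Num.min (Num.min 1 r) (e / 4 / D)).
  by rewrite !lt_min ltr01 r0 divr_gt0.
move=> h /andP[h0]; rewrite !lt_min => /andP[/andP[h1 hr] hD].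
move: h0; rewrite le_eqVlt => /predU1P[<-|h0].
  by rewrite evolution_semigroup0// subrr normr0 ltW.
pose g x := f (z.1 - h, x).
have Bg : Bb g by apply: Cb_Bb; exact: Cb_slice.
have gz y : `|y - z.2| < r -> `|f z - g y| <= e / 4.
  move=> yr; apply: zr; split; rewrite -ball_normE/=; last by rewrite distrC.
  by rewrite opprB addrC subrK gtr0_norm.
have zz : `|f z - g z.2| <= e / 4 by apply: gz; rewrite subrr normr0.
have hd : z.1 - h < z.1 by rewrite ltrBlDr ltrDl.
have h1' : z.1 - 1 <= z.1 - h by rewrite lerD2l lerN2 ltW.
have gg y : `|y - z.2| < r -> `|g y - g z.2| <= e / 4 + e / 4.
  move=> yr; have -> : g y - g z.2 = (f z - g z.2) - (f z - g y) by ring.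
  by rewrite (le_trans (ler_normB _ _))// lerD// gz.
have := HC _ _ _ _ _ h1' hd (lexx _) Bg (fun y => fM (z.1 - h, y) I) gg.
have -> : z.1 - (z.1 - h) = h by ring.
have MC : (M + M) * (C * h) <= e / 4.
  rewrite mulrA; apply: (@le_trans _ _ (D * h)).
    by rewrite ler_wpM2r ?(ltW h0)// /D lerDl.
  by rewrite mulrC -ler_pdivlMr// ltW.
rewrite /evolution_semigroup -/g => H.
have -> : G z.1 (z.1 - h) g z.2 - f z =
  (G z.1 (z.1 - h) g z.2 - g z.2) - (f z - g z.2) by ring.
apply: le_trans (ler_normB _ _) _.
by move: H zz MC; lra.
Qed.

Lemma measurable_evol_from r (f : E -> R) (U : set R) : Cb f -> open U ->
  measurable ([set z : R * E | r < z.1] `&` [set z | U (G z.1 r f z.2)]).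
Proof.
move=> Cf oU; apply: measurable_open_prod; have [u us uG] := evol_solution_exists r Cf.
have [_ _ u12 _ _] := us; rewrite openE => z [/= rz Uz].
have [_ [cu _ _ _]] := u12 z rz.
rewrite uG ?(ltW rz)// in Uz.
have H1 : \forall w \near z, r < w.1.
  have c1 : fst w @[w --> z] --> z.1 by exact: cvg_fst.
  exact: (c1 _ (lt_nbhsr rz)).
have H2 : \forall w \near z, U (u w).
  by apply: cu; rewrite (surjective_pairing z); exact: open_nbhs_nbhs.
apply: filterS2 H1 H2 => w rw Uw; split => //=.
by rewrite uG ?(ltW rw)//; case: w rw Uw.
Qed.

Definition floor_grid (n : nat) (r : R) : R := (Num.floor (n.+1%:R * r))%:~R / n.+1%:R.

Lemma floor_grid_le n r : floor_grid n r <= r.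
Proof. by rewrite /floor_grid ler_pdivrMr// mulrC floor_le. Qed.

Lemma floor_grid_gt n r : r - n.+1%:R^-1 < floor_grid n r.
Proof.
rewrite /floor_grid ltr_pdivlMr// mulrBl mulVf ?pnatr_eq0//.
by rewrite ltrBlDr mulrC -[1]/(1%:~R) -intrD; exact: floorD1_gt.
Qed.

(* With the initial time rounded down to a grid, [G] is piecewise given by a
   single solution, which is continuous; the rounding error vanishes in the limit
   because [p_{r,r'}(y,.)] concentrates at [y] as [r' -> r]. *)
Lemma measurable_evol_grid n (f : E -> R) t : 0 < t -> Cb f ->
  measurable_fun [set: R * E] (fun z => G z.1 (floor_grid n (z.1 - t)) f z.2).
Proof.
move=> t0 Cf; apply: open_measurable_fun => U oU.
pose a (k : int) : R := k%:~R / n.+1%:R.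
pose A (k : int) := (fun z : R * E => n.+1%:R * (z.1 - t)) @^-1` `[k%:~R, (k + 1)%:~R[.
pose B (k : int) := [set z : R * E | a k < z.1] `&` [set z | U (G z.1 (a k) f z.2)].
have -> : (fun z => G z.1 (floor_grid n (z.1 - t)) f z.2) @^-1` U = \bigcup_k (A k `&` B k).
  apply/seteqP; split => [z /= Uz|z [k _ [Ak [_ Bk]]]]; last first.
    rewrite /= /floor_grid (_ : Num.floor _ = k)//.
    by apply: floor_def; move: Ak; rewrite /A /= in_itv.
  exists (Num.floor (n.+1%:R * (z.1 - t))) => //; split.
    by rewrite /A /= in_itv /= floor_le floorD1_gt.
  split => //=; apply: le_lt_trans (floor_grid_le n (z.1 - t)) _.
  by rewrite ltrBlDr ltrDl.
apply: countable_bigcupT_measurable => // k; apply: measurableI.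
  rewrite -[X in measurable X]setTI; apply: continuous_measurable_prod => //.
  move=> z; apply: continuous_atM; first exact: continuous_at_cst.
  by apply: continuous_atB; [exact: cvg_fst|exact: continuous_at_cst].
exact: measurable_evol_from.
Qed.

(** With r_n the rounded time, G(s,r_n) f = G(s,r) G(r,r_n) f. The inner functions are bounded by
    sup |f| and tend to f pointwise, so bounded convergence under p_{s,r}(x,.) applies. *)
Lemma cvg_evol_grid (f : E -> R) r s x : Cb f -> r < s ->
  G s (floor_grid n r) f x @[n --> \oo] --> G s r f x.
Proof.
move=> Cf rs; have [cf /bounded_inP[M fM]] := Cf.
pose g n := G r (floor_grid n r) f.
have Cg n : Cb (g n) by apply: Cb_evol => //; exact: floor_grid_le.
have gM n y : `|g n y| <= M.
  by apply: evol_bounded; [exact: floor_grid_le|exact: Cb_Bb|move=> z; exact: fM].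
have gf y : g n y @[n --> \oo] --> f y.
  pose F (z : R * E) := f z.2.
  have CF : Cb F.
    split; last by apply/bounded_inP; exists M => w _; exact: fM.
    move=> w; apply: (@continuous_comp _ _ _ snd f); first exact: cvg_snd.
    exact: cf.
  apply/cvgrPdist_le => e e0.
  have [h0 h00 H] := evolution_semigroup_small_time (r, y) CF e0.
  near=> n; have := H (r - floor_grid n r).
  rewrite /evolution_semigroup /= subKr distrC; apply.
  rewrite subr_ge0 floor_grid_le/= ltrBlDr addrC -ltrBlDr.
  apply: lt_trans (floor_grid_gt n r); rewrite ltrD2l ltrN2.
  by near: n; exact: (near_infty_natSinv_lt (PosNum h00)).
have mg n : measurable_fun [set: E] (g n) by case: (Cb_Bb (Cg n)).
have mf : measurable_fun [set: E] f by case: (Cb_Bb Cf).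
have [_ _] := bounded_convergence measurableT (probability_ltoo (pts s r x)) mg mf
  (fun n y _ => gM n y) (fun y _ => gf y).
rewrite -(evol_int evol_G _ rs (Cb_Bb Cf)).
rewrite (_ : (fun n => _) = (fun n => (G s (floor_grid n r) f x)%:E)).
  exact: fine_cvg.
apply/funext => n; rewrite -(evol_int evol_G _ rs (Cb_Bb (Cg n))) /g.
by rewrite evol_comp// floor_grid_le.
Unshelve. all: by end_near. Qed.

Lemma measurable_evol (f : E -> R) t : 0 < t -> Cb f ->
  measurable_fun [set: R * E] (fun z => G z.1 (z.1 - t) f z.2).
Proof.
move=> t0 Cf; apply: (measurable_fun_cvg (fun n => measurable_evol_grid n t0 Cf)) => z _.
by apply: cvg_evol_grid => //; rewrite ltrBlDr ltrDl.
Qed.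

Lemma measurable_pts t B : 0 < t -> measurable B ->
  measurable_fun [set: R * E] (fun z => pts z.1 (z.1 - t) z.2 B).
Proof.
move=> t0; apply: (measurable_kernel_Cb (k := fun z : R * E => pts z.1 (z.1 - t) z.2)) => f Cf.
rewrite (_ : (fun z => _) = (fun z => (G z.1 (z.1 - t) f z.2)%:E)).
  by apply/measurable_EFinP; exact: measurable_evol.
apply/funext => z; rewrite -(evol_int evol_G)//; last exact: Cb_Bb.
by rewrite ltrBlDr ltrDl.
Qed.

End EvolutionFacts.

(** * The measure nu *)

Section LebesgueTranslation.
Context {R : realType}.
Local Notation lambda := (@lebesgue_measure R).

Let shift (t r : R) : measurableTypeR R := r - t.

Let measurable_shift t : measurable_fun [set: measurableTypeR R] (shift t).
Proof. by apply: measurable_funB. Qed.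

HB.instance Definition _ t :=
  isMeasurableFun.Build _ _ (measurableTypeR R) (measurableTypeR R) (shift t) (measurable_shift t).

Lemma lebesgue_measure_shift (t : R) (A : set R) : measurable A ->
  pushforward lambda (shift t : measurableTypeR R -> measurableTypeR R) A = lambda A.
Proof.
move=> mA; apply/esym/lebesgue_measure_unique => //= _ [[a c]] _ <-.
rewrite /pushforward (_ : _ @^-1` _ = `]a + t, c + t]%classic); last first.
  by apply/seteqP; split => r /=; rewrite !in_itv/= /shift ltrBrDr lerBlDr.
rewrite !lebesgue_measure_itv/= !lte_fin ltrD2r.
by case: ifP => // _; rewrite -!EFinB; congr EFin; ring.
Qed.

Lemma ge0_integral_shift (t : R) (f : R -> \bar R) : (forall r, 0 <= f r)%E ->
  measurable_fun [set: R] f ->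
  (\int[lambda]_r f (r - t)%R = \int[lambda]_r f r)%E.
Proof.
move=> f0 mf.
transitivity (\int[pushforward lambda (shift t)]_r f r)%E.
  by rewrite (ge0_integral_pushforward (measurable_shift t) lambda measurableT mf).
by apply: eq_measure_integral => A mA _; exact: lebesgue_measure_shift.
Qed.

End LebesgueTranslation.

Section TimeSlice.
Context {R : realType} {d : nat}.
Local Notation E := 'rV[R]_d.

Definition time_slice (s : R) (y : E) : R * E := (s, y).

Let measurable_time_slice s : measurable_fun [set: E] (time_slice s).
Proof. exact: pair1_measurable. Qed.

HB.instance Definition _ s :=
  isMeasurableFun.Build _ _ E (R * E)%type (time_slice s) (measurable_time_slice s).

(** The product of the Dirac mass at s with P. The kernels K_t and the disintegration of nu are both
    families of such measures. *)
Definition on_slice (P : probability E R) (s : R) : probability (R * E)%type R :=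
  distribution P (time_slice s).

Lemma on_sliceE P s B : on_slice P s B = P [set y | B (s, y)].
Proof. by []. Qed.

Lemma integral_on_slice P s (f : R * E -> \bar R) : measurable_fun [set: R * E] f ->
  (forall z, 0 <= f z)%E -> (\int[on_slice P s]_z f z = \int[P]_y f (s, y))%E.
Proof. by move=> mf f0; rewrite ge0_integral_distribution. Qed.

Lemma measurable_slice s (B : set (R * E)) : measurable B -> measurable [set y | B (s, y)].
Proof. by move=> mB; rewrite -[X in measurable X]setTI; exact: measurable_time_slice. Qed.

Lemma measurable_on_slice (disp : measure_display) (X : measurableType disp)
    (P : X -> probability E R) (s : X -> R) :
  measurable_fun [set: X] s ->
  (forall B, measurable B -> measurable_fun [set: X] (fun x => P x B)) ->
  forall B, measurable B -> measurable_fun [set: X] (fun x => on_slice (P x) (s x) B).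
Proof.
move=> ms mP; apply: (measurable_kernel_dynkin (measurable_prod_measurableType _ _)).
  move=> _ _ [A1 mA1 [A2 mA2 <-]] [B1 mB1 [B2 mB2 <-]].
  exists (A1 `&` B1); first exact: measurableI.
  by exists (A2 `&` B2); [exact: measurableI|rewrite setXI].
move=> _ [J mJ [A mA <-]].
rewrite (_ : (fun x => _) = (fun x => (\1_J (s x))%:E * P x A)%E).
  apply: emeasurable_funM; last exact: mP.
  by apply/measurable_EFinP; apply: measurableT_comp.
apply/funext => x; rewrite on_sliceE indicE; have [sJ|sJ] := boolP (s x \in J).
  rewrite mul1e; congr (P x _); apply/seteqP; split => [y []//|y Ay]; split => //=.
  exact: set_mem.
rewrite mul0e (_ : [set y | _] = set0) ?measure0//.
by apply/seteqP; split => // y [/= Js _]; move/negP : sJ; apply; rewrite inE.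
Qed.

End TimeSlice.

Section Disintegration.
Context {R : realType} {d : nat}.
Local Notation E := 'rV[R]_d.
Variable mu : R -> probability E R.
Hypothesis mu_measurable : forall A : set E, measurable A ->
  measurable_fun [set: R] (fun s => mu s A).
Variable nu : {measure set (R * E) -> \bar R}.
Hypothesis nuE : forall (J : set R) (K : set E), measurable J -> measurable K ->
  nu (J `*` K) = (\int[lebesgue_measure]_(t in J) mu t K)%E.

Lemma nu_strip J : measurable J -> nu (J `*` setT) = lebesgue_measure J.
Proof.
move=> mJ; rewrite nuE//.
rewrite (eq_integral (cst 1%E)).
  by rewrite integral_cst// mul1e.
by move=> t _; exact: probability_setT.
Qed.

Lemma nu_slab r : (nu (slab r : set (R * E)) < +oo)%E.
Proof.
rewrite (_ : slab r = `[- r, r] `*` setT).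
  rewrite nu_strip// lebesgue_measure_itv/=; case: ifP => // _.
  by rewrite -EFinB ltry.
by apply/seteqP; split => [z|z []]; rewrite /slab /= in_itv/= ler_norml.
Qed.

Let measurable_mu_slice B : measurable B ->
  measurable_fun [set: R] (fun s => on_slice (mu s) s B).
Proof. by apply: measurable_on_slice. Qed.

(** The hypothesis on nu gives the identity on rectangles, a generating pi-system. It extends to all
    B because the strips [-n, n] x R^d have finite measure and exhaust the space. *)
Lemma nu_disintegration (B : set (R * E)) : measurable B ->
  nu B = (\int[lebesgue_measure]_s on_slice (mu s) s B)%E.
Proof.
pose nu' := mbind_measure lebesgue_measure measurable_mu_slice.
move=> mB; suff : nu B = nu' B by [].
move: B mB; apply: (@measure_unique _ R (R * E)%type
  [set A `*` B | A in @measurable _ R & B in @measurable _ E]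
  (fun n => [set` `[- n%:R, n%:R]] `*` setT)) => //.
- exact: measurable_prod_measurableType.
- move=> _ _ [A1 mA1 [A2 mA2 <-]] [B1 mB1 [B2 mB2 <-]].
  exists (A1 `&` B1); first exact: measurableI.
  by exists (A2 `&` B2); [exact: measurableI|rewrite setXI].
- by move=> n; exists [set` `[- n%:R, n%:R]] => //; exists setT.
- apply/seteqP; split => // z _.
  have [n _ /(_ n (leqnn n)) zn] := nbhs_infty_ger `|z.1|.
  by exists n => //; split => //=; rewrite in_itv/= -ler_norml.
- move=> _ [J mJ [A mA <-]]; rewrite nuE// integral_mkcond.
  rewrite [RHS](_ : _ = \int[lebesgue_measure]_s on_slice (mu s) s (J `*` A))%E//.
  apply: eq_integral => s _; rewrite patchE on_sliceE.
  case: ifPn => [/set_mem sJ|sJ].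
    by congr (mu s _); apply/seteqP; split => [y|y []].
  rewrite (_ : [set y | _] = set0) ?measure0//.
  by apply/seteqP; split => // y [/= Js _]; move/negP : sJ; apply; rewrite inE.
- move=> n; rewrite (_ : _ `*` _ = slab n%:R) ?nu_slab//.
  by apply/seteqP; split => [z []|z]; rewrite /slab /= in_itv/= ler_norml.
Qed.

Lemma integral_nu (f : R * E -> \bar R) : measurable_fun [set: R * E] f ->
  (forall z, 0 <= f z)%E ->
  (\int[nu]_z f z = \int[lebesgue_measure]_s \int[mu s]_y f (s, y))%E.
Proof.
move=> mf f0.
transitivity (\int[mbind_measure lebesgue_measure measurable_mu_slice]_z f z)%E.
  by apply: eq_measure_integral => A mA _; exact: nu_disintegration.
rewrite integral_mbind//; apply: eq_integral => s _; exact: integral_on_slice.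
Qed.

End Disintegration.

(** * The kernel of the evolution semigroup *)

Section TransitionKernel.
Context {R : realType} {d : nat}.
Local Notation E := 'rV[R]_d.
Variable pts : R -> R -> E -> probability E R.

(** [evol_int] ties [pts t s] to G only for s < t, so the Dirac mass that corresponds to G(t,t) = id
    is put in by hand. *)
Definition transition (t : R) (z : R * E) : probability E R :=
  if 0 < t then pts z.1 (z.1 - t) z.2 else \d_(z.2).

(* The kernel of the evolution semigroup: the image of [p_{s,s-t}(x,.)] under
   [y |-> (s - t, y)], where [z = (s, x)]. *)
Definition evol_kernel (t : R) (z : R * E) : probability (R * E)%type R :=
  on_slice (transition t z) (z.1 - t).

Lemma evol_kernelE t z B :
  evol_kernel t z B = transition t z [set y | B (z.1 - t, y)].
Proof. by []. Qed.

Lemma evol_kernel0 z B : evol_kernel 0 z B = \d_z B.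
Proof.
rewrite evol_kernelE /transition ltxx subr0 !diracE.
congr (_ %:R%:E); apply/asboolP/asboolP => /=; by case: z.
Qed.

Lemma ge0_integral_kernel t z (f : R * E -> \bar R) : 0 < t ->
  measurable_fun [set: R * E] f -> (forall z, 0 <= f z)%E ->
  (\int[evol_kernel t z]_w f w = \int[pts z.1 (z.1 - t) z.2]_y f ((z.1 - t)%R, y))%E.
Proof. by move=> t0 mf f0; rewrite integral_on_slice// /transition t0. Qed.

Lemma ge0_integral_kernel0 z (f : R * E -> \bar R) :
  measurable_fun [set: R * E] f -> (forall z, 0 <= f z)%E ->
  (\int[evol_kernel 0 z]_w f w = f z)%E.
Proof.
move=> mf f0; rewrite integral_on_slice// /transition ltxx subr0.
rewrite integral_dirac//; last exact: measurable_fun_pair2.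
by rewrite diracT mul1e; case: z.
Qed.

End TransitionKernel.

Section EvolutionKernel.
Context {R : realType} {d : nat}.
Local Notation E := 'rV[R]_d.
Variables (q : R -> E -> 'M[R]_d) (b : R -> E -> E).
Hypotheses (holder_qb : coefficients_holder q b) (elliptic_q : elliptic q)
  (lyapunov_loc : local_lyapunov q b).
Variables (G : R -> R -> (E -> R) -> E -> R) (pts : R -> R -> E -> probability E R).
Hypothesis evol_G : evolution_operator q b G pts.

Lemma integral_pts_Cb s t x (f : E -> R) : s < t -> Cb f ->
  (\int[pts t s x]_y (f y)%:E = (G t s f x)%:E)%E.
Proof. by move=> st Cf; rewrite -(evol_int evol_G _ st (Cb_Bb Cf)). Qed.

(** The Chapman-Kolmogorov equation. Both sides are finite measures in B, hence determined by C_b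
    functions, for which it is the evolution law. Measurability of the inner kernel in y is a slice
    of the joint measurability, at time s with step s - r. *)
Lemma pts_comp r s t x B : r < s -> s < t -> measurable B ->
  pts t r x B = (\int[pts t s x]_y pts s r y B)%E.
Proof.
move=> rs st; have mk B' : measurable B' -> measurable_fun [set: E] (fun y => pts s r y B').
  move=> mB'; have sr0 : 0 < s - r by rewrite subr_gt0.
  have := measurable_fun_pair2 s (measurable_pts holder_qb elliptic_q lyapunov_loc evol_G sr0 mB').
  by rewrite /= subKr.
apply: (measure_eq_Cb (Q := mbind_measure (pts t s x) mk)).
- exact: probability_ltoo.
- rewrite [X in (X < _)%E](_ : _ = 1%E) ?ltry//.
  transitivity (\int[pts t s x]_y cst 1%E y)%E.
    by apply: eq_integral => y _; exact: probability_setT.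
  by rewrite integral_cst// mul1e; exact: probability_setT.
- move=> f Cf f0; rewrite integral_mbind//; last first.
    by apply/measurable_EFinP; case: (Cb_Bb Cf).
  rewrite integral_pts_Cb//; last exact: lt_trans st.
  under eq_integral do rewrite integral_pts_Cb//.
  rewrite (integral_pts_Cb _ st (Cb_evol evol_G (ltW rs) Cf)).
  by rewrite (evol_comp evol_G _ (ltW rs) st Cf).
Qed.

Local Notation K := (evol_kernel pts).

Lemma measurable_evol_kernel t : 0 <= t -> forall B, measurable B ->
  measurable_fun [set: R * E] (fun z => K t z B).
Proof.
move=> t0; apply: measurable_on_slice; first exact: measurable_funB.
move=> B mB; rewrite /transition; case: ltP => [t0'|_].
  exact: (measurable_pts holder_qb elliptic_q lyapunov_loc evol_G).
rewrite (_ : (fun z => _) = (fun z : R * E => (\1_B z.2)%:E)).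
  have m1 : measurable_fun [set: E] (\1_B : E -> R) by exact: measurable_indic.
  by apply/measurable_EFinP; exact: (measurableT_comp m1 measurable_snd).
by apply/funext => z; rewrite /= diracE indicE.
Qed.

Lemma evol_kernelD s t z B : 0 <= s -> 0 <= t -> measurable B ->
  K (s + t) z B = (\int[K s z]_w K t w B)%E.
Proof.
move=> s0 t0 mB; have mK := measurable_evol_kernel t0 mB.
move: s0; rewrite le_eqVlt => /predU1P[<-|s0].
  by rewrite add0r ge0_integral_kernel0.
move: (t0) mK; rewrite le_eqVlt => /predU1P[<- _|{}t0 mK].
  rewrite addr0 (eq_integral (fun w => (\1_B w)%:E)).
    by rewrite integral_indic// setIT.
  by move=> w _; rewrite evol_kernel0 diracE indicE.
rewrite ge0_integral_kernel// evol_kernelE /transition addr_gt0//.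
rewrite (@pts_comp _ (z.1 - s)).
- apply: eq_integral => y _; rewrite evol_kernelE /transition t0 /=.
  by rewrite opprD addrA.
- by rewrite opprD addrA ltrBlDr ltrDl.
- by rewrite ltrBlDr ltrDl.
- exact: measurable_slice.
Qed.

(** No exceptional set appears, because a bounded f is integrable for every [K t z]. *)
Lemma Kint_evol_kernel t f z : 0 <= t -> Cb f -> Kint (K t) f z = evolution_semigroup G t f z.
Proof.
move=> t0 Cf; have mf : measurable_fun [set: R * E] f.
  by apply: continuous_measurable_prod; case: Cf.
have Cs := Cb_slice (z.1 - t) Cf; have Bs := Cb_Bb Cs.
rewrite /Kint /evol_kernel integral_distribution//; last 2 first.
- exact/measurable_EFinP.
- exact: Bb_integrable.
rewrite /transition; case: ltP => [t0'|t0'].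
  by rewrite -(evol_int evol_G _ _ Bs)// ltrBlDr ltrDl.
have /eqP -> : t == 0 by rewrite eq_le t0 t0'.
rewrite (evolution_semigroup0 evol_G)// integral_dirac//.
  by rewrite diracT mul1e /= subr0; case: z {Cs Bs}.
apply/measurable_EFinP; exact: (Cb_Bb (Cb_slice (z.1 - 0) Cf)).1.
Qed.

Variable mu : R -> probability E R.
Hypothesis evol_mu : evolution_system G mu.
Hypothesis mu_measurable : forall A : set E, measurable A ->
  measurable_fun [set: R] (fun s => mu s A).
Variable nu : {measure set (R * E) -> \bar R}.
Hypothesis nuE : forall (J : set R) (A : set E), measurable J -> measurable A ->
  nu (J `*` A) = (\int[lebesgue_measure]_(t in J) mu t A)%E.

Lemma mu_pts s t A : s < t -> measurable A -> (\int[mu t]_x pts t s x A = mu s A)%E.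
Proof.
move=> st mA; have BA : Bb (\1_A : E -> R).
  split; first exact: measurable_indic.
  by apply/bounded_inP; exists 1 => x _; rewrite indicE; case: (_ \in _); rewrite ?normr1 ?normr0.
have := evol_mu st BA; rewrite integral_indic// setIT => <-.
by apply: eq_integral => x _; rewrite (evol_int evol_G _ st BA) integral_indic// setIT.
Qed.

Lemma evol_kernel_invariant t B : 0 <= t -> measurable B -> (\int[nu]_z K t z B = nu B)%E.
Proof.
move=> t0 mB; have mK := measurable_evol_kernel t0 mB.
move: (t0) mK; rewrite le_eqVlt => /predU1P[<- _|{}t0 mK].
  rewrite (eq_integral (fun w => (\1_B w)%:E)).
    by rewrite integral_indic// setIT.
  by move=> w _; rewrite evol_kernel0 diracE indicE.
rewrite (integral_nu mu_measurable nuE)// (nu_disintegration mu_measurable nuE)//.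
rewrite -[RHS](@ge0_integral_shift _ t)//; last exact: measurable_on_slice.
apply: eq_integral => s _; rewrite on_sliceE -(@mu_pts _ s)//.
- by apply: eq_integral => y _; rewrite evol_kernelE /transition t0.
- by rewrite ltrBlDr ltrDl.
- exact: measurable_slice.
Qed.

End EvolutionKernel.

(** * The semigroup on L^p *)

Section ContractionSemigroup.
Context {disp : measure_display} {T : measurableType disp} {R : realType}.
Context {nu : {measure set T -> \bar R}} {p : R} {p1 : (1 <= p%:E)%E}.
Local Notation L := (LspaceType nu p1).
Local Notation dist f g := (Lnorm nu p%:E (fun z => (f z - g z)%:E)).

Let p1' : 1 <= p. Proof. by move: p1; rewrite lee_fin. Qed.

Let mL (F : L) : measurable_fun [set: T] (F : T -> R).
Proof. by have /(Lfun_Ipow _ p1')[] := Lspace_Lfun F. Qed.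

(** The difference is written -1 * H + F, the form in which [sg_linear] applies, and a class is
    chosen for it so that [sg_contraction] applies. *)
Lemma contraction_semigroup_dist (S : R -> L -> L) t (F H : L) :
  C0_positive_contraction_semigroup S -> 0 <= t ->
  (dist (S t F) (S t H) <= dist F H)%E.
Proof.
move=> SG t0.
have DL : (fun z => -1 * H z + F z) \in Lfun nu p%:E.
  rewrite (_ : (fun z => _) = (F : T -> R) - (H : T -> R)).
    by apply: rpredB; exact: Lspace_Lfun.
  by apply/funext => z; rewrite mulN1r addrC.
have [D DE] := @Lspace_of_Lfun _ _ _ _ _ p1 _ DL.
have SD := sg_linear SG t0 DE.
have m1 (A B : L) : measurable_fun [set: T] (fun z => -1 * A z + B z).
  by apply: measurable_funD => //; exact: measurable_funM.
have e1 (A B : L) : (fun z => (B z - A z)%:E) = EFin \o (fun z => -1 * A z + B z).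
  by apply/funext => z /=; rewrite mulN1r addrC.
rewrite !e1 -(ae_eq_Lnorm (mL _) (m1 _ _) DE) -(ae_eq_Lnorm (mL _) (m1 _ _) SD).
exact: sg_contraction.
Qed.

Lemma contraction_semigroup_eq (S S' : R -> L -> L) t (A : set L) :
  C0_positive_contraction_semigroup S -> C0_positive_contraction_semigroup S' ->
  0 <= t -> (forall F, A F -> S t F = S' t F) ->
  (forall (F : L) (e : R), 0 < e -> exists2 H, A H & (dist F H <= e%:E)%E) -> S t = S' t.
Proof.
move=> SG SG' t0 SA dA; apply/funext => F; apply/LspaceP.
apply: (dist_eq0 (p1 := p1)) => //; apply/eqP; rewrite eq_le Lnorm_ge0 andbT.
apply/lee_addgt0Pr => e e0; rewrite add0e.
have e20 : 0 < e / 2 by rewrite divr_gt0.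
have [H AH FH] := dA F _ e20.
apply: (le_trans (@dist_triangle _ _ _ nu p p1 _ _ _ (mL _) (mL (S t H)) (mL _))).
rewrite [e]splitr EFinD leeD//.
  exact: le_trans (contraction_semigroup_dist _ _ SG t0) FH.
rewrite SA// distC; exact: le_trans (contraction_semigroup_dist _ _ SG' t0) FH.
Qed.

End ContractionSemigroup.

Section EvolutionLp.
Context {R : realType} {d : nat}.
Local Notation E := 'rV[R]_d.
Variables (q : R -> E -> 'M[R]_d) (b : R -> E -> E).
Hypotheses (holder_qb : coefficients_holder q b) (elliptic_q : elliptic q)
  (lyapunov_loc : local_lyapunov q b).
Variables (G : R -> R -> (E -> R) -> E -> R) (pts : R -> R -> E -> probability E R).
Hypothesis evol_G : evolution_operator q b G pts.
Variable nu : {measure set (R * E) -> \bar R}.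
Hypothesis nu_slab : forall r, (nu (slab r) < +oo)%E.
Context {p : R} (p1 : 1 <= p).
Local Notation dist f g := (Lnorm nu p%:E (fun z => (f z - g z)%:E)).
Local Notation K := (evol_kernel pts).

(** At (s,x) the operator sees only the slice of f at time s - t, so for t <= 1 the time support
    grows by at most 1. *)
Lemma evolution_semigroup_slab (f : R * E -> R) r t z : Cb f ->
  (forall w, r < `|w.1| -> f w = 0) -> 0 <= t <= 1 -> r + 1 < `|z.1| ->
  evolution_semigroup G t f z = 0.
Proof.
move=> Cf f0 /andP[t0 t1] rz; apply/eqP; rewrite -normr_le0.
apply: (evol_bounded evol_G); first by rewrite gerBl.
  by apply: Cb_Bb; exact: Cb_slice.
move=> y; rewrite f0 ?normr0//=.
have := ler_normB (z.1 - t) (- t); rewrite opprK subrK normrN (ger0_norm t0).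
by move: rz t1; lra.
Qed.

Lemma measurable_evolution_semigroup (f : R * E -> R) t : 0 <= t -> Cb f ->
  measurable_fun [set: R * E] (evolution_semigroup G t f).
Proof.
move=> t0 Cf; rewrite (_ : evolution_semigroup G t f = Kint (K t) f).
  apply: measurable_Kint; first exact: (measurable_evol_kernel holder_qb elliptic_q lyapunov_loc evol_G).
  by apply: continuous_measurable_prod; case: Cf.
by apply/funext => z; rewrite (Kint_evol_kernel evol_G).
Qed.

Lemma cvg_evolution_semigroup (f : R * E -> R) r : Cb f ->
  (forall w, r < `|w.1| -> f w = 0) ->
  dist (Kint (K t) f) f @[t --> 0^'+] --> 0%E.
Proof.
move=> Cf f0; have [cf /bounded_inP[M fM]] := Cf.
have mf : measurable_fun [set: R * E] f by exact: continuous_measurable_prod.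
have TE t : 0 < t -> Kint (K t) f = evolution_semigroup G t f.
  by move=> t0; apply/funext => z; rewrite (Kint_evol_kernel evol_G) ?(ltW t0).
apply: (dominated_dist_cvg_at_right p1 _ mf (slab_Lfun p1 nu_slab (M + M) (r + 1))).
- by move=> t /andP[t0 _]; rewrite TE//; apply: measurable_evolution_semigroup => //; exact: ltW.
- move=> t z /andP[t0 t1]; rewrite TE// indicE; have [zr|zr] := leP `|z.1| (r + 1).
    rewrite mem_set// mulr1 (le_trans _ (ler_norm _))// (le_trans (ler_normB _ _))// lerD//.
      apply: (evol_bounded evol_G); first by rewrite gerBl ltW.
        by apply: Cb_Bb; exact: Cb_slice.
      by move=> y; exact: fM.
    exact: fM.
  rewrite (evolution_semigroup_slab Cf f0) ?(ltW t0)//.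
  by rewrite f0 ?subrr ?normr0// (lt_trans _ zr)// ltrDl.
- move=> z; apply/cvgrPdist_le => e e0.
  have [h0 h00 H] := evolution_semigroup_small_time holder_qb elliptic_q lyapunov_loc evol_G z Cf e0.
  near=> t; have t0 : 0 < t by [].
  have th : t < h0 by near: t; exact: nbhs_right_lt.
  by rewrite TE// distrC; apply: H; rewrite (ltW t0).
Unshelve. all: by end_near. Qed.

Lemma cvg_difference_quotient (f : R * E -> R) : C12c f ->
  dist (fun z => h^-1 * (evolution_semigroup G h f z - f z)) (opG q b f)
    @[h --> 0^'+] --> 0%E.
Proof.
move=> fc; have [T T0 fT] := C12c_time_support q b fc.
have Cf : Cb f.
  split; first exact: C12c_continuous.
  by have [M fM] := C12c_bounded fc; apply/bounded_inP; exists M.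
have mf : measurable_fun [set: R * E] f by apply: continuous_measurable_prod; case: Cf.
have [M gM] := C12c_opG_bounded holder_qb fc.
have mg : measurable_fun [set: R * E] (opG q b f).
  by apply: continuous_measurable_prod; apply: continuous_opG => //; case: fc.
have sol h z : 0 <= h -> exists2 u,
    bounded_classical_solution q b (z.1 - h) (fun y => f (z.1 - h, y)) u &
    evolution_semigroup G h f z = u z.
  move=> h0; have [u us uG] := evol_solution_exists evol_G (z.1 - h) (Cb_slice (z.1 - h) Cf).
  by exists u => //; rewrite /evolution_semigroup uG ?gerBl//; case: z {us uG}.
(* One M bounds the quotient, by [solution_opG_bound], and the other bounds [opG f]. For h <= 1 both
   vanish beyond time T + 1. *)
apply: (dominated_dist_cvg_at_right p1 _ mg (slab_Lfun p1 nu_slab (M + M) (T + 1))).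
- move=> t /andP[t0 _]; apply: measurable_funM => //; apply: measurable_funB => //.
  by apply: measurable_evolution_semigroup => //; exact: ltW.
- move=> h z /andP[h0 h1]; rewrite indicE; have [zr|zr] := leP `|z.1| (T + 1).
    rewrite mem_set// mulr1 (le_trans _ (ler_norm _))// (le_trans (ler_normB _ _))// lerD//.
    have [u us ->] := sol h z (ltW h0).
    have H sg : `|sg| <= 1 -> sg * (u z - f z) <= M * h.
      move=> sg1; have := solution_opG_bound elliptic_q lyapunov_loc (t := z.1) z.2 fc gM sg1 _ us.
      by rewrite subKr gerBl (ltW h0) -surjective_pairing; exact.
    rewrite normrM gtr0_norm ?invr_gt0// mulrC ler_pdivrMr// ler_norml.
    have := H 1; have := H (- 1); rewrite normrN normr1 lexx mul1r mulN1r lerNl.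
    by move=> /(_ isT) -> /(_ isT) ->.
  rewrite (evolution_semigroup_slab Cf (fun w Tw => (fT w Tw).1)) ?(ltW h0)//.
  have Tz : T < `|z.1| by rewrite (lt_trans _ zr)// ltrDl.
  by have [-> ->] := fT z Tz; rewrite !subrr mulr0 subrr normr0.
- move=> z; apply/cvgrPdist_le => e e0.
  have up sg : `|sg| <= 1 -> \forall h \near 0^'+,
      sg * (evolution_semigroup G h f z - f z) <= h * (sg * opG q b f z + e).
    move=> sg1; have [h0 h00 H] := solution_opG_upper holder_qb elliptic_q lyapunov_loc z.1 z.2 fc sg1 e0.
    near=> h; have h1 : 0 < h by [].
    have hh0 : h < h0 by near: h; exact: nbhs_right_lt.
    have [u us ->] := sol h z (ltW h1).
    by have := H h u; rewrite -surjective_pairing; apply => //; rewrite h1.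
  near=> h; have h0 : 0 < h by [].
  have H1 : 1 * (evolution_semigroup G h f z - f z) <= h * (1 * opG q b f z + e).
    by near: h; apply: up; rewrite normr1.
  have H2 : -1 * (evolution_semigroup G h f z - f z) <= h * (-1 * opG q b f z + e).
    by near: h; apply: up; rewrite normrN normr1.
  move: H1 H2; rewrite !mul1r !mulN1r -ler_pdivrMl// -ler_pdivrMl//.
  by rewrite mulrN ler_norml; lra.
Unshelve. all: by end_near. Qed.

End EvolutionLp.

Theorem proposition6p5 (R : realType) (d : nat) (d1 : (1 <= d)%N)
  (q : R -> 'rV[R]_d -> 'M[R]_d) (b : R -> 'rV[R]_d -> 'rV[R]_d)
  (holder_qb : coefficients_holder q b)
  (elliptic_q : elliptic q)
  (lyapunov_loc : local_lyapunov q b)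
  (lyapunov_glob : global_lyapunov q b)
  (G : R -> R -> ('rV[R]_d -> R) -> 'rV[R]_d -> R)
  (pts : R -> R -> 'rV[R]_d -> probability 'rV[R]_d R)
  (evol_G : evolution_operator q b G pts)
  (mu : R -> probability 'rV[R]_d R)
  (evol_mu : evolution_system G mu)
  (mu_measurable : forall A : set 'rV[R]_d, measurable A ->
     measurable_fun [set: R] (fun s => mu s A))
  (nu : {measure set (R * 'rV[R]_d) -> \bar R})
  (nuE : forall (J : set R) (K : set 'rV[R]_d), measurable J -> measurable K ->
     nu (J `*` K) = (\int[lebesgue_measure]_(t in J) mu t K)%E)
  (p : R) (p1 : (1 <= p%:E)%E) :
  exists S : R -> LspaceType nu p1 -> LspaceType nu p1,
    [/\ C0_positive_contraction_semigroup S,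
        extends_Cb S (evolution_semigroup G),
        forall S' : R -> LspaceType nu p1 -> LspaceType nu p1,
          C0_positive_contraction_semigroup S' ->
          extends_Cb S' (evolution_semigroup G) ->
          forall t, 0 <= t -> S' t = S t
      & generator_extends_opG q b S].
Proof.
have p1' : 1 <= p by move: p1; rewrite lee_fin.
have nuoo := nu_slab nuE.
pose K := evol_kernel pts.
have mK t : 0 <= t -> forall B, measurable B ->
    measurable_fun [set: R * 'rV[R]_d] (fun z => K t z B).
  by move=> t0; exact: (measurable_evol_kernel holder_qb elliptic_q lyapunov_loc evol_G).
have invK t : 0 <= t -> forall B, measurable B -> (\int[nu]_z K t z B = nu B)%E.
  move=> t0 B mB.
  exact (evol_kernel_invariant holder_qb elliptic_q lyapunov_loc evol_G evol_mu mu_measurable nuE t0 mB).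
have KD s t : 0 <= s -> 0 <= t -> forall z B, measurable B ->
    K (s + t) z B = (\int[K s z]_w K t w B)%E.
  move=> s0 t0 z B mB.
  exact (evol_kernelD holder_qb elliptic_q lyapunov_loc evol_G z s0 t0 mB).
have K0 z B : measurable B -> K 0 z B = \d_z B by move=> _; exact: evol_kernel0.
have [] := @Kint_semigroup_exists _ _ R nu p p1 K mK invK K0 KD.
  move=> f fL e e0; have [g [Cg [r g0] gL fg]] := Cb_slab_dense p1' nuoo fL e0.
  exists g; split => //.
  exact: (cvg_evolution_semigroup holder_qb elliptic_q lyapunov_loc evol_G nuoo p1' Cg g0).
move=> S [SG SK].
have mCb (f : R * 'rV[R]_d -> R) : Cb f -> measurable_fun [set: R * 'rV[R]_d] f.
  by move=> [cf _]; exact: continuous_measurable_prod.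
have mL (F : LspaceType nu p1) : measurable_fun [set: R * 'rV[R]_d] (F : _ -> R).
  by have /(Lfun_Ipow _ p1')[] := Lspace_Lfun F.
have SE : extends_Cb S (evolution_semigroup G).
  move=> t f F t0 Cf Ff; apply: ae_eq_trans (SK t F t0) _.
  apply: ae_eq_trans (Kint_ae_eq (mK t t0) (invK t t0) (mL F) (mCb f Cf) Ff) _.
  by apply: aeW => z _; rewrite (Kint_evol_kernel evol_G).
exists S; split => //.
- move=> S' SG' SE' t t0.
  (* On the classes with a representative in C_b both semigroups are prescribed, and these classes
     are dense. *)
  apply: (contraction_semigroup_eq (A := [set F | exists2 f, Cb f & F = f %[ae nu]]) SG' SG t0).
    move=> F [f Cf Ff]; apply/LspaceP; apply: ae_eq_trans (SE' t f F t0 Cf Ff) _.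
    exact/ae_eq_sym/SE.
  move=> F e e0; have [g [Cg _ gL Fg]] := Cb_slab_dense p1' nuoo (Lspace_Lfun F) e0.
  have [H Hg] := @Lspace_of_Lfun _ _ _ _ _ p1 _ gL.
  exists H; first by exists g.
  apply: le_trans Fg; rewrite le_eqVlt; apply/orP; left; apply/eqP.
  apply: (ae_eq_dist (mL F) (mL F) (mL H) (mCb g Cg) _ Hg).
  exact: ae_eq_refl.
- move=> f fc; have [T T0 fT] := C12c_time_support q b fc.
  have Cf : Cb f.
    split; first exact: C12c_continuous.
    by have [M fM] := C12c_bounded fc; apply/bounded_inP; exists M.
  have [M fM] := C12c_bounded fc; have [N gN] := C12c_opG_bounded holder_qb fc.
  have mg : measurable_fun [set: R * 'rV[R]_d] (opG q b f).
    by apply: continuous_measurable_prod; apply: continuous_opG => //; case: fc.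
  have [F Ff] := @Lspace_of_Lfun _ _ _ _ _ p1 _
    (bounded_slab_Lfun p1' nuoo (mCb f Cf) fM (fun z Tz => (fT z Tz).1)).
  have [H Hg] := @Lspace_of_Lfun _ _ _ _ _ p1 _
    (bounded_slab_Lfun p1' nuoo mg gN (fun z Tz => (fT z Tz).2)).
  exists F, H; split => //.
  (* The distance depends only on classes modulo nu, so [S h F], F and H may be replaced by T(h) f,
     f and [opG f]. *)
  have := cvg_difference_quotient holder_qb elliptic_q lyapunov_loc evol_G nuoo p1' fc.
  apply: cvg_trans; apply: near_eq_cvg; near=> h.
  have h0 : 0 <= h by apply: ltW.
  have mT := measurable_evolution_semigroup holder_qb elliptic_q lyapunov_loc evol_G h0 Cf.
  apply: ae_eq_dist => //.
  + by apply: measurable_funM => //; apply: measurable_funB => //; exact: mCb.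
  + by apply: measurable_funM => //; apply: measurable_funB.
  + by apply: filterS2 Ff (SE h f F h0 Cf Ff) => z /(_ I) -> /(_ I) -> _.
  + exact: ae_eq_sym.
Unshelve. all: by end_near. Qed.
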